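(* Let $\beta\in(0,\frac{\pi}{2})$, let $a\in C^2(\mathbb{R})$ with $a(\cdot)>0$, and let $k_1,k_2\in C^2([0,\infty)\times[0,\infty),\mathbb{R})$. Let $T>0$ and $b>1$ be given, and assume that $$k_i(t,u)=k_i\big(b^{-2}t+(1-b^{-2})T,\ b^{-1}u\big)\quad\text{for }0\leqslant t<T,\ u\geqslant0\quad(i=1,2)$$ (equivalently, $k_i(T-t',u)=k_i(T-b^{-2}t',b^{-1}u)$ for $0<t'\leqslant T$, $u\geqslant 0$). Assume also that there exists $\sigma\in(0,\tan\beta)$ such that $|k_i(t,u)|\leqslant\tan\beta-\sigma$ for all $t,u\geqslant0$ ($i=1,2$), and that $$\max k_1+\max k_2<0 .$$ Then the free boundary problem (P) $$\left\{\begin{array}{l} u_t=a(u_x)u_{xx},\quad -\xi_1(t)<x<\xi_2(t),\ t>0,\\ u_x(x,t)=-k_1(t,u(x,t)),\ \ u(x,t)=-x\tan\beta\quad\text{for }x=-\xi_1(t),\ t>0,\\ u_x(x,t)=k_2(t,u(x,t)),\ \ u(x,t)=x\tan\beta\quad\text{for }x=\xi_2(t),\ t>0,\end{array}\right.$$ has a discrete shrinking self-similar solution $(\widetilde U,\widetilde\Xi_1,\widetilde\Xi_2)$ on $[0,T)$ (with factor $b$). If in addition $k_i(t,u)\equiv k_i(u)$ ($i=1,2$) does not depend on $t$, then the discrete shrinking self-similar solution on $[0,T)$ is unique, and $\widetilde U_t<0$, $\widetilde\Xi_{1t}<0$, $\widetilde\Xi_{2t}<0$ for $t\in[0,T)$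.
   Context: In problem (P) the unknowns are positive functions $u(x,t)$ (defined for $-\xi_1(t)\leqslant x\leqslant\xi_2(t)$), $\xi_1(t)$ and $\xi_2(t)$; solutions are understood in the classical sense. The maxima are over $[0,\infty)\times[0,\infty)$. Given $T>0$, a solution $(\widetilde U,\widetilde\Xi_1,\widetilde\Xi_2)$ of (P) for $t\in[0,T)$ is called a (discrete) shrinking self-similar solution on $[0,T)$ with factor $b>1$ if $\|\widetilde U(\cdot,t)\|_{L^\infty}\to0$, $\widetilde\Xi_1(t)\to0$, $\widetilde\Xi_2(t)\to0$ as $t\to T-0$, and $$\widetilde U(x,t)=b\,\widetilde U\big(b^{-1}x,\ b^{-2}t+(1-b^{-2})T\big)\quad\text{for }-\widetilde\Xi_1(t)\leqslant x\leqslant\widetilde\Xi_2(t),\ 0\leqslant t<T,$$ $$\widetilde\Xi_i(t)=b\,\widetilde\Xi_i\big(b^{-2}t+(1-b^{-2})T\big)\quad\text{for }0\leqslant t<T\quad(i=1,2).$$ *)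

(* Defs.v *)
From Stdlib Require Import Reals.
From Coquelicot Require Import Coquelicot.
Open Scope R_scope.

(* Derivatives on sets with boundary are expressed with [D_in f f' D x], the
   derivative of [f] at [x] relative to [D] (one-sided at an endpoint). *)

Definition C2_line (a : R -> R) : Prop :=
  forall (n : nat) (p : R), (n <= 2)%nat ->
    ex_derive_n a n p /\ continuous (Derive_n a n) p.

Definition quadrant (z : R * R) : Prop := 0 <= fst z /\ 0 <= snd z.

Definition C1_quadrant (k kt ku : R -> R -> R) : Prop :=
  (forall t u : R, 0 <= t -> 0 <= u ->
     D_in (fun s => k s u) (fun s => kt s u) (fun s => 0 <= s) t /\
     D_in (fun v => k t v) (fun v => ku t v) (fun v => 0 <= v) u) /\
  continuous_on quadrant (fun z : R * R => kt (fst z) (snd z)) /\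
  continuous_on quadrant (fun z : R * R => ku (fst z) (snd z)).

Definition C2_quadrant (k : R -> R -> R) : Prop :=
  exists kt ku ktt ktu kut kuu : R -> R -> R,
    C1_quadrant k kt ku /\ C1_quadrant kt ktt ktu /\ C1_quadrant ku kut kuu.

Definition quadrant_range (k : R -> R -> R) (y : R) : Prop :=
  exists t u : R, 0 <= t /\ 0 <= u /\ y = k t u.

(* Functions of space and time take the arguments in the order [u x t]; only
   their values for [0 <= t < T] and [- xi1 t <= x <= xi2 t] are relevant. *)

Definition time_interval (T t : R) : Prop := 0 <= t < T.

Definition slice (xi1 xi2 : R -> R) (t x : R) : Prop :=
  - xi1 t <= x <= xi2 t.

Definition interior_slice (xi1 xi2 : R -> R) (t x : R) : Prop :=
  - xi1 t < x < xi2 t.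

Definition closed_domain (T : R) (xi1 xi2 : R -> R) (z : R * R) : Prop :=
  time_interval T (snd z) /\ slice xi1 xi2 (snd z) (fst z).

Definition continuous_on_domain (T : R) (xi1 xi2 : R -> R) (f : R -> R -> R) : Prop :=
  continuous_on (closed_domain T xi1 xi2) (fun z : R * R => f (fst z) (snd z)).

Definition C1_time (T : R) (xi dxi : R -> R) : Prop :=
  (forall t : R, time_interval T t -> D_in xi dxi (time_interval T) t) /\
  continuous_on (time_interval T) dxi.

Definition x_derivative (T : R) (xi1 xi2 : R -> R) (f fx : R -> R -> R) : Prop :=
  (forall x t : R, time_interval T t -> slice xi1 xi2 t x ->
     D_in (fun y => f y t) (fun y => fx y t) (slice xi1 xi2 t) x) /\
  continuous_on_domain T xi1 xi2 fx.

(* At a lateral boundary point the set of times [s] for which [(x, s)] lies in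
   the domain can reduce to a single instant, so that the difference quotient
   says nothing there.  On the lateral boundary the time derivative is
   therefore the continuous extension from [- xi1 t < x < xi2 t]. *)
Definition t_derivative (T : R) (xi1 xi2 : R -> R) (f ft : R -> R -> R) : Prop :=
  (forall x t : R, time_interval T t -> interior_slice xi1 xi2 t x ->
     D_in (fun s => f x s) (fun s => ft x s)
       (fun s => time_interval T s /\ slice xi1 xi2 s x) t) /\
  continuous_on_domain T xi1 xi2 ft.

(* Regularity: the free boundaries are C^1 on [0, T) and [u] is C^{2,1} up to
   the boundary of its domain, time t = 0 included. *)
Definition classical_solution (beta : R) (a : R -> R) (k1 k2 : R -> R -> R)
    (T : R) (u : R -> R -> R) (xi1 xi2 : R -> R) : Prop :=
  (forall t : R, time_interval T t -> 0 < xi1 t /\ 0 < xi2 t) /\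
  (forall x t : R, time_interval T t -> slice xi1 xi2 t x -> 0 < u x t) /\
  (exists dxi1 dxi2 : R -> R, C1_time T xi1 dxi1 /\ C1_time T xi2 dxi2) /\
  continuous_on_domain T xi1 xi2 u /\
  exists ux uxx ut : R -> R -> R,
    x_derivative T xi1 xi2 u ux /\
    x_derivative T xi1 xi2 ux uxx /\
    t_derivative T xi1 xi2 u ut /\
    (forall x t : R, 0 < t < T -> interior_slice xi1 xi2 t x ->
       ut x t = a (ux x t) * uxx x t) /\
    (forall t : R, 0 < t < T ->
       ux (- xi1 t) t = - k1 t (u (- xi1 t) t) /\
       u (- xi1 t) t = - (- xi1 t) * tan beta) /\
    (forall t : R, 0 < t < T ->
       ux (xi2 t) t = k2 t (u (xi2 t) t) /\
       u (xi2 t) t = xi2 t * tan beta).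

(* For a solution [u] this supremum is finite, since [u] is continuous on a
   compact interval; it is then the L^oo norm. *)
Definition sup_norm (u : R -> R -> R) (xi1 xi2 : R -> R) (t : R) : R :=
  real (Lub_Rbar (fun y => exists x : R, slice xi1 xi2 t x /\ y = Rabs (u x t))).

Definition rescaled_time (T b t : R) : R := / b ^ 2 * t + (1 - / b ^ 2) * T.

Definition discrete_shrinking_self_similar (beta : R) (a : R -> R)
    (k1 k2 : R -> R -> R) (T b : R) (u : R -> R -> R) (xi1 xi2 : R -> R) : Prop :=
  classical_solution beta a k1 k2 T u xi1 xi2 /\
  filterlim (sup_norm u xi1 xi2) (at_left T) (locally 0) /\
  filterlim xi1 (at_left T) (locally 0) /\
  filterlim xi2 (at_left T) (locally 0) /\
  (forall x t : R, time_interval T t -> slice xi1 xi2 t x ->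
     u x t = b * u (/ b * x) (rescaled_time T b t)) /\
  (forall t : R, time_interval T t ->
     xi1 t = b * xi1 (rescaled_time T b t) /\
     xi2 t = b * xi2 (rescaled_time T b t)).

(* Main.v *)
(** Iterating the scaling relation and letting the argument tend to [(T, 0)] shows that the
    contact slopes [-k1 = P] and [k2 = Q] are constant before [T], with [Q < P].

    Existence.  For [u = s ph(x / u)], [s = sqrt (2 (T - t))], the Legendre transform [w] of the
    profile, as a function of the slope [p], solves [w'' = a(p) / w] on [[Q, P]], and the free
    boundary conditions become the Robin conditions [w'(Q) = - w(Q) / (tau - Q)],
    [w'(P) = w(P) / (tau + P)], [tau = tan beta]; shooting solves this problem.

    Uniqueness.  Let [Th(m)] be the slope of the profile on the ray [x = m u].  A solution satisfies
    [u_x = Th(x / u)]: for the inequality [>=], compare [u_x] with [Th] composed with the Lorentz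
    boosts preserving the cone [sg x^2 = u^2], where [sg] lies strictly between the square of the
    largest slope and [tau^2].  Along such a boosted profile the normalised speed is strictly
    monotone, which makes it a strict barrier, and a boost lowers the slopes at both contact
    points.  Since [u] is only C^{2,1}, [u_x] cannot be inserted in a maximum principle; instead,
    with [f] constant along the boosted profiles, [f(y,t) - f(x,t)] for [x <= y] is minimised over
    one period of the scaling.  The reverse inequality follows by reflection. *)

Require Import Defs.
From Stdlib Require Import Reals Ranalysis5 Lra Lia Psatz Classical ClassicalEpsilon.
From Coquelicot Require Import Coquelicot.
Open Scope R_scope.

(** * Real analysis *)

(** A barrier cannot be reached at once. At a pair x < y with f_x = 0 at both points and f(y) <
    f(x), the source terms must compare strictly in favour of y. For a boosted profile the source is
    -exp(2 (psi - f)) with psi the logarithm of the normalised speed; since psi falls at rate at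
    least c in m = x / u, this needs f(y) - f(x) >= - dl (m_y - m_x) with dl < c, which is what a
    slightly weaker barrier, already established, provides. Hence both comparisons are continuations
    in finitely many small steps. For the bounds Q <= u_x <= P a constant rises to Q; for the boosts
    the parameter decreases from the value that carries the left edge of the cone to its right edge,
    where the barrier is at most Q.

    The boosts act on the ray and leave the slope p unchanged. With this choice the derivative of
    psi is -e (sg - p^2) over a positive factor, whence th0^2 < sg; the condition sg < tau^2 keeps
    the boosts regular on the cone.

    Compactness is available on one period only, because the domain collapses at T. The scaling
    identifies the two ends of the period, so a minimum can always be placed at a positive time. *)

Lemma is_lim_seq_inv_succ : is_lim_seq (fun n => / (INR n + 1)) 0.
Proof.
  apply (is_lim_seq_inv (fun n => INR n + 1) p_infty); [|discriminate].
  apply is_lim_seq_ext with (fun n => INR (S n)).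
  { intro n. apply S_INR. }
  apply -> (is_lim_seq_incr_1 INR). apply is_lim_seq_INR.
Qed.

Lemma bounded_subsequence (x : nat -> R) (M : R) :
  (forall n, Rabs (x n) <= M) ->
  exists (e : nat -> nat) (l : R),
    (forall n, (e n < e (S n))%nat) /\ is_lim_seq (fun n => x (e n)) l.
Proof.
  intros Hb.
  destruct (Bolzano_Weierstrass x (fun c => - M <= c <= M)) as [l Hl].
  { apply compact_P3. }
  { intro n. apply Rabs_le_between, Hb. }
  assert (Hch : forall N k : nat, exists p, (N < p)%nat /\ Rabs (x p - l) < / (INR k + 1)).
  { intros N k.
    assert (Hk : 0 < / (INR k + 1)) by (apply Rinv_0_lt_compat; pose proof (pos_INR k); lra).
    destruct (Hl (disc l (mkposreal _ Hk)) (S N)) as [p [Hp1 Hp2]].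
    - exists (mkposreal _ Hk). intros z Hz. exact Hz.
    - exists p. split; [lia | exact Hp2]. }
  pose (next := fun N k => proj1_sig (constructive_indefinite_description _ (Hch N k))).
  assert (Hnext : forall N k, (N < next N k)%nat /\ Rabs (x (next N k) - l) < / (INR k + 1)).
  { intros N k. unfold next. apply proj2_sig. }
  pose (e := fix e n := match n with O => next O O | S m => next (e m) (S m) end).
  exists e, l. split.
  - intro n. simpl. apply Hnext.
  - assert (He : forall n, Rabs (x (e n) - l) < / (INR n + 1)).
    { intros [|n]; [apply (Hnext O O) | apply (Hnext (e n) (S n))]. }
    assert (Hlim : is_lim_seq (fun n => / (INR n + 1)) 0).
    { exact is_lim_seq_inv_succ. }
    apply is_lim_seq_spec in Hlim. apply is_lim_seq_spec. intros eps.
    destruct (Hlim eps) as [N HN].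
    exists N. intros n Hn. specialize (HN n Hn). specialize (He n).
    rewrite Rminus_0_r in HN. apply Rabs_lt_between in HN. lra.
Qed.

Lemma extraction_ge (e : nat -> nat) :
  (forall n, (e n < e (S n))%nat) -> forall n, (n <= e n)%nat.
Proof. intros He n. induction n; [lia | specialize (He n); lia]. Qed.

Lemma is_lim_seq_extraction (u : nat -> R) (l : Rbar) (e : nat -> nat) :
  (forall n, (e n < e (S n))%nat) -> is_lim_seq u l -> is_lim_seq (fun n => u (e n)) l.
Proof.
  intros He Hu. apply (is_lim_seq_subseq u l e); [|exact Hu].
  apply eventually_subseq. exact He.
Qed.

Lemma compact_min3 (K : R -> R -> R -> Prop) (F : R -> R -> R -> R) (M : R) :
  (forall x y t, K x y t -> Rabs x <= M /\ Rabs y <= M /\ Rabs t <= M) ->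
  (forall (xn yn tn : nat -> R) (x y t : R),
     (forall n, K (xn n) (yn n) (tn n)) ->
     is_lim_seq xn x -> is_lim_seq yn y -> is_lim_seq tn t ->
     K x y t /\ is_lim_seq (fun n => F (xn n) (yn n) (tn n)) (F x y t)) ->
  (exists x y t, K x y t) ->
  exists x y t, K x y t /\ forall x' y' t', K x' y' t' -> F x y t <= F x' y' t'.
Proof.
  intros HM Hc [x0 [y0 [t0 HK0]]].
  (* No lower bound on [F] is known beforehand. Passing to [atan] makes the supremum exist, and
     strict monotonicity brings the minimum back to [F]. *)
  pose (E := fun v => exists x y t, K x y t /\ v = - atan (F x y t)).
  destruct (completeness E) as [L [HL1 HL2]].
  { exists (PI / 2). intros v [x [y [t [_ ->]]]]. pose proof (atan_bound (F x y t)). lra. }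
  { exists (- atan (F x0 y0 t0)), x0, y0, t0. split; auto. }
  assert (Hn : forall n : nat, exists p : R * R * R,
    K (fst (fst p)) (snd (fst p)) (snd p) /\
    L - / (INR n + 1) < - atan (F (fst (fst p)) (snd (fst p)) (snd p))).
  { intro n. apply NNPP. intro Hno.
    assert (Hp : 0 < / (INR n + 1)) by (apply Rinv_0_lt_compat; pose proof (pos_INR n); lra).
    assert (is_upper_bound E (L - / (INR n + 1))).
    { intros v [x [y [t [HK ->]]]]. apply Rnot_lt_le. intro Hlt.
      apply Hno. exists (x, y, t). simpl. auto. }
    specialize (HL2 _ H). lra. }
  pose (p := fun n => proj1_sig (constructive_indefinite_description _ (Hn n))).
  assert (Hp : forall n, K (fst (fst (p n))) (snd (fst (p n))) (snd (p n)) /\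
    L - / (INR n + 1) < - atan (F (fst (fst (p n))) (snd (fst (p n))) (snd (p n)))).
  { intro n. unfold p. apply proj2_sig. }
  clearbody p.
  destruct (bounded_subsequence (fun n => fst (fst (p n))) M) as [e1 [x [He1 Hx]]].
  { intro n. apply (HM _ _ _ (proj1 (Hp n))). }
  destruct (bounded_subsequence (fun n => snd (fst (p (e1 n)))) M) as [e2 [y [He2 Hy]]].
  { intro n. apply (HM _ _ _ (proj1 (Hp (e1 n)))). }
  destruct (bounded_subsequence (fun n => snd (p (e1 (e2 n)))) M) as [e3 [t [He3 Ht]]].
  { intro n. apply (HM _ _ _ (proj1 (Hp (e1 (e2 n))))). }
  pose (e := fun n => e1 (e2 (e3 n))).
  assert (Hge : forall n, (n <= e n)%nat).
  { intro n. unfold e. pose proof (extraction_ge _ He3 n).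
    pose proof (extraction_ge _ He2 (e3 n)). pose proof (extraction_ge _ He1 (e2 (e3 n))). lia. }
  destruct (Hc (fun n => fst (fst (p (e n)))) (fun n => snd (fst (p (e n))))
              (fun n => snd (p (e n))) x y t) as [HK HF].
  { intro n. apply Hp. }
  { apply (is_lim_seq_extraction (fun n => fst (fst (p (e1 (e2 n))))) x e3 He3).
    apply (is_lim_seq_extraction (fun n => fst (fst (p (e1 n)))) x e2 He2 Hx). }
  { apply (is_lim_seq_extraction (fun n => snd (fst (p (e1 (e2 n))))) y e3 He3 Hy). }
  { exact Ht. }
  exists x, y, t. split; [exact HK|].
  intros x' y' t' HK'. apply Rnot_lt_le. intro Hlt.
  apply atan_increasing in Hlt.
  assert (Hl : - atan (F x' y' t') <= L) by (apply HL1; exists x', y', t'; auto).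
  assert (Hat : is_lim_seq (fun n => atan (F (fst (fst (p (e n)))) (snd (fst (p (e n)))) (snd (p (e n)))))
                 (atan (F x y t))).
  { apply is_lim_seq_continuous; [|exact HF].
    apply continuity_pt_filterlim, continuous_atan. }
  assert (Hle : Rbar_le (Finite (atan (F x y t))) (Finite (- L))).
  { apply (is_lim_seq_le (fun n => atan (F (fst (fst (p (e n)))) (snd (fst (p (e n)))) (snd (p (e n)))))
             (fun n => - L + / (INR n + 1))).
    - intro n. destruct (Hp (e n)) as [_ H].
      assert (/ (INR (e n) + 1) <= / (INR n + 1)).
      { apply Rinv_le_contravar; [pose proof (pos_INR n); lra|].
        pose proof (le_INR _ _ (Hge n)). lra. }
      lra.
    - exact Hat.
    - replace (Finite (- L)) with (Finite (- L + 0)) by (f_equal; ring). apply is_lim_seq_plus'; [apply is_lim_seq_const|].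
      exact is_lim_seq_inv_succ. }
  simpl in Hle. lra.
Qed.

Lemma locally_between (a b x : R) (P : R -> Prop) :
  a < x < b -> (forall y, a < y < b -> P y) -> locally x P.
Proof.
  intros Hx HP.
  assert (Hd : 0 < Rmin (x - a) (b - x)) by (apply Rmin_pos; lra).
  exists (mkposreal _ Hd). intros y Hy. apply HP.
  assert (Hy' : Rabs (y - x) < Rmin (x - a) (b - x)) by exact Hy.
  pose proof (Rmin_l (x - a) (b - x)). pose proof (Rmin_r (x - a) (b - x)).
  apply Rabs_lt_between in Hy'. lra.
Qed.

Lemma is_derive_continuity (f : R -> R) (x l : R) : is_derive f x l -> continuity_pt f x.
Proof.
  intro H. apply continuity_pt_filterlim, (ex_derive_continuous f x). exists l. exact H.
Qed.

Lemma is_derive_quotient (f : R -> R) (x l eps : R) :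
  is_derive f x l -> 0 < eps ->
  exists d, 0 < d /\ forall y, Rabs (y - x) < d -> y <> x ->
    Rabs ((f y - f x) / (y - x) - l) < eps.
Proof.
  intros H Heps. apply is_derive_Reals in H. destruct (H eps Heps) as [d Hd].
  exists d. split; [apply cond_pos|]. intros y Hy Hyx.
  specialize (Hd (y - x)). replace (x + (y - x)) with y in Hd by ring.
  apply Hd; [lra | exact Hy].
Qed.

Lemma derive_sign_right (f : R -> R) (x l : R) :
  is_derive f x l -> 0 < l ->
  exists d, 0 < d /\ (forall y, x < y < x + d -> f x < f y) /\ (forall y, x - d < y < x -> f y < f x).
Proof.
  intros H Hl. destruct (is_derive_quotient f x l l H Hl) as [d [Hd Hq]].
  exists d. split; [exact Hd|].
  assert (Hpos : forall y, Rabs (y - x) < d -> y <> x -> 0 < (f y - f x) / (y - x)).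
  { intros y Hy Hne. specialize (Hq y Hy Hne). apply Rabs_lt_between in Hq. lra. }
  split; intros y Hy.
  - assert (Hq' : 0 < (f y - f x) / (y - x)) by (apply Hpos; [apply Rabs_lt_between; lra | lra]).
    replace (f y) with (f x + (f y - f x) / (y - x) * (y - x)) by (field; lra). nra.
  - assert (Hq' : 0 < (f y - f x) / (y - x)) by (apply Hpos; [apply Rabs_lt_between; lra | lra]).
    replace (f y) with (f x + (f y - f x) / (y - x) * (y - x)) by (field; lra). nra.
Qed.

Lemma increasing_of_derive_pos (f df : R -> R) (a b : R) :
  a < b ->
  (forall x, a < x < b -> is_derive f x (df x)) ->
  (forall x, a <= x <= b -> continuity_pt f x) ->
  (forall x, a < x < b -> 0 < df x) -> f a < f b.
Proof.
  intros Hab Hd Hc Hp.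
  assert (pr1 : forall c, a < c < b -> derivable_pt f c).
  { intros c Hcc. exists (df c). apply is_derive_Reals, Hd, Hcc. }
  assert (pr2 : forall c, a < c < b -> derivable_pt id c).
  { intros c _. apply derivable_pt_id. }
  destruct (MVT f id a b pr1 pr2 Hab Hc) as [c [P Heq]].
  { intros c _. apply derivable_continuous_pt, derivable_pt_id. }
  unfold id in Heq at 1 2.
  rewrite (derive_pt_eq_0 f c (df c) (pr1 c P)) in Heq by (apply is_derive_Reals, Hd, P).
  rewrite (derive_pt_eq_0 id c 1 (pr2 c P)) in Heq by apply derivable_pt_lim_id.
  pose proof (Hp c P). nra.
Qed.

Lemma derive_zero_of_local_min (f : R -> R) (x l d : R) :
  0 < d -> (forall y, x - d < y < x + d -> f x <= f y) -> is_derive f x l -> l = 0.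
Proof.
  intros Hd Hmin H. destruct (Rtotal_order l 0) as [Hl|[Hl|Hl]]; [|exact Hl|].
  - apply is_derive_opp in H. simpl in H.
    destruct (derive_sign_right _ _ _ H) as [e [He [H1 _]]].
    { change (0 < - l). lra. }
    specialize (H1 (x + Rmin d e / 2)). specialize (Hmin (x + Rmin d e / 2)).
    pose proof (Rmin_pos d e Hd He). pose proof (Rmin_l d e). pose proof (Rmin_r d e).
    change (opp (f x)) with (- f x) in H1.
    change (opp (f (x + Rmin d e / 2))) with (- f (x + Rmin d e / 2)) in H1.
    lra.
  - destruct (derive_sign_right _ _ _ H Hl) as [e [He [_ H1]]].
    specialize (H1 (x - Rmin d e / 2)). specialize (Hmin (x - Rmin d e / 2)).
    pose proof (Rmin_pos d e Hd He). pose proof (Rmin_l d e). pose proof (Rmin_r d e).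
    lra.
Qed.

Lemma second_derive_of_local_min (f df : R -> R) (x l d : R) :
  0 < d -> (forall y, x - d < y < x + d -> f x <= f y) ->
  (forall y, x - d < y < x + d -> is_derive f y (df y)) -> is_derive df x l -> 0 <= l.
Proof.
  intros Hd Hmin Hf H. apply Rnot_lt_le. intro Hl.
  assert (H0 : df x = 0).
  { apply (derive_zero_of_local_min f x (df x) d Hd Hmin). apply Hf. lra. }
  apply is_derive_opp in H.
  destruct (derive_sign_right _ _ _ H) as [e [He [H1 _]]].
  { change (0 < - l). lra. }
  pose proof (Rmin_pos d e Hd He). pose proof (Rmin_l d e). pose proof (Rmin_r d e).
  set (y := x + Rmin d e / 2).
  assert (Hy : f x <= f y) by (apply Hmin; unfold y; lra).
  assert (- f x < - f y); [|lra].
  apply (increasing_of_derive_pos (fun z => - f z) (fun z => - df z)).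
  - unfold y; lra.
  - intros z Hz. apply (is_derive_opp f). apply Hf. unfold y in Hz; lra.
  - intros z Hz. apply continuity_pt_opp. apply (is_derive_continuity f z (df z)).
    apply Hf. unfold y in Hz; lra.
  - intros z Hz. assert (Hlt : - df x < - df z) by (apply H1; unfold y in Hz; lra). lra.
Qed.

(** One-sided, because a parabolic minimum over a period may sit at its final time and is compared
    with the past only. *)
Lemma derive_le_zero_of_left_min (f : R -> R) (t l d : R) :
  0 < d -> (forall s, t - d < s <= t -> f t <= f s) -> is_derive f t l -> l <= 0.
Proof.
  intros Hd Hmin H. apply Rnot_lt_le. intro Hl.
  destruct (derive_sign_right _ _ _ H Hl) as [e [He [_ H1]]].
  pose proof (Rmin_pos d e Hd He). pose proof (Rmin_l d e). pose proof (Rmin_r d e).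
  assert (f t <= f (t - Rmin d e / 2)) by (apply Hmin; lra).
  assert (f (t - Rmin d e / 2) < f t) by (apply H1; lra). lra.
Qed.

Lemma nondecreasing_of_derive (f df : R -> R) (a b : R) :
  a <= b -> (forall x, a <= x <= b -> is_derive f x (df x)) ->
  (forall x, a <= x <= b -> 0 <= df x) -> f a <= f b.
Proof.
  intros Hab Hd Hp. destruct (Req_dec a b) as [->|Hne]; [lra|].
  destruct (MVT_cor2 f df a b) as [c [H1 H2]]; [lra| |].
  - intros c Hc. apply is_derive_Reals, Hd, Hc.
  - assert (0 <= df c) by (apply Hp; lra). nra.
Qed.

Lemma derive_nonneg_of_monotone (f : R -> R) (x l d : R) :
  0 < d -> (forall y, x < y < x + d -> f x <= f y) -> is_derive f x l -> 0 <= l.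
Proof.
  intros Hd Hm H. apply Rnot_lt_le. intro Hl. apply is_derive_opp in H.
  destruct (derive_sign_right _ _ _ H) as [e [He [H1 _]]].
  { change (0 < - l). lra. }
  pose proof (Rmin_pos d e Hd He). pose proof (Rmin_l d e). pose proof (Rmin_r d e).
  assert (f x <= f (x + Rmin d e / 2)) by (apply Hm; lra).
  assert (Hlt : - f x < - f (x + Rmin d e / 2)) by (apply H1; lra). lra.
Qed.

Lemma continuous_bounded (f : R -> R) (a b : R) :
  (forall x, continuous f x) -> exists M, 0 < M /\ forall x, a <= x <= b -> Rabs (f x) <= M.
Proof.
  intro Hf. destruct (Rle_lt_dec a b) as [Hab|Hab].
  - assert (Hc : forall c, a <= c <= b -> continuity_pt (fun x => Rabs (f x)) c).
    { intros c _. apply (continuity_pt_comp f Rabs).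
      - apply continuity_pt_filterlim, Hf.
      - apply Rcontinuity_abs. }
    destruct (continuity_ab_maj (fun x => Rabs (f x)) a b Hab Hc) as [m [Hm _]].
    exists (Rabs (f m) + 1). split; [pose proof (Rabs_pos (f m)); lra|].
    intros x Hx. specialize (Hm x Hx). simpl in Hm. lra.
  - exists 1. split; [lra|]. intros x Hx. lra.
Qed.

Lemma continuous_pos_bounded_below (f : R -> R) (a b : R) :
  (forall x, continuous f x) -> (forall x, 0 < f x) ->
  exists m, 0 < m /\ forall x, a <= x <= b -> m <= f x.
Proof.
  intros Hf Hp. destruct (Rle_lt_dec a b) as [Hab|Hab].
  - assert (Hc : forall c, a <= c <= b -> continuity_pt f c).
    { intros c _. apply continuity_pt_filterlim, Hf. }
    destruct (continuity_ab_min f a b Hab Hc) as [m [Hm _]].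
    exists (f m). split; [apply Hp | exact Hm].
  - exists 1. split; [lra|]. intros x Hx. lra.
Qed.

Lemma is_derive_linear (k x : R) : is_derive (fun y => k * y) x k.
Proof. auto_derive; [trivial | ring]. Qed.

Lemma continuous_of_nonexpansive (f : R -> R) (x : R) :
  (forall y, Rabs (f y - f x) <= Rabs (y - x)) -> continuous f x.
Proof.
  intro H. apply continuity_pt_filterlim. intros eps Heps. exists eps. split; [exact Heps|].
  intros y [_ Hy]. eapply Rle_lt_trans; [apply H | exact Hy].
Qed.

Lemma is_lim_seq_between (u : nat -> R) (l a b : R) :
  (forall n, a <= u n <= b) -> is_lim_seq u l -> a <= l <= b.
Proof.
  intros H Hl. split.
  - apply (is_lim_seq_le (fun _ => a) u a l); [apply H | apply is_lim_seq_const | exact Hl].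
  - apply (is_lim_seq_le u (fun _ => b) l b); [apply H | exact Hl | apply is_lim_seq_const].
Qed.

(** * Shrinking domains *)

Definition time_continuous (T : R) (xi : R -> R) : Prop :=
  forall t eps : R, time_interval T t -> 0 < eps ->
    exists d, 0 < d /\ forall s, time_interval T s -> Rabs (s - t) < d -> Rabs (xi s - xi t) < eps.

(** Sequential, since it is combined with minimising sequences in a domain that moves with time. *)
Definition domain_continuous (T : R) (xi1 xi2 : R -> R) (f : R -> R -> R) : Prop :=
  forall (xn tn : nat -> R) (x t : R),
    (forall n, closed_domain T xi1 xi2 (xn n, tn n)) -> closed_domain T xi1 xi2 (x, t) ->
    is_lim_seq xn x -> is_lim_seq tn t -> is_lim_seq (fun n => f (xn n) (tn n)) (f x t).

Definition shrinking_domain (T b : R) (xi1 xi2 : R -> R) : Prop :=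
  0 < T /\ 1 < b /\
  (forall t, time_interval T t -> 0 < xi1 t /\ 0 < xi2 t) /\
  (forall t, time_interval T t ->
     xi1 t = b * xi1 (rescaled_time T b t) /\ xi2 t = b * xi2 (rescaled_time T b t)) /\
  time_continuous T xi1 /\ time_continuous T xi2.

Lemma time_continuous_seq (T : R) (xi : R -> R) (tn : nat -> R) (t : R) :
  time_continuous T xi -> (forall n, time_interval T (tn n)) -> time_interval T t ->
  is_lim_seq tn t -> is_lim_seq (fun n => xi (tn n)) (xi t).
Proof.
  intros Hxi Htn Ht Hl. apply is_lim_seq_spec. intro eps.
  destruct (Hxi t eps Ht (cond_pos eps)) as [d [Hd Hc]].
  apply is_lim_seq_spec in Hl. destruct (Hl (mkposreal d Hd)) as [N HN].
  exists N. intros n Hn. apply Hc; [apply Htn | exact (HN n Hn)].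
Qed.

Lemma domain_continuous_slice (T : R) (xi1 xi2 : R -> R) (f : R -> R -> R) (z t : R) :
  domain_continuous T xi1 xi2 f -> time_interval T t -> slice xi1 xi2 t z ->
  forall d, 0 < d -> exists e, 0 < e /\
    forall z', slice xi1 xi2 t z' -> Rabs (z' - z) < e -> Rabs (f z' t - f z t) < d.
Proof.
  intros Hcont Tt Hz d Hd. apply NNPP. intro Hno.
  assert (Hseq : forall n : nat, exists z', slice xi1 xi2 t z' /\
     Rabs (z' - z) < / (INR n + 1) /\ d <= Rabs (f z' t - f z t)).
  { intro n. apply NNPP. intro Hn. apply Hno. exists (/ (INR n + 1)).
    split; [apply Rinv_0_lt_compat; pose proof (pos_INR n); lra|].
    intros z' H1 H2. apply Rnot_le_lt. intro H3. apply Hn. exists z'. auto. }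
  pose (zn := fun n => proj1_sig (constructive_indefinite_description _ (Hseq n))).
  assert (Hzn : forall n, slice xi1 xi2 t (zn n) /\
     Rabs (zn n - z) < / (INR n + 1) /\ d <= Rabs (f (zn n) t - f z t)).
  { intro n. unfold zn. apply proj2_sig. }
  assert (Hlim : is_lim_seq (fun n => f (zn n) t) (f z t)).
  { apply (Hcont zn (fun _ => t) z t).
    - intro n. split; [exact Tt | apply Hzn].
    - split; [exact Tt | exact Hz].
    - apply is_lim_seq_spec. intros e.
      assert (Hl0 : is_lim_seq (fun n => / (INR n + 1)) 0).
      { exact is_lim_seq_inv_succ. }
      apply is_lim_seq_spec in Hl0. destruct (Hl0 e) as [N HN]. exists N.
      intros n Hn. specialize (HN n Hn). destruct (Hzn n) as (_ & H & _).
      rewrite Rminus_0_r in HN. apply Rabs_lt_between in HN. lra.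
    - apply is_lim_seq_const. }
  apply is_lim_seq_spec in Hlim. destruct (Hlim (mkposreal d Hd)) as [N HN].
  specialize (HN N (Nat.le_refl N)). destruct (Hzn N) as (_ & _ & H). simpl in HN. lra.
Qed.

Lemma rescaled_time_diff (T b t : R) : T - rescaled_time T b t = / b ^ 2 * (T - t).
Proof. unfold rescaled_time. ring. Qed.

Lemma inv_sq_bounds (b : R) : 1 < b -> 0 < / b ^ 2 < 1.
Proof.
  intro Hb. assert (1 < b ^ 2) by nra. split.
  - apply Rinv_0_lt_compat; lra.
  - rewrite <- Rinv_1. apply Rinv_lt_contravar; lra.
Qed.

Lemma rescaled_time_bounds (T b t : R) :
  1 < b -> t < T -> t < rescaled_time T b t < T.
Proof.
  intros Hb Ht. pose proof (rescaled_time_diff T b t). pose proof (inv_sq_bounds b Hb). nra.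
Qed.

Lemma rescaled_time_interval (T b t : R) :
  1 < b -> time_interval T t -> time_interval T (rescaled_time T b t).
Proof.
  intros Hb [H1 H2]. pose proof (rescaled_time_bounds T b t Hb H2). split; lra.
Qed.

(** The map multiplies [T - t] by [/ b ^ 2], so its iterates of the first period cover [0, T). The
    induction runs on the number of periods, controlled by [T * q ^ n <= T - t]. *)
Lemma rescaled_time_induction (T b : R) (P : R -> Prop) :
  0 < T -> 1 < b ->
  (forall t, 0 <= t <= rescaled_time T b 0 -> P t) ->
  (forall t, time_interval T t -> P t -> P (rescaled_time T b t)) ->
  forall t, time_interval T t -> P t.
Proof.
  intros HT Hb Hbase Hstep.
  pose proof (inv_sq_bounds b Hb) as Hq. set (q := / b ^ 2) in *.
  assert (Hn : forall (n : nat) t, time_interval T t -> T * q ^ n <= T - t -> P t).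
  { induction n as [|n IH]; intros t [Ht1 Ht2] Hle.
    - apply Hbase. simpl in Hle. pose proof (rescaled_time_bounds T b 0 Hb HT). lra.
    - destruct (Rle_lt_dec t (rescaled_time T b 0)) as [Hc|Hc].
      + apply Hbase. lra.
      + assert (Hb2 : q * b ^ 2 = 1) by (unfold q; field; lra).
        (* A time beyond the first period is the image of [T - b ^ 2 * (T - t)], which is still
           nonnegative. *)
        assert (Hbt : t = rescaled_time T b (T - b ^ 2 * (T - t))).
        { unfold rescaled_time. fold q. replace (q * (T - b ^ 2 * (T - t)))
            with (q * T - (q * b ^ 2) * (T - t)) by ring. rewrite Hb2. ring. }
        pose proof (rescaled_time_diff T b 0) as H0. fold q in H0.
        assert (0 < b ^ 2) by nra.
        assert (Hti : time_interval T (T - b ^ 2 * (T - t))).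
        { split; [|nra]. assert (T - t <= q * T) by lra.
          assert (b ^ 2 * (T - t) <= b ^ 2 * (q * T)) by nra.
          replace (b ^ 2 * (q * T)) with (q * b ^ 2 * T) in H2 by ring.
          rewrite Hb2 in H2. lra. }
        rewrite Hbt. apply Hstep; [exact Hti|]. apply IH; [exact Hti|].
        simpl in Hle. replace (T * q ^ n) with (b ^ 2 * (T * (q * q ^ n))).
        * replace (T - (T - b ^ 2 * (T - t))) with (b ^ 2 * (T - t)) by ring. nra.
        * replace (b ^ 2 * (T * (q * q ^ n))) with ((q * b ^ 2) * (T * q ^ n)) by ring.
          rewrite Hb2. ring. }
  intros t Ht. destruct (pow_lt_1_zero q) with (y := (T - t) / T) as [N HN].
  { rewrite Rabs_pos_eq; lra. }
  { destruct Ht. apply Rdiv_lt_0_compat; lra. }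
  apply (Hn N t Ht). specialize (HN N (Nat.le_refl N)).
  rewrite Rabs_pos_eq in HN by (apply pow_le; lra).
  assert (T * q ^ N < T * ((T - t) / T)) by nra.
  replace (T * ((T - t) / T)) with (T - t) in H by (field; lra). lra.
Qed.

Section Shrinking_domain.

Variables (T b : R) (xi1 xi2 : R -> R).
Hypothesis Hdom : shrinking_domain T b xi1 xi2.

Lemma slice_rescale (x t : R) :
  time_interval T t ->
  (slice xi1 xi2 t x <-> slice xi1 xi2 (rescaled_time T b t) (/ b * x)).
Proof.
  destruct Hdom as (HT & Hb & _ & Hs & _). intro Ht.
  destruct (Hs t Ht) as [E1 E2]. unfold slice. rewrite E1, E2.
  set (p := xi1 _). set (q := xi2 _).
  assert (Hx : x = b * (/ b * x)) by (field; lra). set (y := / b * x) in *. rewrite Hx.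
  split; intros [H1 H2]; split; nra.
Qed.

Lemma interior_slice_rescale (x t : R) :
  time_interval T t ->
  (interior_slice xi1 xi2 t x <-> interior_slice xi1 xi2 (rescaled_time T b t) (/ b * x)).
Proof.
  destruct Hdom as (HT & Hb & _ & Hs & _). intro Ht.
  destruct (Hs t Ht) as [E1 E2]. unfold interior_slice. rewrite E1, E2.
  set (p := xi1 _). set (q := xi2 _).
  assert (Hx : x = b * (/ b * x)) by (field; lra). set (y := / b * x) in *. rewrite Hx.
  split; intros [H1 H2]; split; nra.
Qed.

Lemma interior_slice_open (x t : R) :
  time_interval T t -> interior_slice xi1 xi2 t x ->
  exists d, 0 < d /\ forall s, time_interval T s -> Rabs (s - t) < d -> interior_slice xi1 xi2 s x.
Proof.
  destruct Hdom as (HT & Hb & _ & _ & H1 & H2). intros Ht [Hx1 Hx2].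
  destruct (H1 t (x + xi1 t) Ht) as [d1 [Hd1 Hc1]]; [lra|].
  destruct (H2 t (xi2 t - x) Ht) as [d2 [Hd2 Hc2]]; [lra|].
  exists (Rmin d1 d2). split; [apply Rmin_pos; lra|].
  intros s Hs Hst. pose proof (Rmin_l d1 d2). pose proof (Rmin_r d1 d2).
  specialize (Hc1 s Hs ltac:(lra)). specialize (Hc2 s Hs ltac:(lra)).
  apply Rabs_lt_between in Hc1. apply Rabs_lt_between in Hc2. split; lra.
Qed.

(** The period is closed: its last time is the image of time 0, and the set is compact. *)
Definition pairs (x y t : R) : Prop :=
  0 <= t <= rescaled_time T b 0 /\ - xi1 t <= x /\ x <= y /\ y <= xi2 t.

Lemma first_period_in_time (t : R) : 0 <= t <= rescaled_time T b 0 -> time_interval T t.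
Proof.
  destruct Hdom as (HT & Hb & _). pose proof (rescaled_time_bounds T b 0 Hb HT).
  intros H'. split; lra.
Qed.

Lemma time_continuous_bounded (xi : R -> R) :
  time_continuous T xi -> exists M, forall t, 0 <= t <= rescaled_time T b 0 -> xi t <= M.
Proof.
  intro Hxi. destruct Hdom as (HT & Hb & _).
  (* Only the time matters here; the two space coordinates are frozen at 0. *)
  destruct (compact_min3 (fun x y t => 0 <= x <= 0 /\ 0 <= y <= 0 /\ 0 <= t <= rescaled_time T b 0)
              (fun x y t => - xi t) T) as (x & y & t & _ & Hm).
  - intros x y t (Hx & Hy & Ht). destruct (first_period_in_time t Ht).
    repeat split; apply Rabs_le_between; lra.
  - intros xn yn tn x y t HK Lx Ly Lt.
    assert (Ht : 0 <= t <= rescaled_time T b 0).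
    { apply (is_lim_seq_between tn t); [intro n; apply HK | exact Lt]. }
    split; [split; [|split; [|exact Ht]]|].
    + apply (is_lim_seq_between xn x); [intro n; apply HK | exact Lx].
    + apply (is_lim_seq_between yn y); [intro n; apply HK | exact Ly].
    + apply (is_lim_seq_opp (fun n => xi (tn n)) (xi t)).
      apply (time_continuous_seq T); auto.
      * intro n. apply first_period_in_time, HK.
      * apply first_period_in_time, Ht.
  - exists 0, 0, 0. pose proof (rescaled_time_bounds T b 0 Hb HT). repeat split; lra.
  - exists (xi t). intros s Hs. specialize (Hm 0 0 s ltac:(repeat split; lra)). simpl in Hm. lra.
Qed.

Lemma pairs_min (F : R -> R -> R -> R) :
  (forall (xn yn tn : nat -> R) (x y t : R),
     (forall n, pairs (xn n) (yn n) (tn n)) -> pairs x y t ->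
     is_lim_seq xn x -> is_lim_seq yn y -> is_lim_seq tn t ->
     is_lim_seq (fun n => F (xn n) (yn n) (tn n)) (F x y t)) ->
  exists x y t, pairs x y t /\ forall x' y' t', pairs x' y' t' -> F x y t <= F x' y' t'.
Proof.
  intros HF. destruct Hdom as (HT & Hb & Hpos & _ & Hc1 & Hc2).
  destruct (time_continuous_bounded xi1 Hc1) as [M1 HM1].
  destruct (time_continuous_bounded xi2 Hc2) as [M2 HM2].
  pose proof (rescaled_time_bounds T b 0 Hb HT) as Hr.
  apply (compact_min3 pairs F (Rabs M1 + Rabs M2 + T)).
  - intros x y t (Ht & H1 & H2 & H3). specialize (HM1 t Ht). specialize (HM2 t Ht).
    pose proof (Rle_abs M1). pose proof (Rle_abs M2).
    pose proof (Rabs_pos M1). pose proof (Rabs_pos M2).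
    repeat split; apply Rabs_le_between; lra.
  - intros xn yn tn x y t HK Hx Hy Ht.
    assert (Ht' : 0 <= t <= rescaled_time T b 0).
    { apply (is_lim_seq_between tn t); [intro n; apply HK | exact Ht]. }
    assert (Htn : forall n, time_interval T (tn n)).
    { intro n. apply first_period_in_time, HK. }
    assert (Hti := first_period_in_time t Ht').
    assert (HP : pairs x y t).
    { split; [exact Ht'|]. split; [|split].
      - apply (is_lim_seq_le (fun n => - xi1 (tn n)) xn (- xi1 t) x).
        + intro n. apply HK.
        + apply (is_lim_seq_opp (fun n => xi1 (tn n)) (xi1 t)).
          apply (time_continuous_seq T); auto.
        + exact Hx.
      - apply (is_lim_seq_le xn yn x y); auto. intro n. apply HK.
      - apply (is_lim_seq_le yn (fun n => xi2 (tn n)) y (xi2 t)); auto.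
        + intro n. apply HK.
        + apply (time_continuous_seq T); auto. }
    split; [exact HP|]. apply HF; auto.
  - exists 0, 0, 0. pose proof (Hpos 0 ltac:(split; lra)). repeat split; lra.
Qed.

End Shrinking_domain.

(* Two-point maximum principle: the minimum over one time period of
   [f y t - f x t], [x <= y], cannot be negative. *)
Lemma monotone_of_two_point (T b : R) (xi1 xi2 : R -> R) (f fx : R -> R -> R) :
  shrinking_domain T b xi1 xi2 ->
  domain_continuous T xi1 xi2 f ->
  (forall x t, 0 < t < T -> interior_slice xi1 xi2 t x ->
     is_derive (fun y => f y t) x (fx x t)) ->
  (forall t, 0 < t < T -> exists eps, 0 < eps /\ forall x, interior_slice xi1 xi2 t x ->
     x < - xi1 t + eps \/ xi2 t - eps < x -> 0 < fx x t) ->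
  (forall x y t, time_interval T t -> slice xi1 xi2 t x -> slice xi1 xi2 t y ->
     f y t - f x t = f (/ b * y) (rescaled_time T b t) - f (/ b * x) (rescaled_time T b t)) ->
  (forall x y t, 0 < t < T -> interior_slice xi1 xi2 t x -> interior_slice xi1 xi2 t y ->
     x < y -> f y t < f x t -> fx x t = 0 -> fx y t = 0 ->
     exists al1 al2 fxx1 fxx2 E1 E2, 0 <= al1 /\ 0 <= al2 /\ E1 < E2 /\
       is_derive (fun z => fx z t) x fxx1 /\ is_derive (fun z => fx z t) y fxx2 /\
       is_derive (fun s => f x s) t (al1 * fxx1 + E1) /\
       is_derive (fun s => f y s) t (al2 * fxx2 + E2)) ->
  forall x y t, time_interval T t -> slice xi1 xi2 t x -> slice xi1 xi2 t y -> x <= y ->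
    f x t <= f y t.
Proof.
  intros Hdom Hcont Hfx Hbd Hinv Hbad.
  pose proof Hdom as (HT & Hb & Hpos & _ & Hc1 & Hc2).
  pose proof (rescaled_time_bounds T b 0 Hb HT) as Hr.
  destruct (pairs_min T b xi1 xi2 Hdom (fun x y t => f y t - f x t))
    as (x & y & t & (Ht & Hx & Hxy & Hy) & Hmin).
  { intros xn yn tn x y t HK (Ht & Hx & Hxy & Hy) Lx Ly Lt.
    apply is_lim_seq_minus'; apply Hcont; auto.
    - intro n. destruct (HK n) as (H1 & H2 & H3 & H4). split; simpl.
      + apply (first_period_in_time T b xi1 xi2 Hdom). exact H1.
      + split; lra.
    - split; simpl; [apply (first_period_in_time T b xi1 xi2 Hdom); exact Ht | split; lra].
    - intro n. destruct (HK n) as (H1 & H2 & H3 & H4). split; simpl.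
      + apply (first_period_in_time T b xi1 xi2 Hdom). exact H1.
      + split; lra.
    - split; simpl; [apply (first_period_in_time T b xi1 xi2 Hdom); exact Ht | split; lra]. }
  assert (Hge : 0 <= f y t - f x t).
  { apply Rnot_lt_le. intro Hneg.
    (* At time 0 there is no past to compare with. The scaling moves such a minimiser to the final
       time of the period without changing the value of [f y t - f x t]. *)
    assert (Hpt : exists x y t, 0 < t /\ pairs T b xi1 xi2 x y t /\ f y t - f x t < 0 /\
      forall x' y' t', pairs T b xi1 xi2 x' y' t' -> f y t - f x t <= f y' t' - f x' t').
    { destruct (Req_dec t 0) as [-> | Hne].
      - assert (T0 : time_interval T 0) by (split; lra).
        assert (Sx : slice xi1 xi2 0 x) by (split; lra).
        assert (Sy : slice xi1 xi2 0 y) by (split; lra).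
        exists (/ b * x), (/ b * y), (rescaled_time T b 0).
        pose proof (Hinv x y 0 T0 Sx Sy) as Hi.
        split; [lra|]. split; [|split].
        + split; [lra|].
          apply (slice_rescale T b xi1 xi2 Hdom x 0 T0) in Sx.
          apply (slice_rescale T b xi1 xi2 Hdom y 0 T0) in Sy.
          split; [apply Sx|]. split; [|apply Sy].
          apply Rmult_le_compat_l; [|lra]. apply Rlt_le, Rinv_0_lt_compat. lra.
        + lra.
        + intros x' y' t' Hp. specialize (Hmin x' y' t' Hp). simpl in Hmin. lra.
      - exists x, y, t. split; [lra|]. split; [split; [lra|]; lra|]. split; [exact Hneg|].
        intros x' y' t' Hp. apply (Hmin x' y' t' Hp). }
    clear x y t Ht Hx Hxy Hy Hmin Hneg.
    destruct Hpt as (x & y & t & Ht0 & Hp & Hneg & Hmin).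
    destruct Hp as (Ht & Hx & Hxy & Hy).
    assert (HtT : 0 < t < T) by lra.
    assert (Tt : time_interval T t) by (split; lra).
    destruct (Req_dec x y) as [->|Hne]; [lra|].
    destruct (Hbd t HtT) as (eps & Heps & Hpos').
    pose proof (fun z Hz => domain_continuous_slice T xi1 xi2 f z t Hcont Tt Hz) as Hsc.
    (* Near a lateral boundary [f] increases strictly, the boundary point included: the sign of [fx]
       gives this inside, and continuity along the slice carries it to the end points. *)
    assert (Hlt : forall z z', slice xi1 xi2 t z -> slice xi1 xi2 t z' -> z < z' ->
       (z' < - xi1 t + eps \/ xi2 t - eps < z) -> f z t < f z' t).
    { intros z z' Hz Hz' Hzz Hor.
      assert (Hin : forall p q, z < p -> p < q -> q < z' -> f p t < f q t).
      { intros p q H1 H2 H3. apply (increasing_of_derive_pos (fun w => f w t) (fun w => fx w t)); auto.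
        - intros w Hw. apply Hfx; auto. destruct Hz, Hz'. split; lra.
        - intros w Hw. apply (is_derive_continuity _ _ (fx w t)).
          apply Hfx; auto. destruct Hz, Hz'. split; lra.
        - intros w Hw. apply Hpos'; [destruct Hz, Hz'; split; lra|]. destruct Hor; [left|right]; lra. }
      set (p := z + (z' - z) / 3). set (q := z + 2 * (z' - z) / 3).
      assert (Hpq : f p t < f q t) by (apply Hin; unfold p, q; lra).
      assert (Hzp : f z t <= f p t).
      { apply Rnot_lt_le. intro Hc.
        destruct (Hsc z Hz (f z t - f p t) ltac:(lra)) as (e & He & Hce).
        pose proof (Rmin_pos e (p - z) He ltac:(unfold p; lra)).
        pose proof (Rmin_l e (p - z)). pose proof (Rmin_r e (p - z)).
        set (w := z + Rmin e (p - z) / 2).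
        assert (Hw : f w t < f p t) by (apply Hin; unfold w, p in *; lra).
        assert (Hw' : Rabs (f w t - f z t) < f z t - f p t).
        { apply Hce; [destruct Hz, Hz'; unfold w, p in *; split; lra|].
          unfold w. apply Rabs_lt_between. lra. }
        apply Rabs_lt_between in Hw'. lra. }
      assert (Hqz : f q t <= f z' t).
      { apply Rnot_lt_le. intro Hc.
        destruct (Hsc z' Hz' (f q t - f z' t) ltac:(lra)) as (e & He & Hce).
        pose proof (Rmin_pos e (z' - q) He ltac:(unfold q; lra)).
        pose proof (Rmin_l e (z' - q)). pose proof (Rmin_r e (z' - q)).
        set (w := z' - Rmin e (z' - q) / 2).
        assert (Hw : f q t < f w t) by (apply Hin; unfold w, q in *; lra).
        assert (Hw' : Rabs (f w t - f z' t) < f q t - f z' t).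
        { apply Hce; [destruct Hz, Hz'; unfold w, q in *; split; lra|].
          unfold w. apply Rabs_lt_between. lra. }
        apply Rabs_lt_between in Hw'. lra. }
      lra. }
    (* If [x] lay on the lateral boundary, moving it inwards would raise [f x t] and lower the
       minimum. *)
    assert (Hix : - xi1 t < x).
    { apply Rnot_le_lt. intro Hle.
      pose proof (Rmin_pos eps (y - x) Heps ltac:(lra)).
      pose proof (Rmin_l eps (y - x)). pose proof (Rmin_r eps (y - x)).
      set (w := x + Rmin eps (y - x) / 2).
      assert (f x t < f w t).
      { apply Hlt; try (split; unfold w; lra); unfold w; [lra | left; lra]. }
      assert (f y t - f x t <= f y t - f w t).
      { apply Hmin. split; [exact Ht|]. unfold w. repeat split; lra. }
      lra. }
    assert (Hiy : y < xi2 t).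
    { apply Rnot_le_lt. intro Hle.
      pose proof (Rmin_pos eps (y - x) Heps ltac:(lra)).
      pose proof (Rmin_l eps (y - x)). pose proof (Rmin_r eps (y - x)).
      set (w := y - Rmin eps (y - x) / 2).
      assert (f w t < f y t).
      { apply Hlt; try (split; unfold w; lra); unfold w; [lra | right; lra]. }
      assert (f y t - f x t <= f w t - f x t).
      { apply Hmin. split; [exact Ht|]. unfold w. repeat split; lra. }
      lra. }
    set (d := Rmin (y - x) (Rmin (x + xi1 t) (xi2 t - y))).
    assert (Hd : 0 < d) by (unfold d; repeat apply Rmin_pos; lra).
    assert (Hd1 : d <= y - x) by apply Rmin_l.
    assert (Hd2 : d <= x + xi1 t).
    { unfold d. eapply Rle_trans; [apply Rmin_r | apply Rmin_l]. }
    assert (Hd3 : d <= xi2 t - y).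
    { unfold d. eapply Rle_trans; [apply Rmin_r | apply Rmin_r]. }
    assert (Ix : interior_slice xi1 xi2 t x) by (split; lra).
    assert (Iy : interior_slice xi1 xi2 t y) by (split; lra).
    (* With the other point held fixed, [f] has a local maximum at [x] and a local minimum at [y].
       The radius [d] also preserves the order of the two points. *)
    assert (Mx : forall w, x - d < w < x + d -> - f x t <= - f w t).
    { intros w Hw. assert (f y t - f x t <= f y t - f w t); [|lra].
      apply Hmin. split; [exact Ht|]. repeat split; lra. }
    assert (My : forall w, y - d < w < y + d -> f y t <= f w t).
    { intros w Hw. assert (f y t - f x t <= f w t - f x t); [|lra].
      apply Hmin. split; [exact Ht|]. repeat split; lra. }
    assert (Dx : forall w, x - d < w < x + d -> is_derive (fun z => - f z t) w (- fx w t)).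
    { intros w Hw. apply (is_derive_opp (fun z => f z t)). apply Hfx; auto. split; lra. }
    assert (Dy : forall w, y - d < w < y + d -> is_derive (fun z => f z t) w (fx w t)).
    { intros w Hw. apply Hfx; auto. split; lra. }
    assert (Fx0 : fx x t = 0).
    { assert (- fx x t = 0); [|lra].
      apply (derive_zero_of_local_min (fun z => - f z t) x _ d Hd Mx). apply Dx. lra. }
    assert (Fy0 : fx y t = 0).
    { apply (derive_zero_of_local_min (fun z => f z t) y _ d Hd My). apply Dy. lra. }
    destruct (Hbad x y t HtT Ix Iy ltac:(lra) ltac:(lra) Fx0 Fy0)
      as (al1 & al2 & fxx1 & fxx2 & E1 & E2 & Ha1 & Ha2 & HE & D1 & D2 & T1 & T2).
    assert (S1 : 0 <= - fxx1).
    { apply (second_derive_of_local_min (fun z => - f z t) (fun z => - fx z t) x _ d Hd Mx Dx).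
      apply (is_derive_opp (fun z => fx z t)). exact D1. }
    assert (S2 : 0 <= fxx2).
    { apply (second_derive_of_local_min (fun z => f z t) (fun z => fx z t) y _ d Hd My Dy D2). }
    destruct (interior_slice_open T b xi1 xi2 Hdom x t Tt Ix) as (e1 & He1 & O1).
    destruct (interior_slice_open T b xi1 xi2 Hdom y t Tt Iy) as (e2 & He2 & O2).
    set (e := Rmin t (Rmin e1 e2)).
    assert (He : 0 < e) by (unfold e; repeat apply Rmin_pos; lra).
    assert (K1 : e <= t) by apply Rmin_l.
    assert (K2 : e <= e1) by (unfold e; eapply Rle_trans; [apply Rmin_r | apply Rmin_l]).
    assert (K3 : e <= e2) by (unfold e; eapply Rle_trans; [apply Rmin_r | apply Rmin_r]).
    (* Minimality over the past makes this time derivative nonpositive, whereas [fxx1 <= 0 <= fxx2]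
       and [E1 < E2] make it positive. *)
    assert (Hl : (al2 * fxx2 + E2) - (al1 * fxx1 + E1) <= 0).
    { apply (derive_le_zero_of_left_min (fun s => f y s - f x s) t _ e He).
      - intros s Hs.
        assert (Ts : time_interval T s) by (split; lra).
        destruct (O1 s Ts) as [? ?]; [apply Rabs_lt_between; lra|].
        destruct (O2 s Ts) as [? ?]; [apply Rabs_lt_between; lra|].
        apply Hmin. split; [lra|]. repeat split; lra.
      - apply (is_derive_minus (fun s => f y s) (fun s => f x s)); auto. }
    nra. }
  assert (Hall : forall t, time_interval T t -> forall x y, slice xi1 xi2 t x ->
    slice xi1 xi2 t y -> x <= y -> f x t <= f y t).
  { apply (rescaled_time_induction T b (fun t => forall x y, slice xi1 xi2 t x ->
      slice xi1 xi2 t y -> x <= y -> f x t <= f y t) HT Hb).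
    - intros s Hs p q [Hp1 Hp2] [Hq1 Hq2] Hpq.
      assert (f y t - f x t <= f q s - f p s).
      { apply Hmin. split; [exact Hs|]. repeat split; lra. }
      lra.
    - intros s Hs IH p q Hp Hq Hpq.
      assert (Hb0 : forall z, z = / b * (b * z)) by (intro z; field; lra).
      rewrite (Hb0 p), (Hb0 q) in *.
      assert (Hp' : slice xi1 xi2 s (b * p)).
      { apply (slice_rescale T b xi1 xi2 Hdom); auto. }
      assert (Hq' : slice xi1 xi2 s (b * q)).
      { apply (slice_rescale T b xi1 xi2 Hdom); auto. }
      pose proof (Hinv (b * p) (b * q) s Hs Hp' Hq').
      assert (f (b * p) s <= f (b * q) s).
      { apply IH; auto. rewrite <- (Hb0 p), <- (Hb0 q) in Hpq. nra. }
      lra. }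
  intros p q s Hs Hp Hq Hpq. apply Hall; auto.
Qed.

(** * Solutions and bounds on the slope *)

(** The form used by the comparison arguments: constant contact slopes, two-sided derivatives in the
    interior, and a time derivative for [u] alone. *)
Definition regular_solution (a : R -> R) (P Q tau T b : R) (xi1 xi2 : R -> R)
    (u ux uxx : R -> R -> R) : Prop :=
  shrinking_domain T b xi1 xi2 /\
  domain_continuous T xi1 xi2 u /\ domain_continuous T xi1 xi2 ux /\
  (forall x t, time_interval T t -> slice xi1 xi2 t x -> 0 < u x t) /\
  (forall x t, time_interval T t -> interior_slice xi1 xi2 t x ->
     is_derive (fun y => u y t) x (ux x t) /\ is_derive (fun y => ux y t) x (uxx x t)) /\
  (forall x t, 0 < t < T -> interior_slice xi1 xi2 t x ->
     is_derive (fun s => u x s) t (a (ux x t) * uxx x t)) /\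
  (forall t, 0 < t < T ->
     ux (- xi1 t) t = P /\ u (- xi1 t) t = tau * xi1 t /\
     ux (xi2 t) t = Q /\ u (xi2 t) t = tau * xi2 t) /\
  (forall x t, time_interval T t -> slice xi1 xi2 t x ->
     u x t = b * u (/ b * x) (rescaled_time T b t)).

(** Reflection in x negates slopes and exchanges the contact points. Allowing an arbitrary [a], not
    only an even one, lets every upper bound on the slope follow from a lower bound. *)
Lemma regular_solution_reflect (a : R -> R) (P Q tau T b : R) (xi1 xi2 : R -> R)
    (u ux uxx : R -> R -> R) :
  regular_solution a P Q tau T b xi1 xi2 u ux uxx ->
  regular_solution (fun p => a (- p)) (- Q) (- P) tau T b xi2 xi1
    (fun x t => u (- x) t) (fun x t => - ux (- x) t) (fun x t => uxx (- x) t).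
Proof.
  intros ((HT & Hb & Hp & Hs & C1 & C2) & Cu & Cux & Hu & Hx & Ht & Hbc & Hsc).
  assert (Sl : forall t x, slice xi2 xi1 t x -> slice xi1 xi2 t (- x)).
  { intros t x [? ?]; split; lra. }
  assert (Il : forall t x, interior_slice xi2 xi1 t x -> interior_slice xi1 xi2 t (- x)).
  { intros t x [? ?]; split; lra. }
  assert (Cr : forall f, domain_continuous T xi1 xi2 f ->
    domain_continuous T xi2 xi1 (fun x t => f (- x) t)).
  { intros f Cf xn tn x t Hn Hl Lx Lt.
    apply (Cf (fun n => - xn n) tn (- x) t).
    - intro n. destruct (Hn n) as [H1 H2]. split; [exact H1 | apply Sl, H2].
    - destruct Hl as [H1 H2]. split; [exact H1 | apply Sl, H2].
    - apply (is_lim_seq_opp xn x). exact Lx.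
    - exact Lt. }
  split; [|split; [|split; [|split; [|split; [|split; [|split]]]]]].
  - split; [exact HT|]. split; [exact Hb|]. split; [|split; [|split; [exact C2 | exact C1]]].
    + intros t H. destruct (Hp t H). auto.
    + intros t H. destruct (Hs t H). auto.
  - apply (Cr u Cu).
  - intros xn tn x t Hn Hl Lx Lt.
    apply (is_lim_seq_opp (fun n => ux (- xn n) (tn n)) (ux (- x) t)).
    apply (Cr ux Cux xn tn x t Hn Hl Lx Lt).
  - intros x t H1 H2. apply Hu; auto.
  - intros x t H1 H2. destruct (Hx (- x) t H1 (Il t x H2)) as [D1 D2].
    assert (Dn : is_derive (fun y : R => - y) x (- 1)) by (auto_derive; [trivial | ring]).
    split.
    + replace (- ux (- x) t) with (- 1 * ux (- x) t) by ring.
      apply (is_derive_comp (fun y => u y t) (fun y => - y)); [exact D1 | exact Dn].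
    + replace (uxx (- x) t) with (- (- 1 * uxx (- x) t)) by ring.
      apply (is_derive_opp (fun y => ux (- y) t)).
      apply (is_derive_comp (fun y => ux y t) (fun y => - y)); [exact D2 | exact Dn].
  - intros x t H1 H2. rewrite Ropp_involutive. apply Ht; auto.
  - intros t H1. destruct (Hbc t H1) as (B1 & B2 & B3 & B4).
    rewrite Ropp_involutive. repeat split; try lra; auto.
  - intros x t H1 H2. rewrite (Hsc (- x) t H1 (Sl t x H2)). do 2 f_equal. ring.
Qed.

Lemma is_derive_sqrt_gap (T c t : R) : 0 < c -> t < T ->
  is_derive (fun s => sqrt (c * (T - s))) t (- (c / (2 * sqrt (c * (T - t))))).
Proof.
  intros Hc Ht. assert (0 < c * (T - t)) by nra.
  auto_derive; [lra|].
  assert (0 < sqrt (c * (T + - t))) by (apply sqrt_lt_R0; lra).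
  replace (T - t) with (T + - t) by ring. field. lra.
Qed.

Lemma sqrt_gap_rescaled (T b c t : R) : 0 < b -> 0 < c -> t < T ->
  sqrt (c * (T - rescaled_time T b t)) = / b * sqrt (c * (T - t)).
Proof.
  intros Hb Hc Ht. rewrite rescaled_time_diff.
  replace (c * (/ b ^ 2 * (T - t))) with ((/ b) ^ 2 * (c * (T - t))) by (field; lra).
  assert (0 < / b) by (apply Rinv_0_lt_compat; lra).
  rewrite sqrt_mult; [|nra|nra]. rewrite sqrt_pow2; lra.
Qed.

Lemma is_lim_seq_sqrt_gap (T c t : R) (tn : nat -> R) :
  0 < c -> t < T -> is_lim_seq tn t ->
  is_lim_seq (fun n => sqrt (c * (T - tn n))) (sqrt (c * (T - t))).
Proof.
  intros Hc Ht Hl. apply (is_lim_seq_continuous (fun s => sqrt (c * (T - s)))); [|exact Hl].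
  eapply is_derive_continuity. apply is_derive_sqrt_gap; auto.
Qed.

Section Regular_solution.

Variables (a : R -> R) (P Q tau T b : R) (xi1 xi2 : R -> R) (u ux uxx : R -> R -> R).
Hypothesis Hsol : regular_solution a P Q tau T b xi1 xi2 u ux uxx.

Lemma ux_rescale (x t : R) : time_interval T t -> interior_slice xi1 xi2 t x ->
  ux x t = ux (/ b * x) (rescaled_time T b t).
Proof.
  destruct Hsol as (Hdom & Cu & Cux & Hu & Hx & Ht & Hbc & Hsc).
  pose proof Hdom as (HT & Hb & _). intros Tt Ix.
  pose proof (rescaled_time_interval T b t Hb Tt) as Tt'.
  pose proof (proj1 (interior_slice_rescale T b xi1 xi2 Hdom x t Tt) Ix) as Ix'.
  destruct (Hx x t Tt Ix) as [D1 _]. destruct (Hx _ _ Tt' Ix') as [D2 _].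
  rewrite <- (is_derive_unique _ _ _ D1).
  apply is_derive_unique.
  apply is_derive_ext_loc with (fun y => b * u (/ b * y) (rescaled_time T b t)).
  { apply (locally_between (- xi1 t) (xi2 t)); [exact Ix|].
    intros y Hy. symmetry. apply Hsc; [exact Tt | split; lra]. }
  replace (ux (/ b * x) (rescaled_time T b t))
    with (b * (/ b * ux (/ b * x) (rescaled_time T b t))) by (field; lra).
  apply is_derive_scal.
  apply (is_derive_comp (fun y => u y (rescaled_time T b t)) (fun y => / b * y)); [exact D2|].
  auto_derive; [trivial | ring].
Qed.

(** The slope is invariant under the scaling, so its bound on one period persists up to [T]. *)
Lemma ux_bounded : exists C, forall x t, time_interval T t -> interior_slice xi1 xi2 t x ->
  Rabs (ux x t) <= C.
Proof.
  destruct Hsol as (Hdom & Cu & Cux & Hu & Hx & Ht & Hbc & Hsc).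
  pose proof Hdom as (HT & Hb & _).
  assert (HF : forall sg, exists m, forall x t, 0 <= t <= rescaled_time T b 0 ->
    slice xi1 xi2 t x -> m <= sg * ux x t).
  { intro sg. destruct (pairs_min T b xi1 xi2 Hdom (fun x y t => sg * ux x t))
      as (x & y & t & Hp & Hm).
    - intros xn yn tn x y t Hn Hp Lx Ly Lt. apply (is_lim_seq_scal_l _ sg (ux x t)).
      apply Cux; auto.
      + intro n. destruct (Hn n) as (H1 & H2 & H3 & H4). split; simpl.
        * apply (first_period_in_time T b xi1 xi2 Hdom). exact H1.
        * split; lra.
      + destruct Hp as (H1 & H2 & H3 & H4).
        split; simpl; [apply (first_period_in_time T b xi1 xi2 Hdom); exact H1 | split; lra].
    - exists (sg * ux x t). intros x' t' Ht' [S1 S2]. apply (Hm x' x' t').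
      repeat split; lra. }
  destruct (HF 1) as [m1 Hm1]. destruct (HF (-1)) as [m2 Hm2].
  exists (Rabs m1 + Rabs m2). intros x t Tt. revert x.
  apply (rescaled_time_induction T b (fun t => forall x, interior_slice xi1 xi2 t x ->
    Rabs (ux x t) <= Rabs m1 + Rabs m2) HT Hb); [| |exact Tt].
  - intros s Hs x [I1 I2]. specialize (Hm1 x s Hs ltac:(split; lra)).
    specialize (Hm2 x s Hs ltac:(split; lra)).
    pose proof (Rabs_maj2 m1). pose proof (Rabs_maj2 m2).
    pose proof (Rabs_pos m1). pose proof (Rabs_pos m2).
    apply Rabs_le_between. lra.
  - intros s Ts IH x Ix. assert (Hb0 : x = / b * (b * x)) by (field; lra).
    rewrite Hb0 in *. apply (interior_slice_rescale T b xi1 xi2 Hdom) in Ix; auto.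
    rewrite <- ux_rescale; auto.
Qed.

(** The similarity variable is invariant under the scaling, so one period suffices. Its bound [Z]
    controls the drift term in the barrier inequality. *)
Lemma domain_width : exists Z, 0 < Z /\ forall x t, time_interval T t -> slice xi1 xi2 t x ->
  Rabs (x / sqrt (1 * (T - t))) <= Z.
Proof.
  destruct Hsol as (Hdom & _). pose proof Hdom as (HT & Hb & Hp & Hs & C1 & C2).
  destruct (time_continuous_bounded T b xi1 xi2 Hdom xi1 C1) as [M1 HM1].
  destruct (time_continuous_bounded T b xi1 xi2 Hdom xi2 C2) as [M2 HM2].
  pose proof (rescaled_time_bounds T b 0 Hb HT) as Hr.
  set (s1 := sqrt (1 * (T - rescaled_time T b 0))).
  assert (Hs1 : 0 < s1) by (apply sqrt_lt_R0; lra).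
  pose proof (HM1 0 ltac:(lra)). pose proof (HM2 0 ltac:(lra)).
  destruct (Hp 0 ltac:(split; lra)).
  exists ((M1 + M2) / s1). split; [apply Rdiv_lt_0_compat; lra|].
  intros x t Tt. revert x.
  apply (rescaled_time_induction T b (fun t => forall x, slice xi1 xi2 t x ->
    Rabs (x / sqrt (1 * (T - t))) <= (M1 + M2) / s1) HT Hb); [| |exact Tt].
  - intros s Hst x [I1 I2]. specialize (HM1 s Hst). specialize (HM2 s Hst).
    assert (Hss : s1 <= sqrt (1 * (T - s))) by (apply sqrt_le_1; lra).
    unfold Rdiv. rewrite Rabs_mult. rewrite (Rabs_pos_eq (/ _)).
    2: { apply Rlt_le, Rinv_0_lt_compat. lra. }
    apply Rmult_le_compat.
    + apply Rabs_pos.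
    + apply Rlt_le, Rinv_0_lt_compat. lra.
    + apply Rabs_le_between. lra.
    + apply Rinv_le_contravar; lra.
  - intros s Ts IH x Ix. assert (Hb0 : x = / b * (b * x)) by (field; lra).
    rewrite Hb0 in *. apply (slice_rescale T b xi1 xi2 Hdom) in Ix; auto.
    specialize (IH _ Ix). rewrite sqrt_gap_rescaled by (destruct Ts; lra).
    assert (0 < sqrt (1 * (T - s))) by (apply sqrt_lt_R0; destruct Ts; lra).
    replace (/ b * (b * x) / (/ b * sqrt (1 * (T - s)))) with (b * x / sqrt (1 * (T - s)));
      [exact IH|]. field. lra.
Qed.

End Regular_solution.

(* The barriers [p + eps * exp (lam * zeta)], [zeta = x / sqrt (T - t)], are strict
   subsolutions of the equation for [u_x] as soon as [lam] is large and [eps] small. *)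
Lemma slope_barrier_step (a : R -> R) (P Q tau T b : R) (xi1 xi2 : R -> R)
    (u ux uxx : R -> R -> R) (Z lam eps p q c : R) :
  regular_solution a P Q tau T b xi1 xi2 u ux uxx ->
  (forall r, 0 < a r) -> (forall r, ex_derive a r) ->
  (forall x t, time_interval T t -> slice xi1 xi2 t x -> Rabs (x / sqrt (1 * (T - t))) <= Z) ->
  0 < lam -> 0 < c ->
  (forall z, Rabs z <= Z -> q + eps * exp (lam * z) < Rmin P Q) ->
  (forall z, Rabs z <= Z ->
     c < Derive a (q + eps * exp (lam * z)) * (eps * lam * exp (lam * z)) ^ 2
         + a (q + eps * exp (lam * z)) * (eps * lam ^ 2 * exp (lam * z))
         - z * (eps * lam * exp (lam * z)) / 2) ->
  q <= p + c ->
  (forall x t, 0 < t < T -> interior_slice xi1 xi2 t x ->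
     p + eps * exp (lam * (x / sqrt (1 * (T - t)))) <= ux x t) ->
  forall x t, 0 < t < T -> interior_slice xi1 xi2 t x ->
     q + eps * exp (lam * (x / sqrt (1 * (T - t)))) <= ux x t.
Proof.
  intros Hsol Ha Hda HZ Hlam Hc HPQ Hstrict Hqp Hp.
  pose proof Hsol as (Hdom & Cu & Cux & Hu & Hx & Ht & Hbc & Hsc).
  pose proof Hdom as (HT & Hb & Hpos & Hsxi & C1 & C2).
  set (s := fun t => sqrt (1 * (T - t))) in *.
  assert (Hs : forall t, t < T -> 0 < s t).
  { intros t H. apply sqrt_lt_R0. lra. }
  pose (h := fun z => q + eps * exp (lam * z)).
  pose (H := fun z => q * z + eps / lam * exp (lam * z)).
  assert (DH : forall z, is_derive H z (h z)).
  { intro z. unfold H, h. auto_derive; [trivial|]. field. lra. }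
  assert (Dh : forall z, is_derive h z (eps * lam * exp (lam * z))).
  { intro z. unfold h. auto_derive; [trivial|]. ring. }
  (* [f] is a primitive in x of the slope minus the barrier, up to the factor [/ s t]. Its
     monotonicity is the claim, and it involves only [u], which can be differentiated in time. *)
  pose (f := fun x t => u x t / s t - H (x / s t)).
  pose (fx := fun x t => (ux x t - h (x / s t)) / s t).
  assert (Dsc : forall x t, t < T -> is_derive (fun y => y / s t) x (/ s t)).
  { intros x t H1. specialize (Hs t H1). auto_derive; [trivial|]. field. lra. }
  assert (Dfx : forall x t, 0 < t < T -> interior_slice xi1 xi2 t x ->
     is_derive (fun y => f y t) x (fx x t)).
  { intros x t H1 H2. assert (Hst := Hs t ltac:(lra)).
    destruct (Hx x t ltac:(split; lra) H2) as [D1 _].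
    unfold f, fx. replace ((ux x t - h (x / s t)) / s t)
      with (ux x t * / s t - / s t * h (x / s t)) by (field; lra).
    apply (is_derive_minus (fun y => u y t / s t) (fun y => H (y / s t))).
    - unfold Rdiv. apply (is_derive_ext (fun y => / s t * u y t)).
      { intro y. apply Rmult_comm. }
      replace (ux x t * / s t) with (/ s t * ux x t) by ring.
      apply (is_derive_scal (fun y => u y t)). exact D1.
    - apply (is_derive_comp H (fun y => y / s t)); [apply DH | apply Dsc; lra]. }
  assert (Mono : forall x y t, time_interval T t -> slice xi1 xi2 t x -> slice xi1 xi2 t y ->
    x <= y -> f x t <= f y t).
  { apply (monotone_of_two_point T b xi1 xi2 f fx Hdom).
    - intros xn tn x t Hn [Tt St] Lx Lt. simpl in Tt, St. assert (Hst := Hs t ltac:(destruct Tt; lra)).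
      assert (Ls : is_lim_seq (fun n => s (tn n)) (s t)).
      { apply is_lim_seq_sqrt_gap; [lra | destruct Tt; lra | exact Lt]. }
      unfold f. apply is_lim_seq_minus'.
      + apply is_lim_seq_div'; [|exact Ls|lra]. apply Cu; auto. split; auto.
      + apply (is_lim_seq_continuous H).
        * eapply is_derive_continuity. apply DH.
        * apply is_lim_seq_div'; auto. lra.
    - exact Dfx.
    - intros t H1. destruct (Hbc t H1) as (B1 & _ & B3 & _).
      assert (Tt : time_interval T t) by (split; lra).
      destruct (Hpos t Tt) as [X1 X2].
      assert (S0 : slice xi1 xi2 t 0) by (split; lra).
      pose proof (HPQ 0) as H0. rewrite Rabs_R0 in H0.
      assert (HZ0 : 0 <= Z). { eapply Rle_trans; [apply Rabs_pos | apply (HZ 0 t Tt S0)]. }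
      specialize (H0 HZ0).
      (* The maximum of [h] over the whole range of the similarity variable leaves a positive gap
         below both contact slopes. *)
      destruct (continuity_ab_maj h (- Z) Z) as [zm [Hzm Izm]]; [lra| |].
      { intros z _. eapply is_derive_continuity. apply Dh. }
      assert (Hgap : h zm < Rmin P Q).
      { apply HPQ. apply Rabs_le_between. lra. }
      pose proof (Rmin_l P Q) as RP. pose proof (Rmin_r P Q) as RQ.
      destruct (domain_continuous_slice T xi1 xi2 ux (- xi1 t) t Cux Tt ltac:(split; lra)
                  (Rmin P Q - h zm) ltac:(lra)) as (e1 & He1 & K1).
      destruct (domain_continuous_slice T xi1 xi2 ux (xi2 t) t Cux Tt ltac:(split; lra)
                  (Rmin P Q - h zm) ltac:(lra)) as (e2 & He2 & K2).
      exists (Rmin e1 e2). split; [apply Rmin_pos; lra|].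
      pose proof (Rmin_l e1 e2). pose proof (Rmin_r e1 e2).
      intros x [I1 I2] Hor. unfold fx. apply Rdiv_lt_0_compat; [|apply Hs; lra].
      assert (h (x / s t) <= h zm).
      { apply Hzm. apply Rabs_le_between. apply HZ; [exact Tt | split; lra]. }
      destruct Hor as [Hor|Hor].
      + specialize (K1 x ltac:(split; lra) ltac:(apply Rabs_lt_between; lra)).
        apply Rabs_lt_between in K1. lra.
      + specialize (K2 x ltac:(split; lra) ltac:(apply Rabs_lt_between; lra)).
        apply Rabs_lt_between in K2. lra.
    - intros x y t Tt Sx Sy. unfold f.
      assert (Hst := Hs t ltac:(destruct Tt; lra)).
      rewrite (Hsc x t Tt Sx), (Hsc y t Tt Sy). unfold s at 5 6 7 8.
      rewrite sqrt_gap_rescaled by (destruct Tt; lra). fold (s t).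
      replace (/ b * y / (/ b * s t)) with (y / s t) by (field; lra).
      replace (/ b * x / (/ b * s t)) with (x / s t) by (field; lra).
      field. lra.
    - intros x y t H1 Ix Iy Hxy Hf Fx Fy.
      assert (Hst := Hs t ltac:(lra)). assert (Tt : time_interval T t) by (split; lra).
      assert (Tch : forall z, fx z t = 0 -> ux z t = h (z / s t)).
      { intros z Hz. unfold fx in Hz. apply Rmult_integral in Hz. destruct Hz as [Hz|Hz]; [lra|].
        exfalso. apply (Rinv_neq_0_compat (s t)); lra. }
      assert (Dxx : forall z, interior_slice xi1 xi2 t z ->
        is_derive (fun z => fx z t) z ((uxx z t - eps * lam * exp (lam * (z / s t)) / s t) / s t)).
      { intros z Iz. destruct (Hx z t Tt Iz) as [_ D2]. unfold fx, Rdiv.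
        apply (is_derive_ext (fun y => / s t * (ux y t - h (y * / s t)))).
        { intro w. apply Rmult_comm. }
        rewrite (Rmult_comm _ (/ s t)).
        apply (is_derive_scal (fun y => ux y t - h (y * / s t))).
        apply (is_derive_minus (fun y => ux y t) (fun y => h (y * / s t))); [exact D2|].
        rewrite (Rmult_comm _ (/ s t)).
        apply (is_derive_comp h (fun y => y * / s t)); [apply Dh | apply (Dsc z t); lra]. }
      (* Where the slope equals the barrier, the time derivative of [f] splits into [a] times [f_xx]
         and a source. The source contains [u / s], hence the value of [f] itself. *)
      assert (Dt : forall z, interior_slice xi1 xi2 t z -> fx z t = 0 ->
        is_derive (fun r => f z r) t
          (a (ux z t) * ((uxx z t - eps * lam * exp (lam * (z / s t)) / s t) / s t)
           + (a (h (z / s t)) * (eps * lam * exp (lam * (z / s t)))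
              + (u z t / s t - z / s t * h (z / s t)) / 2) / s t ^ 2)).
      { intros z Iz Fz. rewrite <- (Tch z Fz).
        pose proof (Ht z t H1 Iz) as Dut.
        assert (Ds : is_derive s t (- (1 / (2 * s t)))) by (apply is_derive_sqrt_gap; lra).
        assert (Dzs : is_derive (fun r => z / s r) t (z / (2 * s t ^ 3))).
        { unfold Rdiv. apply (is_derive_ext (fun r => z * / s r)); [reflexivity|].
          replace (z * / (2 * s t ^ 3)) with (z * (- (- (1 / (2 * s t))) / s t ^ 2)) by (field; lra).
          apply (is_derive_scal (fun r => / s r)). apply is_derive_inv; [exact Ds | lra]. }
        unfold f.
        replace (_ + _) with
          ((a (ux z t) * uxx z t * / s t + u z t * (- (- (1 / (2 * s t))) / s t ^ 2))
           - z / (2 * s t ^ 3) * ux z t) by (field; lra).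
        apply (is_derive_minus (fun r => u z r / s r) (fun r => H (z / s r))).
        - apply (is_derive_mult (fun r => u z r) (fun r => / s r)).
          + exact Dut.
          + apply is_derive_inv; [exact Ds | lra].
          + intros n m. apply Rmult_comm.
        - rewrite (Tch z Fz). apply (is_derive_comp H (fun r => z / s r)); [apply DH | exact Dzs]. }
      do 6 eexists. split; [|split; [|split; [|split; [apply Dxx, Ix | split; [apply Dxx, Iy |
        split; [apply Dt; [exact Ix | exact Fx] | apply Dt; [exact Iy | exact Fy]]]]]]].
      + apply Rlt_le, Ha.
      + apply Rlt_le, Ha.
      (* Times [s t ^ 2], the source is g(z) + c z + f / 2. The strict inequality on the barrier
         makes [g] nondecreasing, and the weaker barrier gives f(y) - f(x) >= - c (Y - X). The
         source thus gains at least c (Y - X) / 2 > 0 from [x] to [y]. *)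
      + pose (g := fun z => a (h z) * (eps * lam * exp (lam * z)) + (H z - z * h z) / 2 - c * z).
        assert (Hg : g (x / s t) <= g (y / s t)).
        { apply (nondecreasing_of_derive g (fun z =>
            Derive a (h z) * (eps * lam * exp (lam * z)) ^ 2
            + a (h z) * (eps * lam ^ 2 * exp (lam * z)) - z * (eps * lam * exp (lam * z)) / 2 - c)).
          - apply Rmult_le_compat_r; [apply Rlt_le, Rinv_0_lt_compat; lra | lra].
          - intros z Hz. unfold g, h, H. auto_derive; [apply Hda|].
            change (Derive (fun x0 : R => a x0)) with (Derive a). field. lra.
          - intros z Hz.
            assert (Zx : Rabs (x / s t) <= Z) by (apply HZ; [exact Tt | destruct Ix; split; lra]).
            assert (Zy : Rabs (y / s t) <= Z) by (apply HZ; [exact Tt | destruct Iy; split; lra]).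
            apply Rabs_le_between in Zx. apply Rabs_le_between in Zy.
            specialize (Hstrict z ltac:(apply Rabs_le_between; lra)). unfold h. lra. }
        assert (Hff : f x t + c * (x / s t) <= f y t + c * (y / s t)).
        { apply (nondecreasing_of_derive (fun z => f z t + c * (z / s t)) (fun z => fx z t + c * / s t)).
          - lra.
          - intros z Hz. apply (is_derive_plus (fun z => f z t) (fun z => c * (z / s t))).
            + apply Dfx; [exact H1 | destruct Ix, Iy; split; lra].
            + apply (is_derive_scal (fun z => z / s t)). apply Dsc. lra.
          - intros z Hz.
            assert (Iz : interior_slice xi1 xi2 t z) by (destruct Ix, Iy; split; lra).
            specialize (Hp z t H1 Iz). unfold fx, h.
            replace ((ux z t - (q + eps * exp (lam * (z / s t)))) / s t + c * / s t)
              with ((ux z t - (q + eps * exp (lam * (z / s t))) + c) * / s t) by (field; lra).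
            apply Rmult_le_pos; [unfold s in *; lra | apply Rlt_le, Rinv_0_lt_compat; lra]. }
        apply Rmult_lt_compat_r.
        { apply Rinv_0_lt_compat. nra. }
        assert (Hlt : x / s t < y / s t).
        { apply Rmult_lt_compat_r; [apply Rinv_0_lt_compat; lra | lra]. }
        unfold g in Hg. unfold f in Hff, Hf.
        set (X := x / s t) in *. set (Y := y / s t) in *.
        lra. }
  intros x t H1 Ix. assert (Hst := Hs t ltac:(lra)).
  assert (0 <= fx x t).
  { destruct Ix as [I1 I2].
    apply (derive_nonneg_of_monotone (fun y => f y t) x _ (xi2 t - x)); [lra| |].
    - intros y Hy. apply Mono; [split; lra | split; lra | split; lra | lra].
    - apply Dfx; [exact H1 | split; assumption]. }
  unfold fx in H0. apply Rnot_lt_le. intro Hlt.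
  assert ((ux x t - h (x / s t)) * / s t < 0).
  { unfold h. assert (0 < / s t) by (apply Rinv_0_lt_compat; lra). unfold s in *. nra. }
  unfold Rdiv in *. lra.
Qed.

(** Continuation in the constant part of the barrier: it starts below [- C], where the bound on [ux]
    suffices, and climbs by [c / 2] at a time until it stops at [Q - eta]. The positive exponential
    is then dropped. *)
Lemma slope_ge (a : R -> R) (P Q tau T b : R) (xi1 xi2 : R -> R)
    (u ux uxx : R -> R -> R) :
  regular_solution a P Q tau T b xi1 xi2 u ux uxx ->
  (forall r, 0 < a r) -> (forall r, ex_derive a r) -> (forall r, continuous (Derive a) r) ->
  Q <= P ->
  forall x t, 0 < t < T -> interior_slice xi1 xi2 t x -> Q <= ux x t.
Proof.
  intros Hsol Ha Hda Hca HPQ x0 t0 Ht0 Ix0.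
  apply le_epsilon. intros eta Heta.
  destruct (ux_bounded a P Q tau T b xi1 xi2 u ux uxx Hsol) as [C HC].
  destruct (domain_width a P Q tau T b xi1 xi2 u ux uxx Hsol) as [Z [HZ0 HZ]].
  set (pm := Rmin (- C) Q - eta).
  pose proof (Rmin_l (- C) Q) as Hm1. pose proof (Rmin_r (- C) Q) as Hm2.
  destruct (continuous_pos_bounded_below a pm Q) as [al [Hal Hal']].
  { intro r. apply (ex_derive_continuous a). apply Hda. }
  { exact Ha. }
  destruct (continuous_bounded (Derive a) pm Q Hca) as [B [HB HB']].
  (* With w the derivative of the barrier in z, the diffusion term is at least (Z / 2 + 2) w: Z / 2
     pays for the drift, 1 for the term with the derivative of [a], and one w is left over. *)
  set (lam := (Z / 2 + 2) / al).
  assert (Hlam : 0 < lam) by (apply Rdiv_lt_0_compat; lra).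
  assert (Hla : lam * al = Z / 2 + 2) by (unfold lam; field; lra).
  clearbody lam.
  set (X := exp (lam * Z)).
  assert (HX : 0 < X) by apply exp_pos.
  (* The first bound keeps the exponential below [eta / 2], so that the barrier stays under [Q]; the
     second makes the quadratic term with the derivative of [a] at most w. *)
  set (eps := Rmin (eta / (2 * X)) (/ (B * lam * X))).
  assert (HBlX : 0 < B * lam * X) by (repeat apply Rmult_lt_0_compat; lra).
  assert (Heps : 0 < eps).
  { apply Rmin_pos; [apply Rdiv_lt_0_compat; lra | apply Rinv_0_lt_compat; exact HBlX]. }
  assert (HeX : eps * X <= eta / 2).
  { replace (eta / 2) with (eta / (2 * X) * X) by (field; lra).
    apply Rmult_le_compat_r; [lra | apply Rmin_l]. }
  assert (HeB : B * (eps * lam * X) <= 1).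
  { replace 1 with (/ (B * lam * X) * (B * lam * X)) by (field; repeat split; lra).
    replace (B * (eps * lam * X)) with (eps * (B * lam * X)) by ring.
    apply Rmult_le_compat_r; [lra | apply Rmin_r]. }
  clearbody eps.
  assert (Hexp : forall z, Rabs z <= Z -> / X <= exp (lam * z) <= X).
  { intros z Hz. apply Rabs_le_between in Hz. unfold X. rewrite <- exp_Ropp.
    assert (Hmono : forall v w, v <= w -> exp v <= exp w).
    { intros v w [Hvw | ->]; [apply Rlt_le, exp_increasing, Hvw | lra]. }
    split; apply Hmono; nra. }
  set (c := eps * lam * / X).
  assert (HiX : 0 < / X) by (apply Rinv_0_lt_compat; lra).
  assert (Hc : 0 < c) by (unfold c; repeat apply Rmult_lt_0_compat; lra).
  pose (pn := fun n : nat => Rmin (pm + INR n * (c / 2)) (Q - eta)).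
  assert (Hclaim : forall n x t, 0 < t < T -> interior_slice xi1 xi2 t x ->
     pn n + eps * exp (lam * (x / sqrt (1 * (T - t)))) <= ux x t).
  { induction n as [|n IH]; intros x t H1 Ix.
    - assert (Hz : Rabs (x / sqrt (1 * (T - t))) <= Z).
      { apply HZ; [split; lra | destruct Ix; split; lra]. }
      specialize (Hexp _ Hz). specialize (HC x t ltac:(split; lra) Ix).
      apply Rabs_le_between in HC. unfold pn. simpl INR.
      pose proof (Rmin_l (pm + 0 * (c / 2)) (Q - eta)). unfold pm in *.
      assert (eps * exp (lam * (x / sqrt (1 * (T - t)))) <= eps * X) by nra. lra.
    - assert (Hpn : pm <= pn (S n) /\ pn (S n) <= Q - eta /\ pn (S n) <= pn n + c / 2).
      { unfold pn. rewrite S_INR.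
        pose proof (Rmin_r (pm + (INR n + 1) * (c / 2)) (Q - eta)).
        pose proof (Rmin_l (pm + (INR n + 1) * (c / 2)) (Q - eta)).
        pose proof (pos_INR n). split; [|split].
        - apply Rmin_glb; [nra | unfold pm; lra].
        - lra.
        - unfold Rmin at 2. destruct (Rle_dec _ _); lra. }
      destruct Hpn as (Q1 & Q2 & Q3).
      (* The estimates leave a margin of at least [c]; steps of [c / 2] make the required inequality
         strict. *)
      apply (slope_barrier_step a P Q tau T b xi1 xi2 u ux uxx Z lam eps (pn n) (pn (S n)) (c / 2));
        auto; try lra.
      + intros z Hz. specialize (Hexp z Hz).
        assert (eps * exp (lam * z) <= eps * X) by nra.
        assert (Rmin P Q = Q) by (apply Rmin_right; lra). lra.
      + intros z Hz. specialize (Hexp z Hz).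
        set (E := exp (lam * z)) in *. set (r := pn (S n) + eps * E).
        assert (Hr : pm <= r <= Q).
        { unfold r. assert (eps * E <= eps * X) by nra.
          assert (0 < eps * E) by (apply Rmult_lt_0_compat; lra). lra. }
        specialize (Hal' r Hr). specialize (HB' r Hr). apply Rabs_le_between in HB', Hz.
        set (w := eps * lam * E).
        assert (Hel : 0 < eps * lam) by (apply Rmult_lt_0_compat; lra).
        assert (Hcw : c <= w) by (unfold c, w; apply Rmult_le_compat_l; lra).
        assert (HBw : B * w <= 1).
        { assert (w <= eps * lam * X) by (unfold w; apply Rmult_le_compat_l; lra). nra. }
        replace (eps * lam ^ 2 * E) with (lam * w) by (unfold w; ring).
        assert (H2 : - (B * w) * w <= Derive a r * w ^ 2) by nra.
        assert (H3 : (Z / 2 + 2) * w <= a r * (lam * w)).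
        { rewrite <- Hla. replace (a r * (lam * w)) with (lam * a r * w) by ring.
          apply Rmult_le_compat_r; [lra|]. apply Rmult_le_compat_l; lra. }
        assert (H4 : - (B * w) * w >= - 1 * w) by nra.
        assert (H5 : z * w / 2 <= Z / 2 * w) by nra.
        lra. }
  destruct (nfloor_ex ((Q - eta - pm) / (c / 2))) as [n [Hn1 Hn2]].
  { apply Rdiv_le_0_compat; [unfold pm; lra | lra]. }
  specialize (Hclaim (S n) x0 t0 Ht0 Ix0).
  assert (Hpn : pn (S n) = Q - eta).
  { unfold pn. apply Rmin_right. rewrite S_INR.
    assert (Q - eta - pm = (Q - eta - pm) / (c / 2) * (c / 2)) by (field; lra). nra. }
  rewrite Hpn in Hclaim.
  assert (0 < eps * exp (lam * (x0 / sqrt (1 * (T - t0))))).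
  { apply Rmult_lt_0_compat; [lra | apply exp_pos]. }
  lra.
Qed.

Lemma slope_bounds (a : R -> R) (P Q tau T b : R) (xi1 xi2 : R -> R)
    (u ux uxx : R -> R -> R) :
  regular_solution a P Q tau T b xi1 xi2 u ux uxx ->
  (forall r, 0 < a r) -> (forall r, ex_derive a r) -> (forall r, continuous (Derive a) r) ->
  Q <= P ->
  forall x t, 0 < t < T -> interior_slice xi1 xi2 t x -> Q <= ux x t <= P.
Proof.
  intros Hsol Ha Hda Hca HPQ x t Ht Ix. split.
  - apply (slope_ge a P Q tau T b xi1 xi2 u ux uxx); auto.
  - assert (Hd : forall r, is_derive (fun p => a (- p)) r (- Derive a (- r))).
    { intro r. auto_derive; [apply Hda|].
      change (Derive (fun x0 : R => a x0)) with (Derive a). ring. }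
    assert (Hle : - P <= - ux (- - x) t).
    { apply (slope_ge (fun p => a (- p)) (- Q) (- P) tau T b xi2 xi1
        (fun x t => u (- x) t) (fun x t => - ux (- x) t) (fun x t => uxx (- x) t)).
      - apply regular_solution_reflect, Hsol.
      - intro r. apply Ha.
      - intro r. eexists. apply Hd.
      - intro r. apply (continuous_ext (fun r => - Derive a (- r))).
        { intro w. symmetry. apply is_derive_unique, Hd. }
        apply (continuous_opp (fun r => Derive a (- r))).
        apply (continuous_comp Ropp (Derive a)); [|apply Hca].
        apply (continuous_opp (fun r : R => r)). apply continuous_id.
      - lra.
      - exact Ht.
      - destruct Ix. split; lra. }
    rewrite Ropp_involutive in Hle. lra.
Qed.

(** * Boosted profiles *)

(* A self-similar solution in polar form: [ph m] is its height and [Th m] its slope on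
   the ray [x = m * u]. *)
Definition polar_profile (a : R -> R) (P Q tau th0 lo hi : R) (Th ph : R -> R) : Prop :=
  0 <= th0 < tau /\ lo < - / tau /\ / tau < hi /\
  (forall m, lo < m < hi ->
     is_derive Th m (- (ph m ^ 2 / a (Th m))) /\
     is_derive ph m (ph m * Th m / (1 - m * Th m)) /\
     0 < ph m /\ Rabs (Th m) <= th0 /\ 0 < 1 - m * Th m) /\
  Th (- / tau) = P /\ Th (/ tau) = Q.

Lemma polar_profile_reflect (a : R -> R) (P Q tau th0 lo hi : R) (Th ph : R -> R) :
  polar_profile a P Q tau th0 lo hi Th ph ->
  polar_profile (fun p => a (- p)) (- Q) (- P) tau th0 (- hi) (- lo)
    (fun m => - Th (- m)) (fun m => ph (- m)).
Proof.
  intros (H0 & H1 & H2 & H3 & H4 & H5).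
  split; [exact H0|]. split; [lra|]. split; [lra|]. split; [|split].
  - intros m Hm. destruct (H3 (- m)) as (D1 & D2 & D3 & D4 & D5); [lra|].
    assert (Dn : is_derive (fun y : R => - y) m (- 1)) by (auto_derive; [trivial | ring]).
    split; [|split; [|split; [|split]]].
    + rewrite Ropp_involutive.
      replace (- (ph (- m) ^ 2 / a (Th (- m))))
        with (- (- 1 * - (ph (- m) ^ 2 / a (Th (- m))))) by ring.
      apply (is_derive_opp (fun m => Th (- m))).
      apply (is_derive_comp Th (fun y => - y)); assumption.
    + replace (ph (- m) * - Th (- m) / (1 - m * - Th (- m)))
        with (- 1 * (ph (- m) * Th (- m) / (1 - - m * Th (- m)))) by (field; lra).
      apply (is_derive_comp ph (fun y => - y)); assumption.
    + exact D3.
    + rewrite Rabs_Ropp. exact D4.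
    + lra.
  - rewrite Ropp_involutive, H5. reflexivity.
  - rewrite H4. reflexivity.
Qed.

Lemma is_derive_decreasing (f df : R -> R) (a b : R) :
  (forall x, a < x < b -> is_derive f x (df x)) -> (forall x, a < x < b -> df x < 0) ->
  forall x y, a < x -> x < y -> y < b -> f y < f x.
Proof.
  intros Hd Hn x y H1 H2 H3.
  assert (- f x < - f y); [|lra].
  apply (increasing_of_derive_pos (fun z => - f z) (fun z => - df z)); auto.
  - intros z Hz. apply (is_derive_opp f). apply Hd. lra.
  - intros z Hz. apply continuity_pt_opp. apply (is_derive_continuity f z (df z)). apply Hd. lra.
  - intros z Hz. specialize (Hn z ltac:(lra)). lra.
Qed.

(** At a zero of the first factor the derivative of the second drops out. This differentiates [fx]
    at a contact point, where only its numerator counts. *)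
Lemma is_derive_mult_zero (N W : R -> R) (x n : R) :
  is_derive N x n -> N x = 0 -> continuity_pt W x ->
  is_derive (fun y => N y * W y) x (n * W x).
Proof.
  intros HN H0 HW. apply is_derive_Reals. intros eps Heps.
  destruct (is_derive_quotient N x n (eps / (2 * (Rabs (W x) + 1))) HN) as [d1 [Hd1 K1]].
  { apply Rdiv_lt_0_compat; [lra|]. pose proof (Rabs_pos (W x)). lra. }
  pose proof (Rabs_pos (W x)) as PW. pose proof (Rabs_pos n) as Pn.
  destruct (HW (Rmin 1 (eps / (2 * (Rabs n + 1))))) as [d2 [Hd2 K2]].
  { apply Rmin_pos; [lra|]. apply Rdiv_lt_0_compat; lra. }
  simpl in K2. unfold R_dist in K2.
  assert (Hd : 0 < Rmin d1 d2) by (apply Rmin_pos; lra).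
  exists (mkposreal _ Hd). intros h Hh Hhd. simpl in Hhd.
  pose proof (Rmin_l d1 d2). pose proof (Rmin_r d1 d2).
  specialize (K1 (x + h)). replace (x + h - x) with h in K1 by ring.
  specialize (K1 ltac:(lra) ltac:(lra)).
  assert (K2' : Rabs (W (x + h) - W x) < Rmin 1 (eps / (2 * (Rabs n + 1)))).
  { apply K2. split; [split; [exact I | lra]|]. replace (x + h - x) with h by ring. lra. }
  pose proof (Rmin_l 1 (eps / (2 * (Rabs n + 1)))). pose proof (Rmin_r 1 (eps / (2 * (Rabs n + 1)))).
  rewrite H0 in *. set (q := (N (x + h) - 0) / h) in *.
  replace ((N (x + h) * W (x + h) - 0 * W x) / h - n * W x)
    with ((q - n) * W (x + h) + n * (W (x + h) - W x)) by (unfold q; field; exact Hh).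
  assert (HWb : Rabs (W (x + h)) <= Rabs (W x) + 1).
  { replace (W (x + h)) with (W x + (W (x + h) - W x)) by ring.
    eapply Rle_trans; [apply Rabs_triang | lra]. }
  eapply Rle_lt_trans; [apply Rabs_triang|]. rewrite !Rabs_mult.
  assert (A1 : Rabs (q - n) * Rabs (W (x + h)) <= eps / (2 * (Rabs (W x) + 1)) * (Rabs (W x) + 1)).
  { apply Rmult_le_compat; try apply Rabs_pos; lra. }
  assert (A2 : Rabs n * Rabs (W (x + h) - W x) <= Rabs n * (eps / (2 * (Rabs n + 1)))).
  { apply Rmult_le_compat_l; lra. }
  replace (eps / (2 * (Rabs (W x) + 1)) * (Rabs (W x) + 1)) with (eps / 2) in A1 by (field; lra).
  assert (A3 : Rabs n * (eps / (2 * (Rabs n + 1))) < eps / 2).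
  { replace (eps / 2) with ((Rabs n + 1) * (eps / (2 * (Rabs n + 1)))) by (field; lra).
    apply Rmult_lt_compat_r; [apply Rdiv_lt_0_compat; lra | lra]. }
  lra.
Qed.

(* The Lorentz boost with parameter [e] preserving the cone [x ^ 2 * sg = u ^ 2], in
   the polar coordinate [m = x / u]. *)
Definition boost (sg e m : R) : R := (m + e) / (1 + sg * e * m).

(** [u] meets the ray of slope [tau] at the right contact point, and going left it decreases more
    slowly than the ray. *)
Lemma above_right_ray (a : R -> R) (P Q tau T b th0 : R) (xi1 xi2 : R -> R)
    (u ux uxx : R -> R -> R) :
  regular_solution a P Q tau T b xi1 xi2 u ux uxx -> 0 <= th0 < tau ->
  (forall x t, 0 < t < T -> interior_slice xi1 xi2 t x -> ux x t <= th0) ->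
  forall x t, 0 < t < T -> interior_slice xi1 xi2 t x -> tau * x < u x t.
Proof.
  intros (Hdom & Cu & Cux & Hu & Hx & Ht & Hbc & Hsc) Hth Hle x t H1 [I1 I2].
  apply Rnot_le_lt. intro Hc.
  destruct (Hbc t H1) as (_ & _ & _ & B4).
  assert (Hd : 0 < (tau - th0) * (xi2 t - x)) by (apply Rmult_lt_0_compat; lra).
  destruct (domain_continuous_slice T xi1 xi2 u (xi2 t) t Cu ltac:(split; lra) ltac:(split; lra)
              _ Hd) as (e & He & K).
  pose proof (Rmin_pos e (xi2 t - x) He ltac:(lra)).
  pose proof (Rmin_l e (xi2 t - x)). pose proof (Rmin_r e (xi2 t - x)).
  set (z := xi2 t - Rmin e (xi2 t - x) / 2).
  assert (Hz : x < z < xi2 t) by (unfold z; lra).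
  specialize (K z ltac:(split; lra) ltac:(unfold z; apply Rabs_lt_between; lra)).
  apply Rabs_lt_between in K.
  assert (Hm : th0 * x - u x t <= th0 * z - u z t).
  { apply (nondecreasing_of_derive (fun y => th0 * y - u y t) (fun y => th0 - ux y t)); [lra| |].
    - intros y Hy. apply (is_derive_minus (fun y => th0 * y) (fun y => u y t)).
      + auto_derive; [trivial | ring].
      + apply Hx; [split; lra | split; lra].
    - intros y Hy. specialize (Hle y t H1 ltac:(split; lra)). lra. }
  nra.
Qed.

Lemma inside_cone (a : R -> R) (P Q tau T b th0 : R) (xi1 xi2 : R -> R)
    (u ux uxx : R -> R -> R) :
  regular_solution a P Q tau T b xi1 xi2 u ux uxx -> 0 <= th0 < tau ->
  (forall x t, 0 < t < T -> interior_slice xi1 xi2 t x -> Rabs (ux x t) <= th0) ->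
  forall x t, 0 < t < T -> interior_slice xi1 xi2 t x -> - / tau < x / u x t < / tau.
Proof.
  intros Hsol Hth Hle x t H1 I1.
  assert (Hr : tau * x < u x t).
  { apply (above_right_ray a P Q tau T b th0 xi1 xi2 u ux uxx); auto.
    intros y s Hs Iy. specialize (Hle y s Hs Iy). apply Rabs_le_between in Hle. lra. }
  assert (Hl : tau * - x < u (- - x) t).
  { apply (above_right_ray (fun p => a (- p)) (- Q) (- P) tau T b th0 xi2 xi1
      (fun x t => u (- x) t) (fun x t => - ux (- x) t) (fun x t => uxx (- x) t)); auto.
    - apply regular_solution_reflect, Hsol.
    - intros y s Hs [Iy1 Iy2]. specialize (Hle (- y) s Hs ltac:(split; lra)).
      apply Rabs_le_between in Hle. lra.
    - destruct I1; split; lra. }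
  rewrite Ropp_involutive in Hl.
  destruct Hsol as (_ & _ & _ & Hu & _).
  specialize (Hu x t ltac:(split; lra) ltac:(destruct I1; split; lra)).
  replace (- / tau) with ((- / tau * u x t) / u x t) by (field; lra).
  replace (/ tau) with ((/ tau * u x t) / u x t) at 2 by (field; lra).
  assert (Hi : 0 < / tau) by (apply Rinv_0_lt_compat; lra).
  assert (Hx : x = / tau * (tau * x)) by (field; lra).
  split; apply Rmult_lt_compat_r; try (apply Rinv_0_lt_compat; lra).
  - assert (/ tau * - u x t < / tau * (tau * x)) by (apply Rmult_lt_compat_l; lra). lra.
  - assert (/ tau * (tau * x) < / tau * u x t) by (apply Rmult_lt_compat_l; lra). lra.
Qed.

Section Boosted_field.

Variables (a : R -> R) (P Q tau th0 lo hi sg nhi : R) (Th ph : R -> R).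
Hypothesis Hprof : polar_profile a P Q tau th0 lo hi Th ph.
Hypothesis Ha : forall r, 0 < a r.
Hypothesis Hca : forall r, continuous a r.
Hypothesis Hsg : th0 ^ 2 < sg < tau ^ 2.
Hypothesis Hnhi : / tau < nhi < hi.

(** The parameter whose boost carries the ray [- / tau] to [/ tau]; every ray of the cone then lands
    at or beyond the right edge. *)
Definition max_boost : R := 2 * tau / (tau ^ 2 + sg).

Definition clamp (m : R) : R := Rmax (- / tau) (Rmin (/ tau) m).

(** [clamp] makes the field continuous on the whole line, so that it can be integrated. The cut at
    [nhi] handles boosted rays that leave (lo, hi), where nothing is known about [Th]; there the
    value is [Th nhi < Q], so a slope at least [Q] never meets it. *)
Definition boosted_slope (e m : R) : R := Th (Rmin nhi (boost sg e (clamp m))).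

(** Along a curve of slope p, crossing the ray x = m u, d(ln u) / dm = p / (1 - m p). The integral
    is thus the logarithm of the height of the boosted profile, normalised to height 1 on the
    axis. *)
Definition boosted_rate (e m : R) : R :=
  boosted_slope e m / (1 - clamp m * boosted_slope e m).

Definition boosted_log (e m : R) : R := RInt (boosted_rate e) 0 m.

Lemma tau_pos : 0 < tau.
Proof. destruct Hprof as (H0 & _). lra. Qed.

Lemma inv_tau_pos : 0 < / tau.
Proof. apply Rinv_0_lt_compat, tau_pos. Qed.

Lemma sg_pos : 0 < sg.
Proof. pose proof (pow2_ge_0 th0). lra. Qed.

Lemma clamp_bounds (m : R) : - / tau <= clamp m <= / tau.
Proof.
  pose proof inv_tau_pos. unfold clamp. split; [apply Rmax_l|].
  apply Rmax_lub; [lra | apply Rmin_l].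
Qed.

Lemma clamp_id (m : R) : - / tau <= m <= / tau -> clamp m = m.
Proof. intros H. unfold clamp. rewrite Rmin_right by lra. apply Rmax_right. lra. Qed.

Lemma max_boost_pos : 0 < max_boost.
Proof.
  unfold max_boost. pose proof tau_pos. apply Rdiv_lt_0_compat; nra.
Qed.

Lemma sg_boost_tau (e : R) : 0 <= e <= max_boost -> sg * e * / tau <= 2 * sg / (tau ^ 2 + sg).
Proof.
  intros He. pose proof sg_pos.
  replace (2 * sg / (tau ^ 2 + sg)) with (sg * max_boost * / tau) by (unfold max_boost; field; nra).
  apply Rmult_le_compat_r; [apply Rlt_le, inv_tau_pos|]. apply Rmult_le_compat_l; lra.
Qed.

(** The value of 1 + sg e m at [e = max_boost], [m = - / tau], the smallest in the admissible
    range. *)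
Definition boost_margin : R := (tau ^ 2 - sg) / (tau ^ 2 + sg).

Lemma boost_margin_pos : 0 < boost_margin.
Proof.
  unfold boost_margin. apply Rdiv_lt_0_compat; nra.
Qed.

Lemma boost_denom (e m : R) : 0 <= e <= max_boost -> - / tau <= m <= / tau ->
  boost_margin <= 1 + sg * e * m <= 2.
Proof.
  intros He Hm. pose proof (sg_boost_tau e He) as H.
  assert (E : boost_margin = 1 - 2 * sg / (tau ^ 2 + sg)) by (unfold boost_margin; field; nra).
  pose proof boost_margin_pos. assert (0 <= sg * e) by nra. split; nra.
Qed.

(** At [max_boost] this is 4 sg tau^2 < (tau^2 + sg)^2, strict because sg and tau^2 differ. *)
Lemma boost_numer (e : R) : 0 <= e <= max_boost -> 0 < 1 - sg * e ^ 2.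
Proof.
  intros He. pose proof sg_pos.
  assert (sg * e ^ 2 <= sg * max_boost ^ 2).
  { apply Rmult_le_compat_l; [lra | apply pow_incr; lra]. }
  assert (sg * max_boost ^ 2 < 1); [|lra].
  unfold max_boost.
  replace (sg * (2 * tau / (tau ^ 2 + sg)) ^ 2)
    with (4 * sg * tau ^ 2 / (tau ^ 2 + sg) ^ 2) by (field; lra).
  apply Rlt_div_l; nra.
Qed.

Lemma sg_sq_lt (m : R) : - / tau <= m <= / tau -> sg * m ^ 2 < 1.
Proof.
  intros Hm. pose proof tau_pos. pose proof inv_tau_pos. pose proof sg_pos.
  assert (Hm2 : m ^ 2 <= (/ tau) ^ 2) by nra.
  assert (sg * m ^ 2 <= sg * (/ tau) ^ 2) by (apply Rmult_le_compat_l; lra).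
  assert (sg * (/ tau) ^ 2 < tau ^ 2 * (/ tau) ^ 2) by (apply Rmult_lt_compat_r; nra).
  replace (tau ^ 2 * (/ tau) ^ 2) with 1 in H3 by (field; lra). lra.
Qed.

(** The displacement is e (1 - sg m^2) / (1 + sg e m), and sg m^2 < 1 on the cone. *)
Lemma boost_gt (e m : R) : 0 < e <= max_boost -> - / tau <= m <= / tau -> m < boost sg e m.
Proof.
  intros He Hm. pose proof (boost_denom e m ltac:(lra) Hm) as HD. pose proof boost_margin_pos.
  pose proof (sg_sq_lt m Hm). unfold boost. apply Rlt_div_r; nra.
Qed.

Lemma boost_ge (e m : R) : 0 <= e <= max_boost -> - / tau <= m <= / tau -> m <= boost sg e m.
Proof.
  intros [[He|<-] He'] Hm.
  - apply Rlt_le, boost_gt; [lra | exact Hm].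
  - unfold boost. replace ((m + 0) / (1 + sg * 0 * m)) with m by field. lra.
Qed.

Lemma is_derive_boost (e m : R) : 0 <= e <= max_boost -> - / tau <= m <= / tau ->
  is_derive (boost sg e) m ((1 - sg * e ^ 2) / (1 + sg * e * m) ^ 2).
Proof.
  intros He Hm. pose proof (boost_denom e m He Hm). pose proof boost_margin_pos.
  unfold boost. auto_derive; [lra|]. field. lra.
Qed.

Lemma clipped_boost_range (e m : R) : 0 <= e <= max_boost ->
  - / tau <= Rmin nhi (boost sg e (clamp m)) <= nhi.
Proof.
  intros He. pose proof (clamp_bounds m). pose proof (boost_ge e _ He H).
  split; [apply Rmin_glb; lra | apply Rmin_l].
Qed.

Lemma boosted_slope_bound (e m : R) : 0 <= e <= max_boost -> Rabs (boosted_slope e m) <= th0.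
Proof.
  intros He. pose proof (clipped_boost_range e m He).
  destruct Hprof as (H0 & H1 & H2 & H3 & _). apply H3. lra.
Qed.

Lemma one_minus_slope (m p : R) : - / tau <= m <= / tau -> Rabs p <= th0 ->
  1 - th0 / tau <= 1 - m * p <= 2.
Proof.
  intros Hm Hp. destruct Hprof as (H0 & _).
  apply Rabs_le_between in Hp.
  assert (Hq : th0 / tau <= 1) by (apply Rle_div_l; lra).
  unfold Rdiv in *. assert (H0' : Rabs (m * p) <= th0 * / tau).
  { rewrite Rabs_mult, Rmult_comm. apply Rmult_le_compat; try apply Rabs_pos; apply Rabs_le_between; lra. }
  apply Rabs_le_between in H0'. lra.
Qed.

Lemma slope_margin_pos : 0 < 1 - th0 / tau.
Proof.
  destruct Hprof as (H0 & _). assert (th0 / tau < 1) by (apply Rlt_div_l; lra). lra.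
Qed.

Lemma Th_decreasing (m n : R) : lo < m -> m < n -> n < hi -> Th n < Th m.
Proof.
  destruct Hprof as (H0 & H1 & H2 & H3 & _).
  apply (is_derive_decreasing Th (fun m => - (ph m ^ 2 / a (Th m)))).
  - intros x Hx. apply H3, Hx.
  - intros x Hx. destruct (H3 x Hx) as (_ & _ & Hp & _).
    assert (0 < ph x ^ 2 / a (Th x)) by (apply Rdiv_lt_0_compat; [nra | apply Ha]). lra.
Qed.

Lemma Th_nonincreasing (m n : R) : lo < m -> m <= n -> n < hi -> Th n <= Th m.
Proof.
  intros H1 [H2| ->] H3; [apply Rlt_le, Th_decreasing; auto | lra].
Qed.

Lemma continuous_clamp (m : R) : continuous clamp m.
Proof.
  apply continuous_of_nonexpansive. intro x.
  unfold clamp, Rmax, Rmin. repeat destruct (Rle_dec _ _); unfold Rabs; repeat destruct (Rcase_abs _); lra.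
Qed.

Lemma continuous_boosted_slope (e m : R) : 0 <= e <= max_boost -> continuous (boosted_slope e) m.
Proof.
  intros He. pose proof (clipped_boost_range e m He) as Hr. pose proof (clamp_bounds m) as Hm.
  unfold boosted_slope.
  apply (continuous_comp (fun m => Rmin nhi (boost sg e (clamp m))) Th).
  - apply (continuous_comp (fun m => boost sg e (clamp m)) (fun w => Rmin nhi w)).
    + apply (continuous_comp clamp (boost sg e)); [apply continuous_clamp|].
      apply (ex_derive_continuous (boost sg e)). eexists. apply is_derive_boost; auto.
    + apply continuous_of_nonexpansive. intro x.
      unfold Rmin. repeat destruct (Rle_dec _ _); unfold Rabs; repeat destruct (Rcase_abs _); lra.
  - apply (ex_derive_continuous Th). destruct Hprof as (H0 & H1 & H2 & H3 & _).
    destruct (H3 _ (conj (Rlt_le_trans _ _ _ H1 (proj1 Hr)) (Rle_lt_trans _ _ _ (proj2 Hr) (proj2 Hnhi)))) as [D _].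
    eexists. exact D.
Qed.

Lemma is_derive_boosted_log (e m : R) : 0 <= e <= max_boost ->
  is_derive (boosted_log e) m (boosted_rate e m).
Proof.
  intros He.
  assert (Hc : forall n, continuous (boosted_rate e) n).
  { intro n. unfold boosted_rate, Rdiv. apply (continuous_mult (boosted_slope e)).
    - apply continuous_boosted_slope, He.
    - apply continuous_comp with (f := fun m => 1 - clamp m * boosted_slope e m) (g := Rinv).
      + apply (continuous_minus (fun _ => 1)); [apply continuous_const|].
        apply (continuous_mult clamp (boosted_slope e));
          [apply continuous_clamp | apply continuous_boosted_slope, He].
      + apply continuous_Rinv.
        pose proof (one_minus_slope _ _ (clamp_bounds n) (boosted_slope_bound e n He)).
        pose proof slope_margin_pos. lra. }
  apply (is_derive_RInt (boosted_rate e) (boosted_log e) 0 m); [|apply Hc].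
  apply filter_forall. intro n. apply (RInt_correct (boosted_rate e)).
  apply (ex_RInt_continuous (boosted_rate e)). intros z _. apply Hc.
Qed.

Lemma is_derive_boosted_slope (e m : R) : 0 <= e <= max_boost -> - / tau < m < / tau ->
  boost sg e m < nhi ->
  is_derive (boosted_slope e) m
    (- (ph (boost sg e m) ^ 2 / a (Th (boost sg e m))) *
      ((1 - sg * e ^ 2) / (1 + sg * e * m) ^ 2)).
Proof.
  intros He Hm Hb.
  assert (Hmm : - / tau <= m <= / tau) by lra.
  pose proof (boost_ge e m He Hmm) as Hg.
  apply (is_derive_ext_loc (fun n => Th (boost sg e n))).
  - assert (Hc : continuity_pt (boost sg e) m).
    { eapply is_derive_continuity. apply is_derive_boost; auto. }
    destruct (Hc (nhi - boost sg e m)) as [d [Hd K]]; [lra|]. simpl in K. unfold R_dist in K.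
    apply (locally_between (Rmax (- / tau) (m - d)) (Rmin (/ tau) (m + d))).
    + split; [apply Rmax_lub_lt | apply Rmin_glb_lt]; lra.
    + intros n [Hn1 Hn2].
      pose proof (Rmax_l (- / tau) (m - d)). pose proof (Rmax_r (- / tau) (m - d)).
      pose proof (Rmin_l (/ tau) (m + d)). pose proof (Rmin_r (/ tau) (m + d)).
      unfold boosted_slope. rewrite clamp_id by lra. rewrite Rmin_right; [reflexivity|].
      destruct (Req_dec n m) as [->|Hne]; [lra|].
      assert (Kn : Rabs (boost sg e n - boost sg e m) < nhi - boost sg e m).
      { apply K. split; [split; [exact I | auto]|]. apply Rabs_lt_between. lra. }
      apply Rabs_lt_between in Kn. lra.
  - rewrite Rmult_comm. apply (is_derive_comp Th (boost sg e)).
    + destruct Hprof as (H0 & H1 & H2 & H3 & _). apply H3. lra.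
    + apply is_derive_boost; auto.
Qed.

Variables (T b : R) (xi1 xi2 : R -> R) (u ux uxx : R -> R -> R).
Hypothesis Hsol : regular_solution a P Q tau T b xi1 xi2 u ux uxx.
Hypothesis Hslope : forall x t, 0 < t < T -> interior_slice xi1 xi2 t x -> Q <= ux x t <= P.

Let bs := boosted_slope.
Let bt := boost sg.

Lemma PQ_bound : Rabs P <= th0 /\ Rabs Q <= th0 /\ Q < P.
Proof.
  clear Hnhi. pose proof Hprof as (H0 & H1 & H2 & H3 & H4 & H5).
  pose proof inv_tau_pos as Hi. rewrite <- H4, <- H5.
  split; [apply H3; lra|]. split; [apply H3; lra|]. apply Th_decreasing; lra.
Qed.

Lemma ux_le_th0 (x t : R) : 0 < t < T -> interior_slice xi1 xi2 t x -> Rabs (ux x t) <= th0.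
Proof.
  intros H1 H2. destruct PQ_bound as (B1 & B2 & _). specialize (Hslope x t H1 H2).
  apply Rabs_le_between in B1, B2. apply Rabs_le_between. lra.
Qed.

Lemma ratio_bounds (x t : R) : 0 < t < T -> interior_slice xi1 xi2 t x ->
  - / tau < x / u x t < / tau.
Proof.
  apply (inside_cone a P Q tau T b th0 xi1 xi2 u ux uxx Hsol).
  - apply Hprof.
  - apply ux_le_th0.
Qed.

Lemma u_pos (x t : R) : time_interval T t -> slice xi1 xi2 t x -> 0 < u x t.
Proof. apply Hsol. Qed.

Lemma is_derive_ratio (x t : R) : time_interval T t -> interior_slice xi1 xi2 t x ->
  is_derive (fun y => y / u y t) x ((1 - x / u x t * ux x t) / u x t).
Proof.
  intros H1 H2. pose proof Hsol as (Hdom & Cu & Cux & Hu & Hx & _).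
  destruct (Hx x t H1 H2) as [D1 _].
  assert (0 < u x t) by (apply u_pos; [exact H1 | destruct H2; split; lra]).
  replace ((1 - x / u x t * ux x t) / u x t)
    with (1 * / u x t + x * (- ux x t / u x t ^ 2)) by (field; lra).
  apply (is_derive_mult (fun y : R => y) (fun y => / u y t)).
  - auto_derive; [trivial | ring].
  - apply (is_derive_inv (fun y => u y t)); [exact D1 | lra].
  - intros n m. apply Rmult_comm.
Qed.

Lemma ux_boundary_limit (t e : R) : 0 <= e <= max_boost ->
  0 < t < T -> bs e (- / tau) < P -> bs e (/ tau) < Q ->
  exists eps, 0 < eps /\ forall x, interior_slice xi1 xi2 t x ->
      x < - xi1 t + eps \/ xi2 t - eps < x -> bs e (x / u x t) < ux x t.
Proof.
  intros He H1 HP HQ. pose proof Hsol as (Hdom & Cu & Cux & Hu & Hx & Ht & Hbc & Hsc).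
  pose proof Hdom as (HT & Hb & Hpos & _).
  assert (Tt : time_interval T t) by (split; lra). destruct (Hpos t Tt) as [X1 X2].
  destruct (Hbc t H1) as (B1 & B2 & B3 & B4).
  assert (Htau : 0 < tau) by (pose proof Hprof as (? & _); lra).
  assert (CN : domain_continuous T xi1 xi2 (fun x t => ux x t - bs e (x / u x t))).
  { intros xn tn x s Hn [Ts Ss] Lx Lt. simpl in Ts, Ss. apply is_lim_seq_minus'.
    - apply Cux; auto. split; auto.
    - apply (is_lim_seq_continuous (bs e)).
      + apply continuity_pt_filterlim.
        apply (continuous_boosted_slope); auto.
      + apply is_lim_seq_div'; [exact Lx | apply Cu; auto; split; auto |].
        specialize (u_pos x s Ts Ss). lra. }
  assert (E1 : - xi1 t / u (- xi1 t) t = - / tau) by (rewrite B2; field; lra).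
  assert (E2 : xi2 t / u (xi2 t) t = / tau) by (rewrite B4; field; lra).
  destruct (domain_continuous_slice T xi1 xi2 _ (- xi1 t) t CN Tt ltac:(split; lra)
     (P - bs e (- / tau)) ltac:(lra)) as (e1 & He1 & K1).
  destruct (domain_continuous_slice T xi1 xi2 _ (xi2 t) t CN Tt ltac:(split; lra)
     (Q - bs e (/ tau)) ltac:(lra)) as (e2 & He2 & K2).
  simpl in K1, K2. rewrite E1, B1 in K1. rewrite E2, B3 in K2.
  exists (Rmin e1 e2). split; [apply Rmin_pos; lra|].
  pose proof (Rmin_l e1 e2). pose proof (Rmin_r e1 e2).
  intros x [I1 I2] [Hor|Hor].
  - specialize (K1 x ltac:(split; lra) ltac:(apply Rabs_lt_between; lra)).
    apply Rabs_lt_between in K1. lra.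
  - specialize (K2 x ltac:(split; lra) ltac:(apply Rabs_lt_between; lra)).
    apply Rabs_lt_between in K2. lra.
Qed.

(* The logarithm of the normalised speed [- ph^2 * boost'] along the boosted
   profile; it decreases strictly because [th0 ^ 2 < sg]. *)
Lemma boosted_speed_decreasing (e m1 m2 : R) :
  0 < e <= max_boost -> - / tau < m1 -> m1 < m2 -> m2 < / tau -> bt e m2 < nhi ->
  let psi := fun m => ln (ph (bt e m)) + ln ((1 - sg * e ^ 2) / (1 + sg * e * m) ^ 2) / 2
                      - boosted_log e m in
  psi m2 + e * (sg - th0 ^ 2) / 10 * m2 <= psi m1 + e * (sg - th0 ^ 2) / 10 * m1.
Proof.
  intros He H1 H2 H3 H4 psi. pose proof Hprof as (P0 & P1 & P2 & P3 & _).
  assert (He' : 0 <= e <= max_boost) by lra.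
  assert (Hmono : forall m, - / tau < m <= m2 -> bt e m < nhi).
  { intros m [Hm1 [Hm2|Hm2]]; [|rewrite Hm2; exact H4].
    eapply Rlt_trans; [|exact H4].
    apply (increasing_of_derive_pos (bt e) (fun m => (1 - sg * e ^ 2) / (1 + sg * e * m) ^ 2)); auto.
    - intros x Hx. apply (is_derive_boost); auto; lra.
    - intros x Hx. eapply is_derive_continuity.
      apply (is_derive_boost); auto; lra.
    - intros x Hx. apply Rdiv_lt_0_compat.
      + apply boost_numer; auto.
      + pose proof (boost_denom e x He' ltac:(lra)).
        pose proof (boost_margin_pos). nra. }
  (* The derivative of [psi] is -e (sg - p^2) / W with 0 < W <= 2 * 5: the factor 1 - m p is at most
     2, the rest of W at most 5. *)
  set (c := e * (sg - th0 ^ 2) / 10).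
  enough (- (psi m1 + c * m1) <= - (psi m2 + c * m2)) by lra.
  apply (nondecreasing_of_derive (fun m => - (psi m + c * m))
    (fun m => - (- e * (sg - Th (bt e m) ^ 2) /
       ((1 - m * Th (bt e m)) * ((1 + sg * e * m) * (1 - bt e m * Th (bt e m)))) + c))).
  - lra.
  - intros m Hm. apply (is_derive_opp (fun m => psi m + c * m)).
    apply (is_derive_plus psi (fun m => c * m)).
    2: { auto_derive; [trivial | ring]. }
    pose proof (boost_denom e m He' ltac:(lra)) as HD.
    pose proof (boost_margin_pos) as HD0.
    pose proof (boost_numer e He') as HN.
    pose proof (boost_ge e m He' ltac:(lra)) as Hge.
    specialize (Hmono m ltac:(lra)).
    destruct (P3 (bt e m)) as (D1 & D2 & D3 & D4 & D5); [change (boost sg e m) with (bt e m) in Hge; lra|].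
    pose proof (one_minus_slope m _ ltac:(lra) D4) as D6.
    pose proof (slope_margin_pos) as D7.
    assert (Db : is_derive (bt e) m ((1 - sg * e ^ 2) / (1 + sg * e * m) ^ 2)).
    { apply (is_derive_boost); auto; lra. }
    assert (Dl : is_derive (boosted_log e) m (Th (bt e m) / (1 - m * Th (bt e m)))).
    { replace (Th (bt e m) / (1 - m * Th (bt e m))) with (boosted_rate e m).
      - apply (is_derive_boosted_log); auto.
      - unfold boosted_rate, boosted_slope. rewrite clamp_id by lra.
        rewrite Rmin_right; [reflexivity|]. apply Rlt_le, Hmono. }
    assert (Dp : is_derive (fun m => ln (ph (bt e m))) m
       ((1 - sg * e ^ 2) / (1 + sg * e * m) ^ 2 *
         (Th (bt e m) / (1 - bt e m * Th (bt e m))))).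
    { replace (Th (bt e m) / (1 - bt e m * Th (bt e m)))
        with (ph (bt e m) * Th (bt e m) / (1 - bt e m * Th (bt e m)) * / ph (bt e m))
        by (field; lra).
      apply (is_derive_comp (fun w => ln (ph w)) (bt e)); [|exact Db].
      apply (is_derive_comp ln ph); [apply is_derive_ln; exact D3 | exact D2]. }
    assert (Dn : is_derive (fun m => ln ((1 - sg * e ^ 2) / (1 + sg * e * m) ^ 2) / 2) m
       (- (sg * e) / (1 + sg * e * m))).
    { auto_derive.
      - repeat split; try lra; [nra|]. apply Rdiv_lt_0_compat; nra.
      - field. repeat split; lra. }
    (* The first two of the three contributions add up to (p - sg e) / (1 + sg e m - (m + e) p).
       Subtracting p / (1 - m p) cancels everything in the numerator except e (p^2 - sg). *)
    replace (- e * (sg - Th (bt e m) ^ 2) /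
       ((1 - m * Th (bt e m)) * ((1 + sg * e * m) * (1 - bt e m * Th (bt e m)))))
      with ((1 - sg * e ^ 2) / (1 + sg * e * m) ^ 2 *
         (Th (bt e m) / (1 - bt e m * Th (bt e m))) + - (sg * e) / (1 + sg * e * m)
         - Th (bt e m) / (1 - m * Th (bt e m))).
    + apply (is_derive_minus (fun m => ln (ph (bt e m)) + ln ((1 - sg * e ^ 2) / (1 + sg * e * m) ^ 2) / 2)
               (boosted_log e)); [|exact Dl].
      apply (is_derive_plus (fun m => ln (ph (bt e m)))
               (fun m => ln ((1 - sg * e ^ 2) / (1 + sg * e * m) ^ 2) / 2)); assumption.
    + assert (HX : 0 < 1 + sg * e * m - (m + e) * Th (bt e m)).
      { replace (1 + sg * e * m - (m + e) * Th (bt e m))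
          with ((1 + sg * e * m) * (1 - bt e m * Th (bt e m))) by (unfold bt, boost; field; lra).
        apply Rmult_lt_0_compat; lra. }
      set (p := Th (bt e m)) in *.
      replace (bt e m) with ((m + e) / (1 + sg * e * m)) by reflexivity.
      field. repeat split; lra.
  - intros m Hm.
    pose proof (boost_denom e m He' ltac:(lra)) as HD.
    pose proof (boost_margin_pos) as HD0.
    pose proof (boost_ge e m He' ltac:(lra)) as Hge.
    specialize (Hmono m ltac:(lra)).
    destruct (P3 (bt e m)) as (D1 & D2 & D3 & D4 & D5); [change (boost sg e m) with (bt e m) in Hge; lra|].
    pose proof (one_minus_slope m _ ltac:(lra) D4) as D6.
    pose proof (slope_margin_pos) as D7.
    set (p := Th (bt e m)) in *.
    set (W := (1 - m * p) * ((1 + sg * e * m) * (1 - bt e m * p))).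
    assert (HX : 0 < (1 + sg * e * m) * (1 - bt e m * p) <= 5).
    { split; [apply Rmult_lt_0_compat; lra|].
      replace ((1 + sg * e * m) * (1 - bt e m * p)) with (1 + sg * e * m - m * p - e * p)
        by (unfold bt, boost; field; lra).
      assert (- 2 <= e * p); [|lra].
      assert (Hep : Rabs (e * p) <= 2).
      { rewrite Rabs_mult. rewrite (Rabs_pos_eq e) by lra.
        assert (e * Rabs p <= max_boost * tau).
        { apply Rmult_le_compat; try lra. apply Rabs_pos. }
        assert (max_boost * tau <= 2); [|lra].
        unfold max_boost. assert (0 <= th0 ^ 2) by nra.
        replace (2 * tau / (tau ^ 2 + sg) * tau) with (2 * tau ^ 2 / (tau ^ 2 + sg)) by (field; lra).
        apply Rle_div_l; lra. }
      apply Rabs_le_between in Hep. lra. }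
    assert (HW : 0 < W <= 10).
    { unfold W. split; [apply Rmult_lt_0_compat; lra | nra]. }
    assert (Hp2 : p ^ 2 <= th0 ^ 2).
    { apply Rabs_le_between in D4. nra. }
    assert (Hn : c <= e * (sg - p ^ 2) / W).
    { apply -> Rle_div_r; [|lra]. unfold c.
      assert (e * (sg - th0 ^ 2) / 10 * W <= e * (sg - th0 ^ 2)).
      { assert (0 <= e * (sg - th0 ^ 2)) by (apply Rmult_le_pos; lra). nra. }
      eapply Rle_trans; [exact H | apply Rmult_le_compat_l; lra]. }
    replace (- e * (sg - p ^ 2) / W) with (- (e * (sg - p ^ 2) / W)) by (field; lra). lra.
Qed.

(** One step of the continuation, from the weaker barrier [e'] to [e]. The gap allowed between them
    carries the square of 1 - th0 / tau because, relative to m = x / u, f has rate (p - q) / ((1 - m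
    p) (1 - m q)), and both factors are bounded below by that number. *)
Lemma boosted_slope_step (e e' dl : R) :
  0 < e <= max_boost -> 0 < dl < e * (sg - th0 ^ 2) / 10 ->
  (forall m, - / tau <= m <= / tau -> bs e m <= bs e' m + dl * (1 - th0 / tau) ^ 2) ->
  (forall x t, 0 < t < T -> interior_slice xi1 xi2 t x -> bs e' (x / u x t) <= ux x t) ->
  forall x t, 0 < t < T -> interior_slice xi1 xi2 t x -> bs e (x / u x t) <= ux x t.
Proof.
  intros He Hdl Hgap Hbar.
  pose proof Hsol as (Hdom & Cu & Cux & Hu & Hx & Ht & Hbc & Hsc).
  pose proof Hdom as (HT & Hb & Hpos & Hsxi & C1 & C2).
  pose proof Hprof as (P0 & P1 & P2 & P3 & P4 & P5).
  assert (He' : 0 <= e <= max_boost) by lra.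
  assert (Hit : 0 < / tau) by (apply Rinv_0_lt_compat; lra).
  pose proof (slope_margin_pos) as Hk.
  set (k := 1 - th0 / tau) in *.
  assert (Hbsb : forall m, Rabs (bs e m) <= th0).
  { intro m. apply (boosted_slope_bound); auto. }
  assert (Hden : forall m, - / tau <= m <= / tau -> k <= 1 - m * bs e m <= 2).
  { intros m Hm. apply (one_minus_slope m _ Hm (Hbsb m)). }
  assert (Hdenu : forall x t, 0 < t < T -> interior_slice xi1 xi2 t x ->
     k <= 1 - x / u x t * ux x t <= 2).
  { intros x t H1 H2. apply (one_minus_slope).
    - pose proof (ratio_bounds x t H1 H2). lra.
    - apply ux_le_th0; auto. }
  pose (S := boosted_log e).
  assert (DS : forall m, is_derive S m (boosted_rate e m)).
  { intro m. apply (is_derive_boosted_log); auto. }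
  assert (Rate : forall m, - / tau <= m <= / tau ->
    boosted_rate e m = bs e m / (1 - m * bs e m)).
  { intros m Hm. unfold boosted_rate. rewrite clamp_id by auto. reflexivity. }
  (* [f] is constant along a boosted profile dilated about the origin, and its x-derivative has the
     sign of the slope minus the barrier. *)
  pose (f := fun x t => ln (u x t) - S (x / u x t)).
  pose (fx := fun x t => (ux x t - bs e (x / u x t)) * / (u x t * (1 - x / u x t * bs e (x / u x t)))).
  assert (Dfx : forall x t, 0 < t < T -> interior_slice xi1 xi2 t x ->
     is_derive (fun y => f y t) x (fx x t)).
  { intros x t H1 H2. assert (Tt : time_interval T t) by (split; lra).
    assert (Hup := u_pos x t Tt ltac:(destruct H2; split; lra)).
    pose proof (ratio_bounds x t H1 H2) as Hm.
    specialize (Hden (x / u x t) ltac:(lra)).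
    destruct (Hx x t Tt H2) as [D1 _].
    unfold f. replace (fx x t) with (ux x t * / u x t -
      (1 - x / u x t * ux x t) / u x t * boosted_rate e (x / u x t)).
    - apply (is_derive_minus (fun y => ln (u y t)) (fun y => S (y / u y t))).
      + apply (is_derive_comp ln (fun y => u y t)); [apply is_derive_ln; exact Hup | exact D1].
      + apply (is_derive_comp S (fun y => y / u y t)); [apply DS | apply is_derive_ratio; auto].
    - rewrite Rate by lra. unfold fx. set (p := bs e (x / u x t)) in *.
      set (q := ux x t). set (m := x / u x t) in *. field. lra. }
  assert (Mono : forall x y t, time_interval T t -> slice xi1 xi2 t x -> slice xi1 xi2 t y ->
    x <= y -> f x t <= f y t).
  { apply (monotone_of_two_point T b xi1 xi2 f fx Hdom).
    - intros xn tn x t Hn [Tt St] Lx Lt. simpl in Tt, St.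
      assert (Hup := u_pos x t Tt St).
      assert (Lu : is_lim_seq (fun n => u (xn n) (tn n)) (u x t)) by (apply Cu; auto; split; auto).
      unfold f. apply is_lim_seq_minus'.
      + apply (is_lim_seq_continuous ln); [|exact Lu].
        eapply is_derive_continuity. apply is_derive_ln. exact Hup.
      + apply (is_lim_seq_continuous S).
        * eapply is_derive_continuity. apply DS.
        * apply is_lim_seq_div'; auto. lra.
    - exact Dfx.
    - intros t H1.
      (* A boost moves both edge rays to the right and [Th] decreases strictly, so the barrier lies
         strictly below [P] and [Q] at the contact points. *)
      destruct (ux_boundary_limit t e He' H1) as (eps & Heps & K).
      + unfold bs, boosted_slope. rewrite clamp_id by lra.
        pose proof (boost_gt e (- / tau) He ltac:(lra)).
        rewrite <- P4. apply (Th_decreasing); auto.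
        * apply Rmin_glb_lt; lra.
        * eapply Rle_lt_trans; [apply Rmin_l | lra].
      + unfold bs, boosted_slope. rewrite clamp_id by lra.
        pose proof (boost_gt e (/ tau) He ltac:(lra)).
        rewrite <- P5. apply (Th_decreasing); auto; try lra.
        * apply Rmin_glb_lt; lra.
        * eapply Rle_lt_trans; [apply Rmin_l | lra].
      + exists eps. split; [exact Heps|]. intros x Ix Hor. specialize (K x Ix Hor).
        pose proof (ratio_bounds x t H1 Ix) as Hm. specialize (Hden (x / u x t) ltac:(lra)).
        assert (Hup := u_pos x t ltac:(split; lra) ltac:(destruct Ix; split; lra)).
        unfold fx. apply Rmult_lt_0_compat; [lra|]. apply Rinv_0_lt_compat.
        apply Rmult_lt_0_compat; lra.
    - intros x y t Tt Sx Sy. unfold f.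
      pose proof (rescaled_time_interval T b t Hb Tt) as Tt'.
      pose proof (proj1 (slice_rescale T b xi1 xi2 Hdom x t Tt) Sx) as Sx'.
      pose proof (proj1 (slice_rescale T b xi1 xi2 Hdom y t Tt) Sy) as Sy'.
      pose proof (u_pos _ _ Tt' Sx') as Ux. pose proof (u_pos _ _ Tt' Sy') as Uy.
      rewrite (Hsc x t Tt Sx), (Hsc y t Tt Sy). rewrite !ln_mult by lra.
      set (v := u (/ b * x) _) in *. set (w := u (/ b * y) _) in *.
      replace (y / (b * w)) with (/ b * y / w) by (field; lra).
      replace (x / (b * v)) with (/ b * x / v) by (field; lra). ring.
    - intros x y t H1 Ix Iy Hxy Hf Fx Fy.
      assert (Tt : time_interval T t) by (split; lra).
      assert (Facts : forall z, interior_slice xi1 xi2 t z -> fx z t = 0 ->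
        let m := z / u z t in let p := Th (bt e m) in
        bt e m < nhi /\ ux z t = p /\ bs e m = p /\
        is_derive (fun z => fx z t) z
          ((uxx z t + ph (bt e m) ^ 2 / a p * ((1 - sg * e ^ 2) / (1 + sg * e * m) ^ 2)
                      * ((1 - m * p) / u z t)) * / (u z t * (1 - m * p))) /\
        is_derive (fun s => f z s) t
          (a p * ((uxx z t + ph (bt e m) ^ 2 / a p * ((1 - sg * e ^ 2) / (1 + sg * e * m) ^ 2)
                      * ((1 - m * p) / u z t)) * / (u z t * (1 - m * p)))
           + - (ph (bt e m) ^ 2 * ((1 - sg * e ^ 2) / (1 + sg * e * m) ^ 2) / u z t ^ 2))).
      { intros z Iz Fz m p.
        assert (Hup := u_pos z t Tt ltac:(destruct Iz; split; lra)).
        pose proof (ratio_bounds z t H1 Iz) as Hm. fold m in Hm.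
        specialize (Hden m ltac:(lra)).
        assert (Hinv : 0 < / (u z t * (1 - m * bs e m))).
        { apply Rinv_0_lt_compat. apply Rmult_lt_0_compat; lra. }
        assert (Htch : ux z t = bs e m).
        { unfold fx in Fz. fold m in Fz. apply Rmult_integral in Fz. destruct Fz; lra. }
        (* A contact cannot take place on the cut part of the field, whose value [Th nhi] is below
           [Q]. *)
        assert (Hnc : bt e m < nhi).
        { apply Rnot_le_lt. intro Hle. specialize (Hslope z t H1 Iz).
          rewrite Htch in Hslope. unfold bs, boosted_slope in Hslope.
          rewrite clamp_id in Hslope by lra. rewrite Rmin_left in Hslope by exact Hle.
          assert (Th nhi < Th (/ tau)); [|lra].
          apply (Th_decreasing); auto; lra. }
        assert (Hbs : bs e m = p).
        { unfold bs, boosted_slope. rewrite clamp_id by lra.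
          rewrite Rmin_right by (apply Rlt_le, Hnc). reflexivity. }
        assert (Dbs : is_derive (bs e) m (- (ph (bt e m) ^ 2 / a p) *
                       ((1 - sg * e ^ 2) / (1 + sg * e * m) ^ 2))).
        { apply (is_derive_boosted_slope); auto. }
        set (B := (1 - sg * e ^ 2) / (1 + sg * e * m) ^ 2) in *.
        rewrite Hbs in *.
        assert (Dm : is_derive (fun y => y / u y t) z ((1 - m * p) / u z t)).
        { rewrite <- Htch. apply is_derive_ratio; auto. }
        destruct (Hx z t Tt Iz) as [D1 D2].
        split; [exact Hnc|]. split; [exact Htch|]. split; [reflexivity|]. split.
        - replace (u z t * (1 - m * p)) with (u z t * (1 - m * bs e m)) by (rewrite Hbs; ring).
          apply (is_derive_mult_zero (fun y => ux y t - bs e (y / u y t))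
                  (fun y => / (u y t * (1 - y / u y t * bs e (y / u y t))))).
          + replace (uxx z t + ph (bt e m) ^ 2 / a p * B * ((1 - m * p) / u z t))
              with (uxx z t - (1 - m * p) / u z t * (- (ph (bt e m) ^ 2 / a p) * B)) by ring.
            apply (is_derive_minus (fun y => ux y t) (fun y => bs e (y / u y t))); [exact D2|].
            apply (is_derive_comp (bs e) (fun y => y / u y t)); [exact Dbs | exact Dm].
          + fold m. rewrite Hbs. lra.
          + apply continuity_pt_inv.
            2: { fold m. rewrite Hbs. apply Rgt_not_eq. apply Rmult_lt_0_compat; lra. }
            assert (Cm := is_derive_continuity _ _ _ Dm).
            apply continuity_pt_mult; [apply (is_derive_continuity _ _ _ D1)|].
            apply continuity_pt_minus; [apply continuity_pt_const; intros ? ?; reflexivity|].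
            apply continuity_pt_mult; [exact Cm|].
            apply (continuity_pt_comp (fun y => y / u y t) (bs e)); [exact Cm|].
            apply (is_derive_continuity _ _ _ Dbs).
        - pose proof (Ht z t H1 Iz) as Dut. rewrite Htch in Dut.
          pose proof (Ha p) as Hap.
          replace (a p * ((uxx z t + ph (bt e m) ^ 2 / a p * B * ((1 - m * p) / u z t)) *
               / (u z t * (1 - m * p))) + - (ph (bt e m) ^ 2 * B / u z t ^ 2))
            with (a p * uxx z t * / u z t -
              z * (- (a p * uxx z t) / u z t ^ 2) * (p / (1 - m * p))).
          + unfold f. apply (is_derive_minus (fun s => ln (u z s)) (fun s => S (z / u z s))).
            * apply (is_derive_comp ln (fun s => u z s)); [apply is_derive_ln; exact Hup | exact Dut].
            * apply (is_derive_comp S (fun s => z / u z s)).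
              { rewrite <- Hbs. rewrite <- Rate by lra. apply DS. }
              unfold Rdiv at 1. apply (is_derive_scal (fun s => / u z s)).
              apply (is_derive_inv (fun s => u z s)); [exact Dut | lra].
          + assert (Hz : z = m * u z t) by (unfold m; field; lra).
            set (U := u z t) in *. set (V := uxx z t) in *.
            clearbody m p B U V. rewrite Hz. field. repeat split; lra. }
      destruct (Facts x Ix Fx) as (A1 & A2 & A3 & A4 & A5).
      destruct (Facts y Iy Fy) as (B1 & B2 & B3 & B4 & B5).
      do 6 eexists. split; [|split; [|split; [|split; [exact A4 | split; [exact B4 |
        split; [exact A5 | exact B5]]]]]].
      + apply Rlt_le, Ha.
      + apply Rlt_le, Ha.
      + assert (Hm12 : x / u x t < y / u y t).
        { apply (increasing_of_derive_pos (fun z => z / u z t)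
                  (fun z => (1 - z / u z t * ux z t) / u z t)); auto.
          - intros z Hz. apply is_derive_ratio; [exact Tt | destruct Ix, Iy; split; lra].
          - intros z Hz. eapply is_derive_continuity.
            apply is_derive_ratio; [exact Tt | destruct Ix, Iy; split; lra].
          - intros z Hz. assert (Iz : interior_slice xi1 xi2 t z) by (destruct Ix, Iy; split; lra).
            assert (Hup := u_pos z t Tt ltac:(destruct Iz; split; lra)).
            specialize (Hdenu z t H1 Iz). apply Rdiv_lt_0_compat; lra. }
        pose proof (ratio_bounds x t H1 Ix) as Rx. pose proof (ratio_bounds y t H1 Iy) as Ry.
        pose proof (boosted_speed_decreasing e _ _ He ltac:(apply Rx) Hm12 ltac:(apply Ry) B1) as Hpsi.
        cbv beta zeta in Hpsi.
        (* The weaker barrier limits how fast [f] can decrease, at rate [dl] in the variable x /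
           u. *)
        assert (Hff : f x t + dl * (x / u x t) <= f y t + dl * (y / u y t)).
        { apply (nondecreasing_of_derive (fun z => f z t + dl * (z / u z t))
            (fun z => fx z t + dl * ((1 - z / u z t * ux z t) / u z t))); [lra| |].
          - intros z Hz. assert (Iz : interior_slice xi1 xi2 t z) by (destruct Ix, Iy; split; lra).
            apply (is_derive_plus (fun z => f z t) (fun z => dl * (z / u z t))).
            + apply Dfx; auto.
            + apply (is_derive_scal (fun z => z / u z t)). apply is_derive_ratio; auto.
          - intros z Hz. assert (Iz : interior_slice xi1 xi2 t z) by (destruct Ix, Iy; split; lra).
            assert (Hup := u_pos z t Tt ltac:(destruct Iz; split; lra)).
            specialize (Hdenu z t H1 Iz). pose proof (ratio_bounds z t H1 Iz) as Hm.
            specialize (Hden (z / u z t) ltac:(lra)). specialize (Hgap (z / u z t) ltac:(lra)).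
            specialize (Hbar z t H1 Iz). unfold fx.
            set (m := z / u z t) in *. set (p := ux z t) in *. set (q := bs e m) in *.
            replace ((p - q) * / (u z t * (1 - m * q)) + dl * ((1 - m * p) / u z t))
              with (((p - q) + dl * ((1 - m * p) * (1 - m * q))) * / (u z t * (1 - m * q)))
              by (field; lra).
            apply Rmult_le_pos.
            + assert (k ^ 2 <= (1 - m * p) * (1 - m * q)).
              { replace (k ^ 2) with (k * k) by ring. apply Rmult_le_compat; lra. }
              assert (dl * k ^ 2 <= dl * ((1 - m * p) * (1 - m * q))).
              { apply Rmult_le_compat_l; lra. }
              lra.
            + apply Rlt_le, Rinv_0_lt_compat. apply Rmult_lt_0_compat; lra. }
        (* Written as an exponential, the source is compared through psi - f: from [x] to [y], psi
           drops by at least c (Y - X) and [f] by at most dl (Y - X), with dl < c. *)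
        assert (Key : forall z, interior_slice xi1 xi2 t z -> bt e (z / u z t) < nhi ->
          ph (bt e (z / u z t)) ^ 2 * ((1 - sg * e ^ 2) / (1 + sg * e * (z / u z t)) ^ 2) / u z t ^ 2
          = exp (2 * (ln (ph (bt e (z / u z t))) +
             ln ((1 - sg * e ^ 2) / (1 + sg * e * (z / u z t)) ^ 2) / 2
             - boosted_log e (z / u z t) - f z t))).
        { intros z Iz Hlt. assert (Hup := u_pos z t Tt ltac:(destruct Iz; split; lra)).
          pose proof (ratio_bounds z t H1 Iz) as Hm. set (m := z / u z t) in *.
          pose proof (boost_denom e m He' ltac:(lra)) as HD.
          pose proof (boost_margin_pos) as HD0.
          pose proof (boost_numer e He') as HN.
          pose proof (boost_ge e m He' ltac:(lra)) as Hge.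
          change (boost sg e m) with (bt e m) in Hge.
          destruct (P3 (bt e m)) as (_ & _ & D3 & _); [lra|].
          assert (HB : 0 < (1 - sg * e ^ 2) / (1 + sg * e * m) ^ 2).
          { apply Rdiv_lt_0_compat; [lra | nra]. }
          set (B := (1 - sg * e ^ 2) / (1 + sg * e * m) ^ 2) in *.
          unfold f. fold m. unfold S.
          replace (2 * (ln (ph (bt e m)) + ln B / 2 - boosted_log e m -
                  (ln (u z t) - boosted_log e m)))
            with (ln (ph (bt e m)) + ln (ph (bt e m)) + ln B + (- ln (u z t) + - ln (u z t))) by field.
          rewrite !exp_plus, exp_Ropp, !exp_ln by assumption. field. lra. }
        rewrite (Key x Ix A1), (Key y Iy B1). apply Ropp_lt_contravar, exp_increasing.
        set (X := x / u x t) in *. set (Y := y / u y t) in *.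
        set (c := e * (sg - th0 ^ 2) / 10) in *.
        assert (0 < (c - dl) * (Y - X)) by (apply Rmult_lt_0_compat; lra). lra. }
  intros x t H1 Ix.
  assert (Hn : 0 <= fx x t).
  { destruct Ix as [I1 I2].
    apply (derive_nonneg_of_monotone (fun y => f y t) x _ (xi2 t - x)); [lra| |].
    - intros y Hy. apply Mono; [split; lra | split; lra | split; lra | lra].
    - apply Dfx; [exact H1 | split; assumption]. }
  pose proof (ratio_bounds x t H1 Ix) as Hm. specialize (Hden (x / u x t) ltac:(lra)).
  assert (Hup := u_pos x t ltac:(split; lra) ltac:(destruct Ix; split; lra)).
  unfold fx in Hn. apply Rnot_lt_le. intro Hlt.
  assert (Hinv : 0 < / (u x t * (1 - x / u x t * bs e (x / u x t)))).
  { apply Rinv_0_lt_compat. apply Rmult_lt_0_compat; lra. }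
  nra.
Qed.

(** [L] bounds the rate of decrease of [Th] on [- / tau, nhi], and [/ d0 ^ 2] bounds the rate at
    which the boosted ray moves with the parameter. *)
Lemma boosted_slope_lipschitz : exists K, 0 < K /\
  forall e e' m, 0 <= e -> e <= e' -> e' <= max_boost -> - / tau <= m <= / tau ->
    bs e m <= bs e' m + K * (e' - e).
Proof.
  pose proof Hprof as (P0 & P1 & P2 & P3 & P4 & P5).
  assert (Hit : 0 < / tau) by (apply Rinv_0_lt_compat; lra).
  pose proof (boost_margin_pos) as HD0.
  set (d0 := boost_margin) in *.
  destruct (continuity_ab_maj (fun n => ph n ^ 2 / a (Th n)) (- / tau) nhi) as [n0 [Hn0 _]]; [lra| |].
  { intros n Hn. destruct (P3 n) as (D1 & D2 & D3 & D4 & D5); [lra|].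
    unfold Rdiv. apply continuity_pt_mult.
    - simpl. apply continuity_pt_mult; [apply (is_derive_continuity _ _ _ D2)|].
      apply continuity_pt_mult; [apply (is_derive_continuity _ _ _ D2)|].
      apply continuity_pt_const. intros ? ?; reflexivity.
    - apply continuity_pt_inv; [|apply Rgt_not_eq, Ha].
      apply (continuity_pt_comp Th a); [apply (is_derive_continuity _ _ _ D1)|].
      apply continuity_pt_filterlim, Hca. }
  set (L := Rabs (ph n0 ^ 2 / a (Th n0)) + 1).
  assert (HL : 0 < L) by (unfold L; pose proof (Rabs_pos (ph n0 ^ 2 / a (Th n0))); lra).
  assert (HLb : forall n, - / tau <= n <= nhi -> ph n ^ 2 / a (Th n) <= L).
  { intros n Hn. specialize (Hn0 n Hn). simpl in Hn0. unfold L.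
    pose proof (Rle_abs (ph n0 ^ 2 / a (Th n0))). simpl in H. simpl. lra. }
  exists (L / d0 ^ 2). split; [apply Rdiv_lt_0_compat; nra|].
  intros e e' m He Hee He' Hm.
  pose proof (boost_denom e m ltac:(lra) Hm) as D1.
  pose proof (boost_denom e' m ltac:(lra) Hm) as D2.
  fold d0 in D1, D2.
  pose proof (sg_sq_lt m Hm) as Hs.
  assert (Hdiff : boost sg e' m - boost sg e m =
     (e' - e) * (1 - sg * m ^ 2) / ((1 + sg * e * m) * (1 + sg * e' * m))).
  { unfold boost. field. lra. }
  assert (Hpp : d0 ^ 2 <= (1 + sg * e * m) * (1 + sg * e' * m)).
  { replace (d0 ^ 2) with (d0 * d0) by ring. apply Rmult_le_compat; lra. }
  assert (Hd2 : 0 < d0 ^ 2) by nra.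
  assert (Hlo : 0 <= boost sg e' m - boost sg e m).
  { rewrite Hdiff. apply Rdiv_le_0_compat; [apply Rmult_le_pos; lra | lra]. }
  assert (Hup : boost sg e' m - boost sg e m <= (e' - e) / d0 ^ 2).
  { rewrite Hdiff. unfold Rdiv. apply Rmult_le_compat.
    - apply Rmult_le_pos; lra.
    - apply Rlt_le, Rinv_0_lt_compat. lra.
    - assert (0 <= sg * m ^ 2).
      { apply Rmult_le_pos; [|apply pow2_ge_0]. pose proof (pow2_ge_0 th0). lra. }
      nra.
    - apply Rinv_le_contravar; lra. }
  unfold bs, boosted_slope. rewrite clamp_id by exact Hm.
  pose proof (boost_ge e m ltac:(lra) Hm) as Hge.
  set (n := Rmin nhi (boost sg e m)). set (n' := Rmin nhi (boost sg e' m)).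
  assert (Hn : - / tau <= n /\ n <= n' /\ n' <= nhi /\ n' - n <= (e' - e) / d0 ^ 2).
  { unfold n, n', Rmin. repeat destruct (Rle_dec _ _); lra. }
  destruct Hn as (N1 & N2 & N3 & N4).
  assert (Th n + L * n <= Th n' + L * n').
  { apply (nondecreasing_of_derive (fun n => Th n + L * n) (fun n => - (ph n ^ 2 / a (Th n)) + L)).
    - exact N2.
    - intros w Hw. apply (is_derive_plus Th (fun n => L * n)).
      + apply P3. lra.
      + auto_derive; [trivial | ring].
    - intros w Hw. specialize (HLb w ltac:(lra)). lra. }
  assert (L * (n' - n) <= L * ((e' - e) / d0 ^ 2)) by (apply Rmult_le_compat_l; lra).
  replace (L / d0 ^ 2 * (e' - e)) with (L * ((e' - e) / d0 ^ 2)) by (field; lra). lra.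
Qed.

(** Strictness is lost at parameter 0 and the step length is proportional to the final parameter
    [em]. The continuation therefore goes down to each [em > 0], and the Lipschitz bound in the
    parameter lets [em] tend to 0. *)
Lemma slope_ge_profile (x t : R) : 0 < t < T -> interior_slice xi1 xi2 t x ->
  Th (x / u x t) <= ux x t.
Proof.
  pose proof Hprof as (P0 & P1 & P2 & P3 & P4 & P5).
  pose proof (max_boost_pos) as He1.
  pose proof (slope_margin_pos) as Hk.
  set (e1 := max_boost) in *.
  destruct boosted_slope_lipschitz as [K [HK HL]]. fold e1 in HL.
  assert (Hall : forall em, 0 < em <= e1 -> forall x t, 0 < t < T ->
    interior_slice xi1 xi2 t x -> bs em (x / u x t) <= ux x t).
  { intros em Hem.
    set (dl := em * (sg - th0 ^ 2) / 20).
    assert (Hdl : 0 < dl) by (unfold dl; apply Rdiv_lt_0_compat; [apply Rmult_lt_0_compat|]; lra).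
    set (st := dl * (1 - th0 / tau) ^ 2 / K).
    assert (Hst : 0 < st).
    { unfold st. apply Rdiv_lt_0_compat; [|exact HK]. apply Rmult_lt_0_compat; [exact Hdl | nra]. }
    pose (en := fun n : nat => Rmax em (e1 - INR n * st)).
    assert (Hen : forall n x t, 0 < t < T -> interior_slice xi1 xi2 t x ->
      bs (en n) (x / u x t) <= ux x t).
    { induction n as [|n IH].
      (* The start is [max_boost]: all rays of the cone are pushed to [/ tau] or further, so the
         barrier is at most [Q]. *)
      - intros y s Hs Iy. unfold en. simpl INR. rewrite Rmult_0_l, Rminus_0_r, Rmax_right by lra.
        pose proof (ratio_bounds y s Hs Iy) as Hm. destruct (Hslope y s Hs Iy) as [HQ _].
        eapply Rle_trans; [|exact HQ]. unfold bs, boosted_slope. rewrite clamp_id by lra.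
        set (m := y / u y s) in *. rewrite <- P5.
        apply (Th_nonincreasing); auto; [lra| |].
        + apply Rmin_glb; [lra|]. unfold boost.
          pose proof (boost_denom e1 m ltac:(unfold e1 in *; lra) ltac:(lra)) as D1.
          pose proof (boost_margin_pos) as HD0.
          apply -> Rle_div_r; [|lra].
          assert (0 <= (m + / tau) * (1 - sg * e1 * / tau)).
          { apply Rmult_le_pos; [lra|].
            pose proof (boost_denom e1 (- / tau) ltac:(unfold e1 in *; lra) ltac:(lra)) as D2.
            lra. }
          assert (E : e1 + e1 * sg * (/ tau) ^ 2 = 2 * / tau).
          { unfold e1, max_boost. field. split; [lra | nra]. }
          nra.
        + eapply Rle_lt_trans; [apply Rmin_l | lra].
      - assert (Hr : em <= en (S n) /\ en (S n) <= en n /\ en n <= e1 /\ en n <= en (S n) + st).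
        { unfold en. rewrite S_INR. pose proof (pos_INR n).
          assert (0 <= INR n * st) by (apply Rmult_le_pos; lra).
          unfold Rmax. repeat destruct (Rle_dec _ _); lra. }
        destruct Hr as (R1 & R2 & R3 & R4).
        apply (boosted_slope_step (en (S n)) (en n) dl).
        + fold e1. lra.
        + split; [exact Hdl|]. unfold dl.
          assert (em * (sg - th0 ^ 2) <= en (S n) * (sg - th0 ^ 2)) by (apply Rmult_le_compat_r; lra).
          assert (0 < em * (sg - th0 ^ 2)) by (apply Rmult_lt_0_compat; lra). lra.
        + intros m Hm. specialize (HL (en (S n)) (en n) m ltac:(lra) R2 R3 Hm).
          assert (K * (en n - en (S n)) <= K * st) by (apply Rmult_le_compat_l; lra).
          replace (K * st) with (dl * (1 - th0 / tau) ^ 2) in H by (unfold st; field; lra). lra.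
        + exact IH. }
    destruct (nfloor_ex ((e1 - em) / st)) as [n [Hn1 Hn2]].
    { apply Rdiv_le_0_compat; lra. }
    intros y s Hs Iy. specialize (Hen (S n) y s Hs Iy).
    replace (en (S n)) with em in Hen; [exact Hen|].
    unfold en. symmetry. apply Rmax_left. rewrite S_INR.
    assert (e1 - em = (e1 - em) / st * st) by (field; lra). nra. }
  intros H1 Ix. apply le_epsilon. intros eps Heps.
  pose proof (ratio_bounds x t H1 Ix) as Hm.
  set (em := Rmin e1 (eps / K)).
  assert (Hem : 0 < em) by (apply Rmin_pos; [lra | apply Rdiv_lt_0_compat; lra]).
  assert (Hem1 : em <= e1) by apply Rmin_l. assert (Hem2 : em <= eps / K) by apply Rmin_r.
  specialize (Hall em ltac:(lra) x t H1 Ix).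
  specialize (HL 0 em (x / u x t) ltac:(lra) ltac:(lra) ltac:(lra) ltac:(lra)).
  assert (K * (em - 0) <= eps).
  { replace eps with (K * (eps / K)) by (field; lra). rewrite Rminus_0_r. apply Rmult_le_compat_l; lra. }
  assert (E0 : bs 0 (x / u x t) = Th (x / u x t)).
  { unfold bs, boosted_slope. rewrite clamp_id by lra. f_equal.
    set (m := x / u x t) in *. unfold boost.
    replace ((m + 0) / (1 + sg * 0 * m)) with m by (field; lra).
    apply Rmin_right. lra. }
  lra.
Qed.

End Boosted_field.

(** * Classification of self-similar solutions *)

Lemma derive_zero_constant (f : R -> R) (a b : R) :
  a <= b -> (forall x, a <= x <= b -> is_derive f x 0) -> f a = f b.
Proof.
  intros Hab Hd. apply Rle_antisym.
  - apply (nondecreasing_of_derive f (fun _ => 0)); auto. intros; lra.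
  - enough (- f a <= - f b) by lra.
    apply (nondecreasing_of_derive (fun x => - f x) (fun _ => 0)); auto.
    + intros x Hx. replace 0 with (- 0) by ring. apply (is_derive_opp f). auto.
    + intros; lra.
Qed.

Section Classification.

Variables (a : R -> R) (P Q tau th0 lo hi T b : R) (Th ph : R -> R).
Variables (xi1 xi2 : R -> R) (u ux uxx : R -> R -> R).
Hypothesis Hprof : polar_profile a P Q tau th0 lo hi Th ph.
Hypothesis Ha : forall r, 0 < a r.
Hypothesis Hda : forall r, ex_derive a r.
Hypothesis Hca : forall r, continuous (Derive a) r.
Hypothesis Hsol : regular_solution a P Q tau T b xi1 xi2 u ux uxx.

Lemma profile_slopes_lt : Q < P.
Proof.
  pose proof Hprof as (H0 & H1 & H2 & H3 & E1 & E2).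
  assert (0 < / tau) by (apply Rinv_0_lt_compat; lra).
  rewrite <- E1, <- E2. apply (Th_decreasing a P Q tau th0 lo hi Th ph); auto; lra.
Qed.

Lemma ratio_in_cone (x t : R) : 0 < t < T -> interior_slice xi1 xi2 t x ->
  - / tau < x / u x t < / tau.
Proof.
  apply (ratio_bounds a P Q tau th0 lo hi Th ph Hprof Ha T b xi1 xi2 u ux uxx Hsol).
  apply (slope_bounds a P Q tau T b xi1 xi2 u ux uxx Hsol Ha Hda Hca).
  apply Rlt_le, profile_slopes_lt.
Qed.

(** The conditions on [sg] and [nhi] are met by midpoints. The upper bound is the lower one for the
    reflected solution, whose profile lives on (- hi, - lo). *)
Lemma slope_eq_profile (x t : R) : 0 < t < T -> interior_slice xi1 xi2 t x ->
  ux x t = Th (x / u x t).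
Proof.
  pose proof Hprof as (H0 & H1 & H2 & H3 & _). intros Ht Ix.
  pose proof profile_slopes_lt as HPQ.
  assert (Hc : forall r, continuous a r) by (intro r; apply (ex_derive_continuous a), Hda).
  assert (Hsg : th0 ^ 2 < (th0 ^ 2 + tau ^ 2) / 2 < tau ^ 2) by nra.
  pose proof (slope_bounds a P Q tau T b xi1 xi2 u ux uxx Hsol Ha Hda Hca ltac:(lra)) as Hsl.
  apply Rle_antisym.
  - assert (Hr : - Th (- (- x / u (- - x) t)) <= - ux (- - x) t).
    { apply (slope_ge_profile (fun p => a (- p)) (- Q) (- P) tau th0 (- hi) (- lo)
        ((th0 ^ 2 + tau ^ 2) / 2) ((/ tau + - lo) / 2) (fun m => - Th (- m)) (fun m => ph (- m)))
        with (T := T) (b := b) (xi1 := xi2) (xi2 := xi1) (u := fun x t => u (- x) t)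
          (ux := fun x t => - ux (- x) t) (uxx := fun x t => uxx (- x) t); auto; try lra.
      - apply polar_profile_reflect, Hprof.
      - intro r. apply (continuous_comp Ropp a); [|apply Hc].
        apply (continuous_opp (fun r : R => r)). apply continuous_id.
      - apply regular_solution_reflect, Hsol.
      - intros y s Hs [Iy1 Iy2]. specialize (Hsl (- y) s Hs ltac:(split; lra)). lra.
      - destruct Ix; split; lra. }
    rewrite !Ropp_involutive in Hr.
    replace (- (- x / u x t)) with (x / u x t) in Hr by (unfold Rdiv; ring). lra.
  - apply (slope_ge_profile a P Q tau th0 lo hi ((th0 ^ 2 + tau ^ 2) / 2) ((/ tau + hi) / 2)
      Th ph) with (T := T) (b := b) (xi1 := xi1) (xi2 := xi2) (uxx := uxx); auto; lra.
Qed.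

(** Differentiating u_x = Th(x / u) on the axis gives u u_t = - ph(0)^2, so u^2 + 2 ph(0)^2 t is
    constant there. Its values at [t] and at the rescaled time determine the constant. *)
Lemma centre_height (t : R) : 0 < t < T -> u 0 t = sqrt (2 * (T - t)) * ph 0.
Proof.
  pose proof Hprof as (H0 & H1 & H2 & H3 & _).
  pose proof Hsol as (Hdom & Cu & Cux & Hu & Hx & Ht & Hbc & Hsc).
  pose proof Hdom as (HT & Hb & Hpos & Hsxi & C1 & C2).
  assert (Hit : 0 < / tau) by (apply Rinv_0_lt_compat; lra).
  destruct (H3 0 ltac:(lra)) as (D1 & _ & Hp0 & _ & _).
  assert (Dw : forall r, 0 < r < T -> is_derive (fun s => u 0 s * u 0 s + 2 * ph 0 ^ 2 * s) r 0).
  { intros r Hr. assert (Tr : time_interval T r) by (split; lra).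
    destruct (Hpos r Tr) as [X1 X2].
    assert (I0 : interior_slice xi1 xi2 r 0) by (split; lra).
    assert (Hup : 0 < u 0 r) by (apply Hu; [exact Tr | split; lra]).
    assert (E0 : 0 / u 0 r = 0) by (unfold Rdiv; ring).
    destruct (Hx 0 r Tr I0) as [_ D2].
    assert (Huxx : uxx 0 r = - (ph 0 ^ 2 / a (Th 0)) / u 0 r).
    { rewrite <- (is_derive_unique _ _ _ D2). apply is_derive_unique.
      apply (is_derive_ext_loc (fun y => Th (y / u y r))).
      - apply (locally_between (- xi1 r) (xi2 r)); [exact I0|].
        intros y Hy. symmetry. apply slope_eq_profile; auto.
      - replace (- (ph 0 ^ 2 / a (Th 0)) / u 0 r)
          with ((1 - 0 / u 0 r * ux 0 r) / u 0 r * - (ph 0 ^ 2 / a (Th 0)))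
          by (field; split; [apply Rgt_not_eq, Ha | lra]).
        apply (is_derive_comp Th (fun y => y / u y r)).
        + rewrite E0. exact D1.
        + apply (is_derive_ratio a P Q tau T b xi1 xi2 u ux uxx); auto. }
    pose proof (Ht 0 r Hr I0) as Dut.
    rewrite Huxx, (slope_eq_profile 0 r Hr I0), E0 in Dut.
    pose proof (Ha (Th 0)) as Hap.
    set (v := a (Th 0) * (- (ph 0 ^ 2 / a (Th 0)) / u 0 r)) in *.
    assert (Ev : (v * u 0 r + u 0 r * v) + 2 * ph 0 ^ 2 = 0) by (unfold v; field; lra).
    enough (D : is_derive (fun s => u 0 s * u 0 s + 2 * ph 0 ^ 2 * s) r
                  ((v * u 0 r + u 0 r * v) + 2 * ph 0 ^ 2)) by (rewrite Ev in D; exact D).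
    apply (is_derive_plus (fun s => u 0 s * u 0 s) (fun s => 2 * ph 0 ^ 2 * s)).
    - apply (is_derive_mult (fun s => u 0 s) (fun s => u 0 s)); auto. intros; apply Rmult_comm.
    - auto_derive; [trivial | ring]. }
  intros Htt. assert (Tt : time_interval T t) by (split; lra).
  pose proof (rescaled_time_bounds T b t Hb ltac:(lra)) as Hr.
  assert (Hw := derive_zero_constant (fun s => u 0 s * u 0 s + 2 * ph 0 ^ 2 * s)
    t (rescaled_time T b t) ltac:(lra) ltac:(intros y Hy; apply Dw; lra)).
  simpl in Hw. destruct (Hpos t Tt) as [X1 X2].
  assert (Hs0 : u 0 t = b * u 0 (rescaled_time T b t)).
  { rewrite (Hsc 0 t Tt) by (split; lra). rewrite Rmult_0_r. reflexivity. }
  assert (Hup : 0 < u 0 t) by (apply Hu; [exact Tt | split; lra]).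
  pose proof (rescaled_time_diff T b t) as Hd. pose proof (inv_sq_bounds b Hb) as Hq.
  assert (Hv : u 0 (rescaled_time T b t) = / b * u 0 t) by (rewrite Hs0; field; lra).
  rewrite Hv in Hw.
  assert (Hqb : / b * / b = / b ^ 2) by (field; lra).
  assert (Hsq : (u 0 t) ^ 2 = (2 * (T - t)) * ph 0 ^ 2).
  { set (q := / b ^ 2) in *. set (t' := rescaled_time T b t) in *.
    assert (u 0 t ^ 2 * (1 - q) = 2 * (T - t) * ph 0 ^ 2 * (1 - q)).
    { replace (/ b * u 0 t * (/ b * u 0 t)) with (q * (u 0 t) ^ 2) in Hw by (rewrite <- Hqb; ring).
      assert (t' = T - q * (T - t)) by lra. rewrite H in Hw.
      replace (u 0 t * (u 0 t * 1)) with (u 0 t ^ 2) in * by ring. nra. }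
    apply Rmult_eq_reg_r with (1 - q); lra. }
  rewrite <- (sqrt_pow2 (u 0 t)) by lra. rewrite Hsq.
  rewrite sqrt_mult; [|lra|nra]. rewrite sqrt_pow2 by lra. reflexivity.
Qed.

(** ln u and ln ph(x / u) have the same x-derivative once the slope is that of the profile; their
    difference is read off on the axis. *)
Lemma interior_height (x t : R) : 0 < t < T -> interior_slice xi1 xi2 t x ->
  u x t = sqrt (2 * (T - t)) * ph (x / u x t).
Proof.
  pose proof Hprof as (H0 & H1 & H2 & H3 & _).
  pose proof Hsol as (Hdom & Cu & Cux & Hu & Hx & Ht & Hbc & Hsc).
  pose proof Hdom as (HT & Hb & Hpos & Hsxi & C1 & C2).
  intros Htt Ix. assert (Tt : time_interval T t) by (split; lra).
  destruct (Hpos t Tt) as [X1 X2].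
  assert (Hf : forall y, interior_slice xi1 xi2 t y ->
    is_derive (fun y => ln (u y t) - ln (ph (y / u y t))) y 0).
  { intros y Iy. pose proof (ratio_in_cone y t Htt Iy) as Hm.
    assert (Hup : 0 < u y t) by (apply Hu; [exact Tt | destruct Iy; split; lra]).
    destruct (H3 (y / u y t) ltac:(lra)) as (_ & D2 & D3 & _ & D5).
    destruct (Hx y t Tt Iy) as [D1 _].
    assert (Dm := is_derive_ratio a P Q tau T b xi1 xi2 u ux uxx Hsol y t Tt Iy).
    rewrite (slope_eq_profile y t Htt Iy) in D1, Dm.
    set (m := y / u y t) in *. set (p := Th m) in *.
    replace 0 with (p * / u y t - (1 - m * p) / u y t * (ph m * p / (1 - m * p) * / ph m))
      by (clearbody m p; field; lra).
    apply (is_derive_minus (fun y => ln (u y t)) (fun y => ln (ph (y / u y t)))).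
    - apply (is_derive_comp ln (fun y => u y t)); [apply is_derive_ln; exact Hup | exact D1].
    - apply (is_derive_comp (fun m => ln (ph m)) (fun y => y / u y t)); [|exact Dm].
      apply (is_derive_comp ln ph); [apply is_derive_ln; exact D3 | exact D2]. }
  assert (Hconst : ln (u x t) - ln (ph (x / u x t)) = ln (u 0 t) - ln (ph (0 / u 0 t))).
  { destruct (Rle_lt_dec 0 x) as [Hx0|Hx0].
    - symmetry. apply (derive_zero_constant (fun y => ln (u y t) - ln (ph (y / u y t))) 0 x Hx0).
      intros y Hy. apply Hf. destruct Ix; split; lra.
    - apply (derive_zero_constant (fun y => ln (u y t) - ln (ph (y / u y t))) x 0); [lra|].
      intros y Hy. apply Hf. destruct Ix; split; lra. }
  assert (E0 : 0 / u 0 t = 0) by (unfold Rdiv; ring). rewrite E0 in Hconst.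
  pose proof (centre_height t Htt) as Hc.
  assert (Hup : 0 < u x t) by (apply Hu; [exact Tt | destruct Ix; split; lra]).
  pose proof (ratio_in_cone x t Htt Ix) as Hm.
  destruct (H3 (x / u x t) ltac:(lra)) as (_ & _ & D3 & _ & _).
  destruct (H3 0 ltac:(lra)) as (_ & _ & D4 & _ & _).
  assert (Hs : 0 < sqrt (2 * (T - t))) by (apply sqrt_lt_R0; lra).
  rewrite Hc, ln_mult in Hconst by assumption.
  apply ln_inv; [exact Hup | apply Rmult_lt_0_compat; assumption|].
  rewrite ln_mult by assumption. lra.
Qed.

Lemma boundary_height (z m t : R) (xn : nat -> R) : 0 < t < T -> slice xi1 xi2 t z ->
  z / u z t = m -> - / tau <= m <= / tau ->
  (forall n, interior_slice xi1 xi2 t (xn n)) -> is_lim_seq xn z ->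
  u z t = sqrt (2 * (T - t)) * ph m.
Proof.
  pose proof Hprof as (H0 & H1 & H2 & H3 & _).
  pose proof Hsol as (Hdom & Cu & Cux & Hu & Hx & Ht & Hbc & Hsc).
  intros Htt Sz Ez Hm In Ln. assert (Tt : time_interval T t) by (split; lra).
  assert (Lu : is_lim_seq (fun n => u (xn n) t) (u z t)).
  { apply (Cu xn (fun _ => t) z t); auto.
    - intro n. specialize (In n). split; [exact Tt | destruct In; split; simpl in *; lra].
    - split; auto.
    - apply is_lim_seq_const. }
  assert (Hup := Hu z t Tt Sz).
  assert (Lr : is_lim_seq (fun n => sqrt (2 * (T - t)) * ph (xn n / u (xn n) t))
                 (sqrt (2 * (T - t)) * ph m)).
  { apply is_lim_seq_mult'; [apply is_lim_seq_const|].
    apply (is_lim_seq_continuous ph).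
    - destruct (H3 m ltac:(lra)) as (_ & D2 & _). apply (is_derive_continuity _ _ _ D2).
    - rewrite <- Ez. apply is_lim_seq_div'; auto. lra. }
  apply is_lim_seq_ext with (v := fun n => u (xn n) t) in Lr.
  - assert (E : Finite (u z t) = Finite (sqrt (2 * (T - t)) * ph m)); [|congruence].
    rewrite <- (is_lim_seq_unique _ _ Lu), <- (is_lim_seq_unique _ _ Lr). reflexivity.
  - intro n. symmetry. apply interior_height; auto.
Qed.

Lemma classification_pos_time (t : R) : 0 < t < T ->
  xi1 t = sqrt (2 * (T - t)) * (ph (- / tau) / tau) /\
  xi2 t = sqrt (2 * (T - t)) * (ph (/ tau) / tau) /\
  forall x, slice xi1 xi2 t x ->
    - / tau <= x / u x t <= / tau /\ u x t = sqrt (2 * (T - t)) * ph (x / u x t).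
Proof.
  pose proof Hprof as (H0 & H1 & H2 & H3 & _).
  pose proof Hsol as (Hdom & Cu & Cux & Hu & Hx & Ht & Hbc & Hsc).
  pose proof Hdom as (HT & Hb & Hpos & Hsxi & C1 & C2).
  intros Htt. assert (Tt : time_interval T t) by (split; lra).
  destruct (Hpos t Tt) as [X1 X2]. destruct (Hbc t Htt) as (_ & B2 & _ & B4).
  assert (Hit : 0 < / tau) by (apply Rinv_0_lt_compat; lra).
  assert (Hn : forall n : nat, 0 < / (INR n + 1) <= 1).
  { intro n. pose proof (pos_INR n). split; [apply Rinv_0_lt_compat; lra|].
    rewrite <- Rinv_1 at 2. apply Rinv_le_contravar; lra. }
  assert (Lz : forall z w, is_lim_seq (fun n => z + w * / (INR n + 1)) z).
  { intros z w. replace (Finite z) with (Finite (z + w * 0)) by (f_equal; ring).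
    apply is_lim_seq_plus'; [apply is_lim_seq_const|].
    apply (is_lim_seq_scal_l _ w 0). exact is_lim_seq_inv_succ. }
  assert (E1 : - xi1 t / u (- xi1 t) t = - / tau) by (rewrite B2; field; lra).
  assert (E2 : xi2 t / u (xi2 t) t = / tau) by (rewrite B4; field; lra).
  assert (U1 : u (- xi1 t) t = sqrt (2 * (T - t)) * ph (- / tau)).
  { apply (boundary_height _ _ _ (fun n => - xi1 t + xi1 t * / (INR n + 1))); auto.
    - split; lra.
    - lra.
    - intro n. specialize (Hn n). split; nra. }
  assert (U2 : u (xi2 t) t = sqrt (2 * (T - t)) * ph (/ tau)).
  { apply (boundary_height _ _ _ (fun n => xi2 t + - xi2 t * / (INR n + 1))); auto.
    - split; lra.
    - lra.
    - intro n. specialize (Hn n). split; nra. }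
  split; [|split].
  - rewrite B2 in U1. apply Rmult_eq_reg_l with tau; [|lra]. rewrite U1. field. lra.
  - rewrite B4 in U2. apply Rmult_eq_reg_l with tau; [|lra]. rewrite U2. field. lra.
  - intros x [S1 S2]. destruct (Req_dec x (- xi1 t)) as [->|N1].
    { rewrite E1. split; [lra | exact U1]. }
    destruct (Req_dec x (xi2 t)) as [->|N2].
    { rewrite E2. split; [lra | exact U2]. }
    assert (Ix : interior_slice xi1 xi2 t x) by (split; lra).
    pose proof (ratio_in_cone x t Htt Ix). split; [lra | apply interior_height; auto].
Qed.

(** The equation and the contact conditions hold for positive times; the scaling transfers the
    result to time 0. *)
Lemma classification (t : R) : time_interval T t ->
  xi1 t = sqrt (2 * (T - t)) * (ph (- / tau) / tau) /\
  xi2 t = sqrt (2 * (T - t)) * (ph (/ tau) / tau) /\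
  forall x, slice xi1 xi2 t x ->
    - / tau <= x / u x t <= / tau /\ u x t = sqrt (2 * (T - t)) * ph (x / u x t).
Proof.
  pose proof Hsol as (Hdom & Cu & Cux & Hu & Hx & Ht & Hbc & Hsc).
  pose proof Hdom as (HT & Hb & Hpos & Hsxi & C1 & C2).
  intros Tt. pose proof (rescaled_time_interval T b t Hb Tt) as Tt'.
  pose proof (rescaled_time_bounds T b t Hb ltac:(destruct Tt; lra)) as Hr.
  destruct (classification_pos_time (rescaled_time T b t)) as (K1 & K2 & K3).
  { destruct Tt. lra. }
  rewrite sqrt_gap_rescaled in * by (destruct Tt; lra).
  destruct (Hsxi t Tt) as [E1 E2]. split; [|split].
  - rewrite E1, K1. field. destruct Hprof as (? & _). lra.
  - rewrite E2, K2. field. destruct Hprof as (? & _). lra.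
  - intros x Sx. pose proof (proj1 (slice_rescale T b xi1 xi2 Hdom x t Tt) Sx) as Sx'.
    destruct (K3 _ Sx') as [M1 M2]. rewrite (Hsc x t Tt Sx).
    pose proof (Hu _ _ Tt' Sx') as Hup. set (v := u (/ b * x) _) in *.
    replace (x / (b * v)) with (/ b * x / v) by (field; lra).
    split; [exact M1|]. rewrite M2 at 1. field. lra.
Qed.

End Classification.

(** * Inverse functions and second-order differential equations *)

Lemma increasing_preimage (g dg : R -> R) (a b p q y : R) :
  (forall x, a < x < b -> is_derive g x (dg x)) ->
  a < p -> p < q -> q < b -> g p < y < g q -> exists x, p < x < q /\ g x = y.
Proof.
  intros Hd H1 H2 H3 Hy.
  destruct (IVT_interv (fun x => g x - y) p q) as [x [Hx Hx0]]; try lra.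
  - intros x Hx. apply continuity_pt_minus.
    + apply (is_derive_continuity g x (dg x)). apply Hd. lra.
    + apply continuity_pt_const. intros ? ?; reflexivity.
  - exists x. split; [|lra].
    assert (x <> p) by (intros ->; lra). assert (x <> q) by (intros ->; lra). lra.
Qed.

(** The derivative at each point comes from the difference quotient at that point alone; strict
    monotonicity supplies the continuity of the inverse. *)
Lemma local_inverse (g dg : R -> R) (a b : R) :
  (forall x, a < x < b -> is_derive g x (dg x) /\ 0 < dg x) ->
  exists h, forall x, a < x < b -> h (g x) = x /\ is_derive h (g x) (/ dg x).
Proof.
  intros Hg.
  assert (Hinc : forall x y, a < x -> x < y -> y < b -> g x < g y).
  { intros x y H1 H2 H3. apply (increasing_of_derive_pos g dg); auto.
    - intros z Hz. apply Hg. lra.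
    - intros z Hz. apply (is_derive_continuity g z (dg z)), Hg. lra.
    - intros z Hz. apply Hg. lra. }
  assert (Hinj : forall x y, a < x < b -> a < y < b -> g x = g y -> x = y).
  { intros x y Hx Hy E. destruct (Rtotal_order x y) as [H|[H|H]]; [|exact H|].
    - specialize (Hinc x y ltac:(lra) H ltac:(lra)). lra.
    - specialize (Hinc y x ltac:(lra) H ltac:(lra)). lra. }
  pose (h := fun y => epsilon (inhabits 0) (fun x => a < x < b /\ g x = y)).
  assert (Hh : forall x, a < x < b -> h (g x) = x).
  { intros x Hx. assert (H : a < h (g x) < b /\ g (h (g x)) = g x).
    { unfold h. apply (epsilon_spec (inhabits 0) (fun z => a < z < b /\ g z = g x)).
      exists x. auto. }
    apply Hinj; tauto. }
  exists h. intros x Hx. split; [apply Hh, Hx|].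
  destruct (Hg x Hx) as [Dx Px]. set (d := dg x) in *.
  apply is_derive_Reals. intros eps Heps.
  (* The first bound keeps the quotient q above d / 2; the second then gives |1 / q - 1 / d| = |q -
     d| / (q d) < eps. *)
  set (tol := Rmin (d / 2) (eps * d ^ 2 / 2)).
  assert (Htol : 0 < tol) by (apply Rmin_pos; [lra|]; apply Rdiv_lt_0_compat; [|lra];
    apply Rmult_lt_0_compat; nra).
  destruct (is_derive_quotient g x d tol Dx Htol) as [eta [Heta K]].
  set (r := Rmin (eta / 2) (Rmin ((x - a) / 2) ((b - x) / 2))).
  assert (Hr : 0 < r) by (unfold r; repeat apply Rmin_pos; lra).
  assert (R1 : r <= eta / 2) by apply Rmin_l.
  assert (R2 : r <= (x - a) / 2) by (unfold r; eapply Rle_trans; [apply Rmin_r | apply Rmin_l]).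
  assert (R3 : r <= (b - x) / 2) by (unfold r; eapply Rle_trans; [apply Rmin_r | apply Rmin_r]).
  assert (G1 : g (x - r) < g x) by (apply Hinc; lra).
  assert (G2 : g x < g (x + r)) by (apply Hinc; lra).
  assert (Hdel : 0 < Rmin (g x - g (x - r)) (g (x + r) - g x)) by (apply Rmin_pos; lra).
  exists (mkposreal _ Hdel). intros k Hk Hkd. simpl in Hkd.
  pose proof (Rmin_l (g x - g (x - r)) (g (x + r) - g x)).
  pose proof (Rmin_r (g x - g (x - r)) (g (x + r) - g x)).
  apply Rabs_lt_between in Hkd.
  destruct (increasing_preimage g dg a b (x - r) (x + r) (g x + k)) as [y [Hy Ey]]; try lra.
  { intros z Hz. apply Hg, Hz. }
  assert (Hyx : y <> x) by (intros ->; lra).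
  rewrite <- Ey, !Hh by lra.
  specialize (K y ltac:(apply Rabs_lt_between; lra) Hyx).
  replace k with (g y - g x) by lra.
  set (q := (g y - g x) / (y - x)) in *.
  assert (Hq : (y - x) / (g y - g x) = / q) by (unfold q; field; lra).
  rewrite Hq.
  pose proof (Rmin_l (d / 2) (eps * d ^ 2 / 2)) as T1. fold tol in T1.
  pose proof (Rmin_r (d / 2) (eps * d ^ 2 / 2)) as T2. fold tol in T2.
  assert (Hqd : d / 2 < q) by (apply Rabs_lt_between in K; lra).
  replace (/ q - / d) with (- (q - d) * / (q * d)) by (field; lra).
  rewrite Rabs_mult, Rabs_Ropp. rewrite (Rabs_pos_eq (/ (q * d))).
  2: { apply Rlt_le, Rinv_0_lt_compat. nra. }
  apply (Rmult_lt_reg_r (q * d)); [nra|].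
  replace (Rabs (q - d) * / (q * d) * (q * d)) with (Rabs (q - d)) by (field; lra).
  assert (eps * d ^ 2 / 2 <= eps * (q * d)).
  { replace (eps * d ^ 2 / 2) with (eps * (d ^ 2 / 2)) by field. apply Rmult_le_compat_l; nra. }
  lra.
Qed.

Lemma cosh_ge_1 (x : R) : 1 <= cosh x.
Proof.
  unfold cosh. assert (H : exp x * exp (- x) = 1) by (rewrite <- exp_plus, Rplus_opp_r; apply exp_0).
  pose proof (exp_pos (- x)). pose proof (pow2_ge_0 (exp x - exp (- x))). nra.
Qed.

Lemma is_derive_cosh_scal (K p0 p : R) :
  is_derive (fun q => cosh (K * (q - p0))) p (K * sinh (K * (p - p0))).
Proof.
  unfold cosh, sinh. auto_derive; [trivial|].
  replace (K * (p + - p0)) with (K * (p - p0)) by ring. field.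
Qed.

Lemma is_derive_sinh_scal (K p0 p : R) :
  is_derive (fun q => sinh (K * (q - p0))) p (K * cosh (K * (p - p0))).
Proof.
  unfold cosh, sinh. auto_derive; [trivial|].
  replace (K * (p + - p0)) with (K * (p - p0)) by ring. field.
Qed.

Lemma nonneg_of_second_derive_nonneg (z z1 z2 : R -> R) (p0 p : R) :
  (forall q, Rmin p0 p <= q <= Rmax p0 p -> is_derive z q (z1 q) /\ is_derive z1 q (z2 q) /\ 0 <= z2 q) ->
  z1 p0 = 0 -> z p0 <= z p /\ (p0 <= p -> 0 <= z1 p).
Proof.
  intros H H0. destruct (Rle_lt_dec p0 p) as [Hp|Hp].
  - rewrite Rmin_left, Rmax_right in H by lra.
    assert (Hz1 : forall q, p0 <= q <= p -> 0 <= z1 q).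
    { intros q Hq. rewrite <- H0. apply (nondecreasing_of_derive z1 z2); [lra| |];
        intros r Hr; apply H; lra. }
    split; [|intros _; apply Hz1; lra].
    apply (nondecreasing_of_derive z z1); [lra| |]; intros r Hr; [apply H; lra | apply Hz1; lra].
  - rewrite Rmin_right, Rmax_left in H by lra.
    assert (Hz1 : forall q, p <= q <= p0 -> z1 q <= 0).
    { intros q Hq. rewrite <- H0. apply (nondecreasing_of_derive z1 z2); [lra| |];
        intros r Hr; apply H; lra. }
    split; [|intros; lra].
    enough (- z p <= - z p0) by lra.
    apply (nondecreasing_of_derive (fun q => - z q) (fun q => - z1 q)); [lra| |].
    + intros r Hr. apply (is_derive_opp z). apply H. lra.
    + intros r Hr. specialize (Hz1 r Hr). lra.
Qed.

(** M cosh(K (p - p0)) / K^2 plus or minus y is convex with a critical point at [p0], hence minimal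
    there. *)
Lemma cosh_bound (y y1 y2 : R -> R) (K M p0 p : R) :
  0 < K ->
  (forall q, Rmin p0 p <= q <= Rmax p0 p -> is_derive y q (y1 q) /\ is_derive y1 q (y2 q) /\
     Rabs (y2 q) <= M * cosh (K * (q - p0))) ->
  y p0 = 0 -> y1 p0 = 0 ->
  Rabs (y p) <= M / K ^ 2 * (cosh (K * (p - p0)) - 1) /\
  (p0 <= p -> Rabs (y1 p) <= M / K * sinh (K * (p - p0))).
Proof.
  intros HK H Y0 Y1.
  assert (S0 : sinh (K * (p0 - p0)) = 0).
  { replace (K * (p0 - p0)) with 0 by ring. apply sinh_0. }
  assert (C0 : cosh (K * (p0 - p0)) = 1).
  { replace (K * (p0 - p0)) with 0 by ring. apply cosh_0. }
  assert (HH : forall sg, sg = 1 \/ sg = -1 ->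
    M / K ^ 2 + sg * 0 <= M / K ^ 2 * cosh (K * (p - p0)) + sg * y p /\
    (p0 <= p -> 0 <= M / K * sinh (K * (p - p0)) + sg * y1 p)).
  { intros sg Hsg.
    destruct (nonneg_of_second_derive_nonneg
      (fun q => M / K ^ 2 * cosh (K * (q - p0)) + sg * y q)
      (fun q => M / K * sinh (K * (q - p0)) + sg * y1 q)
      (fun q => M * cosh (K * (q - p0)) + sg * y2 q) p0 p) as [A B].
    - intros q Hq. destruct (H q Hq) as (D1 & D2 & D3). split; [|split].
      + apply (is_derive_plus (fun q => M / K ^ 2 * cosh (K * (q - p0))) (fun q => sg * y q)).
        * replace (M / K * sinh (K * (q - p0))) with (M / K ^ 2 * (K * sinh (K * (q - p0)))) by (field; lra).
          apply (is_derive_scal (fun q => cosh (K * (q - p0)))). apply is_derive_cosh_scal.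
        * apply (is_derive_scal y). exact D1.
      + apply (is_derive_plus (fun q => M / K * sinh (K * (q - p0))) (fun q => sg * y1 q)).
        * replace (M * cosh (K * (q - p0))) with (M / K * (K * cosh (K * (q - p0)))) by (field; lra).
          apply (is_derive_scal (fun q => sinh (K * (q - p0)))). apply is_derive_sinh_scal.
        * apply (is_derive_scal y1). exact D2.
      + apply Rabs_le_between in D3. destruct Hsg as [-> | ->]; lra.
    - rewrite S0, Y1. ring.
    - simpl in A. rewrite C0, Y0 in A. split; [simpl; lra | exact B]. }
  destruct (HH 1 (or_introl eq_refl)) as [A1 B1].
  destruct (HH (-1) (or_intror eq_refl)) as [A2 B2].
  split.
  - apply Rabs_le_between. lra.
  - intro Hp. specialize (B1 Hp). specialize (B2 Hp). apply Rabs_le_between. lra.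
Qed.

Lemma pow_half_small (Y eps : R) : 0 <= Y -> 0 < eps -> exists n : nat, 4 * ((/ 2) ^ n * Y) < eps.
Proof.
  intros HY He. destruct (pow_lt_1_zero (/ 2)) with (y := eps / (4 * Y + 1)) as [N HN].
  { rewrite Rabs_pos_eq; lra. }
  { apply Rdiv_lt_0_compat; lra. }
  exists N. specialize (HN N (Nat.le_refl N)).
  assert (Hp : 0 < (/ 2) ^ N) by (apply pow_lt; lra).
  rewrite Rabs_pos_eq in HN by lra.
  assert ((/ 2) ^ N * (4 * Y + 1) < eps).
  { replace eps with (eps / (4 * Y + 1) * (4 * Y + 1)) by (field; lra).
    apply Rmult_lt_compat_r; lra. }
  lra.
Qed.

Section Picard.

Variables (F : R -> R -> R) (B L p0 v0 s0 : R).
Hypothesis HL : 0 < L.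
Hypothesis HB : forall p v, Rabs (F p v) <= B.
Hypothesis HLip : forall p v w, Rabs (F p v - F p w) <= L * Rabs (v - w).
Hypothesis HF : forall f, (forall p, continuous f p) -> forall p, continuous (fun q => F q (f q)) p.

Let J (f : R -> R) (p : R) : R := RInt f p0 p.
Let step (f : R -> R) (p : R) : R := v0 + s0 * (p - p0) + J (J (fun q => F q (f q))) p.

Let is_derive_J (f : R -> R) : (forall p, continuous f p) -> forall p, is_derive (J f) p (f p).
Proof.
  intros Hf p. apply (is_derive_RInt f (J f) p0 p); [|apply Hf].
  apply filter_forall. intro q. apply (RInt_correct f).
  apply (ex_RInt_continuous f). intros z _. apply Hf.
Qed.

Let J0 (f : R -> R) : J f p0 = 0.
Proof. apply (RInt_point p0 f). Qed.

Let step_derive (f : R -> R) : (forall p, continuous f p) -> forall p,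
  is_derive (step f) p (s0 + J (fun q => F q (f q)) p) /\
  is_derive (fun q => s0 + J (fun r => F r (f r)) q) p (F p (f p)).
Proof.
  intros Hf p.
  assert (H1 : forall p, is_derive (J (fun q => F q (f q))) p (F p (f p))).
  { apply (is_derive_J (fun q => F q (f q))). apply HF, Hf. }
  assert (H2 : is_derive (J (J (fun q => F q (f q)))) p (J (fun q => F q (f q)) p)).
  { apply (is_derive_J (J (fun q => F q (f q)))). intro q.
    apply (ex_derive_continuous (J (fun q => F q (f q)))). eexists. apply H1. }
  split.
  - apply (is_derive_plus (fun p => v0 + s0 * (p - p0)) (J (J (fun q => F q (f q))))); [|exact H2].
    auto_derive; [trivial | ring].
  - replace (F p (f p)) with (0 + F p (f p)) by ring.
    apply (is_derive_plus (fun _ => s0) (J (fun q => F q (f q)))); [|apply H1].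
    apply (is_derive_const s0).
Qed.

Let step_continuous (f : R -> R) : (forall p, continuous f p) -> forall p, continuous (step f) p.
Proof.
  intros Hf p. apply (ex_derive_continuous (step f)).
  exists (s0 + J (fun q => F q (f q)) p). apply (proj1 (step_derive f Hf p)).
Qed.

(** In the norm weighted by cosh(K (p - p0)), two integrations gain 1 / K^2 and the Lipschitz
    constant costs L. With K^2 = 2 L the iteration contracts by 1/2 on the whole line, so no gluing
    of local solutions arises. *)
Let K : R := sqrt (2 * L).
Let HK : 0 < K.
Proof. apply sqrt_lt_R0. lra. Qed.
Let HK2 : K ^ 2 = 2 * L.
Proof. unfold K. rewrite pow2_sqrt; lra. Qed.

Let step_diff (f g : R -> R) (M : R) :
  (forall p, continuous f p) -> (forall p, continuous g p) ->
  (forall p, Rabs (F p (f p) - F p (g p)) <= M * cosh (K * (p - p0))) ->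
  forall p, Rabs (step f p - step g p) <= M / (2 * L) * cosh (K * (p - p0)).
Proof.
  intros Hf Hg HM p.
  destruct (cosh_bound (fun p => step f p - step g p)
    (fun p => (s0 + J (fun q => F q (f q)) p) - (s0 + J (fun q => F q (g q)) p))
    (fun p => F p (f p) - F p (g p)) K M p0 p HK) as [A _].
  - intros q _. destruct (step_derive f Hf q) as [F1 F2]. destruct (step_derive g Hg q) as [G1 G2].
    split; [|split; [|apply HM]].
    + apply (is_derive_minus (step f) (step g)); assumption.
    + apply (is_derive_minus (fun p => s0 + J (fun q => F q (f q)) p)
               (fun p => s0 + J (fun q => F q (g q)) p)); assumption.
  - unfold step. rewrite !J0. ring.
  - rewrite !J0. ring.
  - rewrite HK2 in A.
    assert (0 <= M / (2 * L)).
    { specialize (HM p0). replace (K * (p0 - p0)) with 0 in HM by ring. rewrite cosh_0 in HM.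
      pose proof (Rabs_pos (F p0 (f p0) - F p0 (g p0))). apply Rdiv_le_0_compat; lra. }
    nra.
Qed.

Let it (n : nat) : R -> R := Nat.iter n step (fun _ => v0).

Let it_continuous (n : nat) : forall p, continuous (it n) p.
Proof.
  induction n as [|n IH]; [intro p; apply continuous_const | apply (step_continuous _ IH)].
Qed.

(** The estimate starts with the difference of the second and first iterates: the first minus the
    zeroth still contains the linear term with [s0], while later differences involve only values of
    [F], bounded by [B]. *)
Let it_diff (n : nat) : forall p, Rabs (it (S (S n)) p - it (S n) p) <=
  B / L * (/ 2) ^ n * cosh (K * (p - p0)).
Proof.
  assert (HB0 : 0 <= B) by (eapply Rle_trans; [apply Rabs_pos | apply (HB 0 0)]).
  induction n as [|n IH]; intro p.
  - replace (B / L * (/ 2) ^ 0) with (2 * B / (2 * L)) by (field; lra).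
    apply (step_diff (it 1) (it 0) (2 * B) (it_continuous 1) (it_continuous 0)).
    intro q. pose proof (HB q (it 1 q)). pose proof (HB q (it 0 q)).
    pose proof (cosh_ge_1 (K * (q - p0))).
    assert (Rabs (F q (it 1 q) - F q (it 0 q)) <= 2 * B).
    { unfold Rminus. eapply Rle_trans; [apply Rabs_triang|]. rewrite Rabs_Ropp. lra. }
    nra.
  - replace (B / L * (/ 2) ^ S n) with (L * (B / L * (/ 2) ^ n) / (2 * L)) by (simpl; field; lra).
    apply (step_diff (it (S (S n))) (it (S n)) (L * (B / L * (/ 2) ^ n))
             (it_continuous _) (it_continuous _)).
    intro q. eapply Rle_trans; [apply HLip|]. rewrite Rmult_assoc.
    apply Rmult_le_compat_l; [lra | apply IH].
Qed.

Let B_nonneg : 0 <= B.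
Proof. eapply Rle_trans; [apply Rabs_pos | apply (HB 0 0)]. Qed.

Let it_tail (n m : nat) (p : R) :
  Rabs (it (S (m + n)) p - it (S n) p) <=
  2 * (B / L * (/ 2) ^ n * cosh (K * (p - p0))) * (1 - (/ 2) ^ m).
Proof.
  induction m as [|m IH].
  - change (0 + n)%nat with n. rewrite Rminus_diag, Rabs_R0. simpl. lra.
  - pose proof (it_diff (m + n) p) as Hd.
    change (S m + n)%nat with (S (m + n)).
    replace (it (S (S (m + n))) p - it (S n) p)
      with ((it (S (S (m + n))) p - it (S (m + n)) p) + (it (S (m + n)) p - it (S n) p)) by ring.
    eapply Rle_trans; [apply Rabs_triang|].
    rewrite pow_add in Hd. set (W := B / L) in *. set (X := cosh (K * (p - p0))) in *.
    change ((/ 2) ^ S m) with (/ 2 * (/ 2) ^ m).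
    replace (W * ((/ 2) ^ m * (/ 2) ^ n) * X) with ((W * (/ 2) ^ n * X) * (/ 2) ^ m) in Hd by ring.
    lra.
Qed.

Let it_limit (p : R) : exists l : R, is_lim_seq (fun n => it (S n) p) l /\
  forall n, Rabs (it (S n) p - l) <= 2 * (B / L * (/ 2) ^ n * cosh (K * (p - p0))).
Proof.
  set (X := cosh (K * (p - p0))).
  assert (HX : 1 <= X) by apply cosh_ge_1.
  assert (HW : 0 <= B / L) by (apply Rdiv_le_0_compat; [apply B_nonneg | exact HL]).
  assert (Hpow : forall n, 0 < (/ 2) ^ n) by (intro n; apply pow_lt; lra).
  assert (Htail : forall n m, Rabs (it (S (m + n)) p - it (S n) p) <= 2 * (B / L * (/ 2) ^ n * X)).
  { intros n m. eapply Rle_trans; [apply it_tail|]. fold X.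
    assert (0 <= B / L * (/ 2) ^ n * X).
    { apply Rmult_le_pos; [apply Rmult_le_pos; [exact HW | apply Rlt_le, Hpow] | lra]. }
    specialize (Hpow m). nra. }
  assert (Hc : ex_lim_seq_cauchy (fun n => it (S n) p)).
  { intros eps.
    destruct (pow_half_small (B / L * X) eps) as [N HN].
    { apply Rmult_le_pos; lra. }
    { apply cond_pos. }
    exists N. intros n m Hn Hm.
    pose proof (Htail N (n - N)%nat) as A1. pose proof (Htail N (m - N)%nat) as A2.
    replace (n - N + N)%nat with n in A1 by lia. replace (m - N + N)%nat with m in A2 by lia.
    apply Rabs_le_between in A1, A2. apply Rabs_lt_between. lra. }
  apply ex_lim_seq_cauchy_corr in Hc. destruct Hc as [l Hl]. exists l. split; [exact Hl|].
  intro n. assert (Hle : Rbar_le (Finite (Rabs (l - it (S n) p))) (Finite (2 * (B / L * (/ 2) ^ n * X)))).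
  { apply (is_lim_seq_le (fun m => Rabs (it (S (m + n)) p - it (S n) p))
             (fun _ => 2 * (B / L * (/ 2) ^ n * X))).
    - intro m. apply Htail.
    - apply (is_lim_seq_abs _ (l - it (S n) p)). apply is_lim_seq_minus'; [|apply is_lim_seq_const].
      apply (is_lim_seq_incr_n (fun n => it (S n) p) n). exact Hl.
    - apply is_lim_seq_const. }
  rewrite Rabs_minus_sym. exact Hle.
Qed.

Lemma picard_lindelof : exists v v1 : R -> R, v p0 = v0 /\ v1 p0 = s0 /\
  forall p, is_derive v p (v1 p) /\ is_derive v1 p (F p (v p)).
Proof.
  pose (v := fun p => proj1_sig (constructive_indefinite_description _ (it_limit p))).
  assert (Hv : forall p, is_lim_seq (fun n => it (S n) p) (v p) /\
    forall n, Rabs (it (S n) p - v p) <= 2 * (B / L * (/ 2) ^ n * cosh (K * (p - p0)))).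
  { intro p. unfold v. apply (proj2_sig (constructive_indefinite_description _ (it_limit p))). }
  clearbody v.
  assert (HW : 0 <= B / L) by (apply Rdiv_le_0_compat; [apply B_nonneg | exact HL]).
  assert (Hpow : forall n, 0 < (/ 2) ^ n) by (intro n; apply pow_lt; lra).
  assert (Hsmall : forall X eps, 0 < X -> 0 < eps -> exists n, 2 * (B / L * (/ 2) ^ n * X) < eps).
  { intros X eps HX He.
    assert (HBX : 0 <= B / L * X) by (apply Rmult_le_pos; lra).
    destruct (pow_half_small (B / L * X) eps HBX He) as [N HN].
    exists N. assert (0 <= (/ 2) ^ N * (B / L * X)).
    { apply Rmult_le_pos; [apply Rlt_le, Hpow | exact HBX]. }
    lra. }
  assert (Cv : forall p, continuous v p).
  { intro p. apply continuity_pt_filterlim. intros eps Heps.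
    (* The weight is bounded near [p], so the convergence is locally uniform and continuity passes
       to the limit. *)
    destruct (continuous_bounded (fun q => cosh (K * (q - p0))) (p - 1) (p + 1)) as (X & HX & HXb).
    { intro q. apply (ex_derive_continuous (fun q => cosh (K * (q - p0)))).
      eexists. apply is_derive_cosh_scal. }
    destruct (Hsmall X (eps / 3) HX ltac:(lra)) as [n Hn].
    assert (Ci : continuity_pt (it (S n)) p) by (apply continuity_pt_filterlim, it_continuous).
    destruct (Ci (eps / 3) ltac:(lra)) as [d [Hd Kd]]. simpl in Kd. unfold R_dist in Kd.
    exists (Rmin d 1). split; [apply Rmin_pos; lra|]. simpl. unfold R_dist.
    intros q [Hq1 Hq2]. pose proof (Rmin_l d 1). pose proof (Rmin_r d 1).
    specialize (Kd q ltac:(split; [exact Hq1 | lra])).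
    assert (Hb : forall r, p - 1 <= r <= p + 1 -> Rabs (it (S n) r - v r) < eps / 3).
    { intros r Hr. eapply Rle_lt_trans; [apply Hv|]. specialize (HXb r Hr).
      rewrite Rabs_pos_eq in HXb by (pose proof (cosh_ge_1 (K * (r - p0))); lra).
      assert (B / L * (/ 2) ^ n * cosh (K * (r - p0)) <= B / L * (/ 2) ^ n * X).
      { apply Rmult_le_compat_l; [|exact HXb]. apply Rmult_le_pos; [exact HW | apply Rlt_le, Hpow]. }
      lra. }
    apply Rabs_lt_between in Hq2.
    pose proof (Hb q ltac:(lra)) as Bq. pose proof (Hb p ltac:(lra)) as Bp.
    apply Rabs_lt_between in Bq, Bp. apply Rabs_lt_between in Kd. apply Rabs_lt_between.
    change (Nat.iter (S n) step (fun _ => v0)) with (it (S n)) in *. simpl in *. lra. }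
  assert (Fix : forall p, v p = step v p).
  { intro p. set (X := cosh (K * (p - p0))). assert (HX : 1 <= X) by apply cosh_ge_1.
    apply Rminus_diag_uniq. apply Rabs_eq_0. apply Rle_antisym; [|apply Rabs_pos].
    apply le_epsilon. intros eps Heps. rewrite Rplus_0_l.
    destruct (Hsmall X (eps / 2) ltac:(lra) ltac:(lra)) as [n Hn].
    assert (A1 : Rabs (step (it (S n)) p - step v p) <= L * (2 * (B / L * (/ 2) ^ n)) / (2 * L) * X).
    { apply (step_diff (it (S n)) v (L * (2 * (B / L * (/ 2) ^ n))) (it_continuous (S n)) Cv).
      intro q. eapply Rle_trans; [apply HLip|].
      replace (L * (2 * (B / L * (/ 2) ^ n)) * cosh (K * (q - p0)))
        with (L * (2 * (B / L * (/ 2) ^ n * cosh (K * (q - p0))))) by ring.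
      apply Rmult_le_compat_l; [lra | apply Hv]. }
    pose proof (proj2 (Hv p) (S n)) as A2. fold X in A2.
    change (it (S (S n)) p) with (step (it (S n)) p) in A2.
    replace (L * (2 * (B / L * (/ 2) ^ n)) / (2 * L) * X) with (B / L * (/ 2) ^ n * X) in A1
      by (field; lra).
    change ((/ 2) ^ S n) with (/ 2 * (/ 2) ^ n) in A2.
    apply Rabs_le_between in A1, A2. apply Rabs_le_between. lra. }
  exists v, (fun p => s0 + J (fun q => F q (v q)) p). split; [|split].
  - rewrite Fix. unfold step. rewrite J0. ring.
  - rewrite J0. ring.
  - intro p. split.
    + apply (is_derive_ext (step v)); [intro q; symmetry; apply Fix | apply (step_derive v Cv p)].
    + apply (step_derive v Cv p).
Qed.

End Picard.

(** * Existence of the profile *)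

Lemma second_order_stability (y y1 y2 : R -> R) (L e p0 p1 : R) :
  0 < L -> 0 <= e -> p0 <= p1 ->
  (forall q, p0 <= q <= p1 -> is_derive y q (y1 q) /\ is_derive y1 q (y2 q) /\
     Rabs (y2 q) <= e + L * Rabs (y q)) ->
  y p0 = 0 -> y1 p0 = 0 ->
  Rabs (y p1) <= e / L * cosh (sqrt (2 * L) * (p1 - p0)) /\
  Rabs (y1 p1) <= 2 * e / sqrt (2 * L) * sinh (sqrt (2 * L) * (p1 - p0)).
Proof.
  intros HL He Hp H Y0 Y1. set (K := sqrt (2 * L)).
  assert (HK : 0 < K) by (apply sqrt_lt_R0; lra).
  assert (HK2 : K ^ 2 = 2 * L) by (unfold K; rewrite pow2_sqrt; lra).
  assert (Hch : forall q, 1 <= cosh (K * (q - p0))) by (intro q; apply cosh_ge_1).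
  destruct (continuity_ab_maj (fun q => Rabs (y q) / cosh (K * (q - p0))) p0 p1 Hp)
    as [m [Hm Hm01]].
  { intros q Hq. apply continuity_pt_mult.
    - apply (continuity_pt_comp y Rabs); [|apply Rcontinuity_abs].
      apply (is_derive_continuity y q (y1 q)), H, Hq.
    - apply continuity_pt_inv; [|specialize (Hch q); lra].
      eapply is_derive_continuity. apply is_derive_cosh_scal. }
  set (M := Rabs (y m) / cosh (K * (m - p0))) in *. cbv beta in Hm. fold M in Hm.
  assert (HM : forall q, p0 <= q <= p1 -> Rabs (y q) <= M * cosh (K * (q - p0))).
  { intros q Hq. specialize (Hm q Hq). specialize (Hch q). cbv beta in Hm.
    apply (proj1 (Rle_div_l _ _ _ (Rlt_gt _ _ (Rlt_le_trans _ _ _ Rlt_0_1 Hch)))). exact Hm. }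
  assert (HM0 : 0 <= M).
  { unfold M. specialize (Hch m). apply Rdiv_le_0_compat; [apply Rabs_pos | lra]. }
  assert (HB : forall q, p0 <= q <= p1 ->
    Rabs (y q) <= (e + L * M) / (2 * L) * (cosh (K * (q - p0)) - 1) /\
    Rabs (y1 q) <= (e + L * M) / K * sinh (K * (q - p0))).
  { intros q Hq.
    destruct (cosh_bound y y1 y2 K (e + L * M) p0 q HK) as [A B]; auto.
    - intros r Hr. rewrite Rmin_left, Rmax_right in Hr by lra.
      destruct (H r ltac:(lra)) as (D1 & D2 & D3). split; [exact D1|]. split; [exact D2|].
      eapply Rle_trans; [exact D3|]. specialize (HM r ltac:(lra)). specialize (Hch r). nra.
    - rewrite HK2 in A. split; [exact A | apply B; lra]. }
  (* At the point where the weighted maximum M is attained, the bound from [cosh_bound] reads M <=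
     (e + L M) / (2 L), which absorbs M into the left-hand side. *)
  assert (HMe : M <= e / L).
  { destruct (HB m Hm01) as [A _]. specialize (Hch m).
    assert (E : Rabs (y m) = M * cosh (K * (m - p0))) by (unfold M; field; lra).
    rewrite E in A. set (X := cosh (K * (m - p0))) in *.
    assert (W : 0 <= (e + L * M) / (2 * L)) by (apply Rdiv_le_0_compat; nra).
    assert (M * X <= (e + L * M) / (2 * L) * X) by nra.
    assert (M <= (e + L * M) / (2 * L)) by nra.
    apply -> Rle_div_r; [|lra].
    apply <- Rle_div_r in H1; [|lra]. lra. }
  assert (HeL : e + L * M <= 2 * e).
  { assert (L * M <= L * (e / L)) by (apply Rmult_le_compat_l; lra).
    replace (L * (e / L)) with e in H0 by (field; lra). lra. }
  destruct (HB p1 ltac:(lra)) as [A B]. split.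
  - eapply Rle_trans; [exact A|]. specialize (Hch p1).
    apply Rmult_le_compat; try lra.
    + apply Rdiv_le_0_compat; nra.
    + replace (e / L) with (2 * e / (2 * L)) by (field; lra).
      apply Rmult_le_compat_r; [apply Rlt_le, Rinv_0_lt_compat; lra | exact HeL].
  - eapply Rle_trans; [exact B|]. apply Rmult_le_compat_r.
    + destruct (HB p1 ltac:(lra)) as [_ B'].
      assert (S : 0 <= sinh (K * (p1 - p0))).
      { rewrite <- sinh_0. destruct (Req_dec p0 p1) as [->|Hne].
        - replace (K * (p1 - p1)) with 0 by ring. lra.
        - apply Rlt_le, sinh_lt. apply Rmult_lt_0_compat; lra. }
      exact S.
    + apply Rmult_le_compat_r; [apply Rlt_le, Rinv_0_lt_compat; lra | exact HeL].
Qed.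

(* Legendre transform [w] of a self-similar profile as a function of the slope [p]:
   the free boundary conditions become linear Robin conditions, solved by shooting
   from [p = Q] with the scale [mu] as parameter. *)
Section Shooting.

Variables (al : R -> R) (P Q tau A am : R).
Hypothesis Hal : forall p, continuous al p.
Hypothesis HA : forall p, am <= al p <= A.
Hypothesis Ham : 0 < am.
Hypothesis HP : - tau < P < tau.
Hypothesis HQ : - tau < Q < tau.
Hypothesis HQP : Q < P.

(** The solution is convex with initial tangent (tau - p) / (tau - Q), whose value at [P] is [c].
    Cutting the nonlinearity at [c] removes the singularity at 0 without affecting the solution on p
    <= P. *)
Let c : R := (tau - P) / (tau - Q).

Let c_bounds : 0 < c < 1.
Proof.
  unfold c. split; [apply Rdiv_lt_0_compat; lra|]. apply <- Rlt_div_l; lra.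
Qed.

Let F (mu p v : R) : R := mu ^ 2 * (al p / Rmax v c).

Let inv_max_lip (v w : R) : Rabs (/ Rmax v c - / Rmax w c) <= / c ^ 2 * Rabs (v - w).
Proof.
  pose proof (Rmax_r v c) as M1. pose proof (Rmax_r w c) as M2.
  replace (/ Rmax v c - / Rmax w c) with ((Rmax w c - Rmax v c) * / (Rmax v c * Rmax w c))
    by (field; lra).
  rewrite Rabs_mult, Rmult_comm. rewrite (Rabs_pos_eq (/ _)).
  2: { apply Rlt_le, Rinv_0_lt_compat. nra. }
  apply Rmult_le_compat; try apply Rabs_pos.
  - apply Rlt_le, Rinv_0_lt_compat. nra.
  - apply Rinv_le_contravar; nra.
  - unfold Rmax. repeat destruct (Rle_dec _ _); unfold Rabs; repeat destruct (Rcase_abs _); lra.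
Qed.

Let Lip (mu : R) : R := mu ^ 2 * A / c ^ 2 + 1.

Let Lip_pos (mu : R) : 0 < Lip mu.
Proof.
  unfold Lip. pose proof (HA 0).
  assert (0 <= mu ^ 2 * A / c ^ 2) by (apply Rdiv_le_0_compat; nra). lra.
Qed.

Let F_lip (mu p v w : R) : Rabs (F mu p v - F mu p w) <= Lip mu * Rabs (v - w).
Proof.
  unfold F. replace (mu ^ 2 * (al p / Rmax v c) - mu ^ 2 * (al p / Rmax w c))
    with (mu ^ 2 * al p * (/ Rmax v c - / Rmax w c)) by (unfold Rdiv; ring).
  pose proof (HA p). pose proof (pow2_ge_0 mu).
  rewrite Rabs_mult, (Rabs_pos_eq (mu ^ 2 * al p)) by nra.
  eapply Rle_trans.
  - apply Rmult_le_compat; [nra | apply Rabs_pos | | apply inv_max_lip].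
    apply (Rmult_le_compat_l (mu ^ 2)); [lra | apply HA].
  - unfold Lip. pose proof (Rabs_pos (v - w)).
    replace (mu ^ 2 * A * (/ c ^ 2 * Rabs (v - w))) with (mu ^ 2 * A / c ^ 2 * Rabs (v - w))
      by (field; lra). lra.
Qed.

Let F_nonneg (mu p v : R) : 0 <= F mu p v <= mu ^ 2 * (A / c).
Proof.
  unfold F. pose proof (HA p). pose proof (pow2_ge_0 mu).
  pose proof (Rmax_r v c). split.
  - apply Rmult_le_pos; [lra|]. apply Rdiv_le_0_compat; lra.
  - apply Rmult_le_compat_l; [lra|]. unfold Rdiv. apply Rmult_le_compat; try lra.
    + apply Rlt_le, Rinv_0_lt_compat. lra.
    + apply Rinv_le_contravar; lra.
Qed.

Let solution_exists (mu : R) : exists vv : (R -> R) * (R -> R),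
  fst vv Q = 1 /\ snd vv Q = - / (tau - Q) /\
  forall p, is_derive (fst vv) p (snd vv p) /\ is_derive (snd vv) p (F mu p (fst vv p)).
Proof.
  destruct (picard_lindelof (F mu) (mu ^ 2 * (A / c)) (Lip mu) Q 1 (- / (tau - Q)))
    as (v & v1 & V0 & V1 & D).
  - apply Lip_pos.
  - intros p v. pose proof (F_nonneg mu p v). rewrite Rabs_pos_eq; lra.
  - intros p v w. apply F_lip.
  - intros f Hf p. unfold F. apply (continuous_scal_r (mu ^ 2) (fun q => al q / Rmax (f q) c)).
    unfold Rdiv. apply (continuous_mult al); [apply Hal|].
    apply (continuous_comp f (fun w => / Rmax w c)); [apply Hf|].
    apply continuity_pt_filterlim. intros eps Heps. exists (eps * c ^ 2).
    split; [apply Rmult_lt_0_compat; nra|]. simpl. unfold R_dist. intros x [_ Hx].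
    eapply Rle_lt_trans; [apply inv_max_lip|].
    apply (Rmult_lt_reg_l (c ^ 2)); [nra|].
    replace (c ^ 2 * (/ c ^ 2 * Rabs (x - f p))) with (Rabs (x - f p)) by (field; lra). simpl. lra.
  - exists (v, v1). auto.
Qed.

Let sol (mu : R) := proj1_sig (constructive_indefinite_description _ (solution_exists mu)).
Let v (mu : R) : R -> R := fst (sol mu).
Let v1 (mu : R) : R -> R := snd (sol mu).

Let sol_spec (mu : R) : v mu Q = 1 /\ v1 mu Q = - / (tau - Q) /\
  forall p, is_derive (v mu) p (v1 mu p) /\ is_derive (v1 mu) p (F mu p (v mu p)).
Proof. apply (proj2_sig (constructive_indefinite_description _ (solution_exists mu))). Qed.

Let above_line (mu p : R) : (tau - p) / (tau - Q) <= v mu p.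
Proof.
  destruct (sol_spec mu) as (V0 & V1 & D).
  destruct (nonneg_of_second_derive_nonneg (fun p => v mu p - (tau - p) / (tau - Q))
     (fun p => v1 mu p - - / (tau - Q)) (fun p => F mu p (v mu p)) Q p) as [H _].
  - intros q _. destruct (D q) as [D1 D2]. split; [|split; [|apply F_nonneg]].
    + apply (is_derive_minus (v mu) (fun p => (tau - p) / (tau - Q))); [exact D1|].
      auto_derive; [trivial|]. field. lra.
    + replace (F mu q (v mu q)) with (F mu q (v mu q) - 0) by ring.
      apply (is_derive_minus (v1 mu) (fun _ => - / (tau - Q))); [exact D2|].
      apply (is_derive_const (- / (tau - Q))).
  - rewrite V1. ring.
  - cbv beta in H. rewrite V0 in H.
    replace ((tau - Q) / (tau - Q)) with 1 in H by (field; lra). lra.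
Qed.

Let above_c (mu p : R) : p <= P -> c <= v mu p.
Proof.
  intro Hp. eapply Rle_trans; [|apply above_line].
  unfold c, Rdiv. apply Rmult_le_compat_r; [apply Rlt_le, Rinv_0_lt_compat; lra | lra].
Qed.

(** The Robin condition at [P] is G = 0. In [p] the derivative of G is v'' (tau + p), nonnegative
    between [Q] and [P]. *)
Let G (mu p : R) : R := v1 mu p * (tau + p) - v mu p.

Let G_derive (mu p : R) : is_derive (G mu) p (F mu p (v mu p) * (tau + p)).
Proof.
  destruct (sol_spec mu) as (_ & _ & D). destruct (D p) as [D1 D2].
  replace (F mu p (v mu p) * (tau + p))
    with ((F mu p (v mu p) * (tau + p) + v1 mu p * 1) - v1 mu p) by ring.
  apply (is_derive_minus (fun p => v1 mu p * (tau + p)) (v mu)); [|exact D1].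
  apply (is_derive_mult (v1 mu) (fun p => tau + p)); [exact D2 | | intros; apply Rmult_comm].
  auto_derive; [trivial | ring].
Qed.

Let G_start (mu : R) : G mu Q = - (2 * tau / (tau - Q)).
Proof.
  destruct (sol_spec mu) as (V0 & V1 & _). unfold G. rewrite V0, V1. field. lra.
Qed.

Let G_zero : G 0 P < 0.
Proof.
  rewrite <- (derive_zero_constant (G 0) Q P); [|lra|].
  - rewrite G_start. assert (0 < 2 * tau / (tau - Q)) by (apply Rdiv_lt_0_compat; lra). lra.
  - intros p _. pose proof (G_derive 0 p) as D. unfold F in D.
    replace (0 ^ 2 * (al p / Rmax (v 0 p) c) * (tau + p)) with 0 in D by ring. exact D.
Qed.

(** If G were nonpositive at [P], it would be so on [Q, P], making v / (tau + p) nonincreasing and v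
    at most [V]. Then v'' is at least of order mu^2, which forces G up to a positive value for large
    mu. *)
Let G_large : exists mu, 0 < mu /\ 0 < G mu P.
Proof.
  set (V := 2 * tau / (tau + Q)).
  assert (HV : 0 < V) by (apply Rdiv_lt_0_compat; lra).
  set (k := (P - Q) * (am / V * (tau + Q))).
  assert (Hk : 0 < k).
  { unfold k. apply Rmult_lt_0_compat; [lra|]. apply Rmult_lt_0_compat; [|lra].
    apply Rdiv_lt_0_compat; lra. }
  assert (Hx : 0 < 2 * tau / (tau - Q)) by (apply Rdiv_lt_0_compat; lra).
  (* G rises by at least mu^2 k >= mu k, and mu k exceeds the initial deficit 2 tau / (tau - Q) by
     k. *)
  set (mu := 2 * tau / (tau - Q) / k + 1).
  assert (Hmu1 : 1 <= mu).
  { unfold mu. assert (0 < 2 * tau / (tau - Q) / k) by (apply Rdiv_lt_0_compat; lra). lra. }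
  exists mu. split; [lra|]. apply Rnot_le_lt. intro Hneg.
  destruct (sol_spec mu) as (V0 & V1 & D).
  assert (Hmono : forall p q, Q <= p -> p <= q -> G mu p <= G mu q).
  { intros p q Hp Hq. apply (nondecreasing_of_derive (G mu) (fun p => F mu p (v mu p) * (tau + p))); auto.
    intros r Hr. apply Rmult_le_pos; [apply F_nonneg | lra]. }
  assert (HvV : forall p, Q <= p <= P -> v mu p <= V).
  { intros p Hp.
    assert (Hd : - (v mu Q / (tau + Q)) <= - (v mu p / (tau + p))).
    { apply (nondecreasing_of_derive (fun p => - (v mu p / (tau + p)))
        (fun p => - ((v1 mu p * (tau + p) - v mu p) / (tau + p) ^ 2))); [lra| |].
      - intros r Hr. apply (is_derive_opp (fun p => v mu p / (tau + p))).
        destruct (D r) as [D1 _].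
        replace ((v1 mu r * (tau + r) - v mu r) / (tau + r) ^ 2)
          with (v1 mu r * / (tau + r) + v mu r * (Ropp 1 / (tau + r) ^ 2)) by (field; lra).
        apply (is_derive_mult (v mu) (fun p => / (tau + p))); [exact D1 | | intros; apply Rmult_comm].
        apply (is_derive_inv (fun p => tau + p)); [auto_derive; [trivial | ring] | lra].
      - intros r Hr. pose proof (Hmono r P ltac:(lra) ltac:(lra)) as Hr'. unfold G in Hr', Hneg.
        assert (0 <= (- (v1 mu r * (tau + r) - v mu r)) / (tau + r) ^ 2).
        { apply Rdiv_le_0_compat; [lra | nra]. }
        unfold Rdiv in *. lra. }
    rewrite V0 in Hd.
    assert (v mu p / (tau + p) <= 1 / (tau + Q)) by lra.
    apply -> Rle_div_l in H; [|lra]. eapply Rle_trans; [exact H|]. unfold V.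
    replace (1 / (tau + Q) * (tau + p)) with ((tau + p) / (tau + Q)) by (field; lra).
    unfold Rdiv. apply Rmult_le_compat_r; [apply Rlt_le, Rinv_0_lt_compat; lra | lra]. }
  assert (Hg : G mu Q - mu ^ 2 * (am / V * (tau + Q)) * Q <= G mu P - mu ^ 2 * (am / V * (tau + Q)) * P).
  { apply (nondecreasing_of_derive (fun p => G mu p - mu ^ 2 * (am / V * (tau + Q)) * p)
      (fun p => F mu p (v mu p) * (tau + p) - mu ^ 2 * (am / V * (tau + Q)))); [lra| |].
    - intros r Hr. apply (is_derive_minus (G mu) (fun p => mu ^ 2 * (am / V * (tau + Q)) * p)).
      + apply G_derive.
      + auto_derive; [trivial | ring].
    - intros r Hr. unfold F. rewrite Rmax_left by (apply above_c; lra).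
      assert (am / V <= al r / v mu r).
      { unfold Rdiv. pose proof (HA r). pose proof (above_c mu r ltac:(lra)).
        apply Rmult_le_compat; try lra.
        - apply Rlt_le, Rinv_0_lt_compat. lra.
        - apply Rinv_le_contravar; [lra | apply HvV; lra]. }
      assert (0 < am / V) by (apply Rdiv_lt_0_compat; lra).
      assert (am / V * (tau + Q) <= al r / v mu r * (tau + r)) by (apply Rmult_le_compat; lra).
      pose proof (pow2_ge_0 mu).
      replace (mu ^ 2 * (al r / v mu r) * (tau + r) - mu ^ 2 * (am / V * (tau + Q)))
        with (mu ^ 2 * (al r / v mu r * (tau + r) - am / V * (tau + Q))) by ring.
      apply Rmult_le_pos; lra. }
  rewrite G_start in Hg.
  assert (E : mu * k = 2 * tau / (tau - Q) + k).
  { unfold mu. set (X := 2 * tau / (tau - Q)). field. lra. }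
  assert (mu * k <= mu ^ 2 * k) by (apply Rmult_le_compat_r; [lra | nra]).
  replace (mu ^ 2 * k) with (mu ^ 2 * (am / V * (tau + Q)) * P - mu ^ 2 * (am / V * (tau + Q)) * Q)
    in H by (unfold k; ring).
  lra.
Qed.

(** A change of mu acts as a forcing of size |mu^2 - nu^2| A / c; the stability estimate turns it
    into a bound for G linear in |mu^2 - nu^2|. *)
Let G_continuous (nu : R) : continuity_pt (fun mu => G mu P) nu.
Proof.
  pose proof (HA 0) as HA0.
  set (L := Lip nu). set (K := sqrt (2 * L)).
  assert (HL : 0 < L) by apply Lip_pos.
  set (B := A / c * (2 / K * Rabs (sinh (K * (P - Q))) * (tau + P) + / L * cosh (K * (P - Q))) + 1).
  assert (HK : 0 < K) by (apply sqrt_lt_R0; lra).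
  assert (HAc : 0 < A / c) by (apply Rdiv_lt_0_compat; lra).
  assert (HB : 0 < B).
  { unfold B. assert (0 <= A / c * (2 / K * Rabs (sinh (K * (P - Q))) * (tau + P) + / L * cosh (K * (P - Q)))); [|lra].
    apply Rmult_le_pos; [lra|]. apply Rplus_le_le_0_compat.
    - apply Rmult_le_pos; [|lra]. apply Rmult_le_pos; [|apply Rabs_pos]. apply Rdiv_le_0_compat; lra.
    - apply Rmult_le_pos; [apply Rlt_le, Rinv_0_lt_compat; lra|].
      pose proof (cosh_ge_1 (K * (P - Q))). lra. }
  assert (Key : forall mu, Rabs (G mu P - G nu P) <= Rabs (mu ^ 2 - nu ^ 2) * B).
  { intro mu. set (e := Rabs (mu ^ 2 - nu ^ 2) * (A / c)).
    assert (He0 : 0 <= Rabs (mu ^ 2 - nu ^ 2)) by apply Rabs_pos.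
    assert (He : 0 <= e) by (unfold e; nra).
    destruct (sol_spec mu) as (V0 & V1 & D). destruct (sol_spec nu) as (W0 & W1 & E).
    destruct (second_order_stability (fun p => v mu p - v nu p) (fun p => v1 mu p - v1 nu p)
       (fun p => F mu p (v mu p) - F nu p (v nu p)) L e Q P HL He ltac:(lra)) as [S1 S2].
    - intros q Hq. destruct (D q) as [D1 D2]. destruct (E q) as [E1 E2]. split; [|split].
      + apply (is_derive_minus (v mu) (v nu)); assumption.
      + apply (is_derive_minus (v1 mu) (v1 nu)); assumption.
      + replace (F mu q (v mu q) - F nu q (v nu q))
          with ((mu ^ 2 - nu ^ 2) * (al q / Rmax (v mu q) c) + (F nu q (v mu q) - F nu q (v nu q)))
          by (unfold F; ring).
        eapply Rle_trans; [apply Rabs_triang|]. apply Rplus_le_compat; [|apply F_lip].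
        rewrite Rabs_mult. unfold e. apply Rmult_le_compat_l; [exact He0|].
        pose proof (F_nonneg 1 q (v mu q)) as Hf. unfold F in Hf.
        rewrite Rabs_pos_eq; lra.
    - rewrite V0, W0. ring.
    - rewrite V1, W1. ring.
    - fold K in S1, S2. unfold G.
      replace (v1 mu P * (tau + P) - v mu P - (v1 nu P * (tau + P) - v nu P))
        with ((v1 mu P - v1 nu P) * (tau + P) + - (v mu P - v nu P)) by ring.
      eapply Rle_trans; [apply Rabs_triang|]. rewrite Rabs_mult, Rabs_Ropp, (Rabs_pos_eq (tau + P)) by lra.
      assert (S2' : Rabs (v1 mu P - v1 nu P) <= 2 * e / K * Rabs (sinh (K * (P - Q)))).
      { eapply Rle_trans; [exact S2|]. apply Rmult_le_compat_l; [apply Rdiv_le_0_compat; lra|].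
        apply Rle_abs. }
      assert (Rabs (v1 mu P - v1 nu P) * (tau + P) <= 2 * e / K * Rabs (sinh (K * (P - Q))) * (tau + P)).
      { apply Rmult_le_compat_r; lra. }
      replace (Rabs (mu ^ 2 - nu ^ 2) * B)
        with (2 * e / K * Rabs (sinh (K * (P - Q))) * (tau + P) + e / L * cosh (K * (P - Q))
              + Rabs (mu ^ 2 - nu ^ 2)) by (unfold B, e; field; lra).
      lra. }
  intros eps Heps.
  assert (Cq : continuity_pt (fun mu => mu ^ 2) nu).
  { apply (is_derive_continuity (fun mu => mu ^ 2) nu (2 * nu)). auto_derive; [trivial | ring]. }
  destruct (Cq (eps / B)) as [d [Hd Kd]]; [apply Rdiv_lt_0_compat; lra|].
  exists d. split; [exact Hd|]. simpl in *. unfold R_dist in *. intros x Hx.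
  specialize (Kd x Hx). specialize (Key x). eapply Rle_lt_trans; [exact Key|].
  apply <- Rlt_div_r in Kd; [|lra]. simpl. exact Kd.
Qed.

Lemma robin_problem_solvable : exists w w1 : R -> R,
  (forall p, 0 < w p) /\
  (forall p, is_derive w p (w1 p) /\ is_derive w1 p (al p / w p)) /\
  w1 Q = - (w Q / (tau - Q)) /\ w1 P = w P / (tau + P).
Proof.
  destruct G_large as (mu1 & Hmu1 & HG1).
  destruct (IVT_interv (fun mu => G mu P) 0 mu1) as [mu [Hmu HG]].
  { intros nu _. apply G_continuous. }
  { exact Hmu1. } { exact G_zero. } { exact HG1. }
  assert (Hmu0 : mu <> 0) by (intros ->; pose proof G_zero; lra).
  destruct (sol_spec mu) as (V0 & V1 & D).
  assert (HvP : v1 mu P = v mu P / (tau + P)).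
  { unfold G in HG. apply Rmult_eq_reg_r with (tau + P); [|lra].
    replace (v mu P / (tau + P) * (tau + P)) with (v mu P) by (field; lra). lra. }
  (* Beyond [P] the Robin condition gives a positive derivative and convexity keeps it positive, so
     the cut is inactive on the whole line. *)
  assert (Hc : forall p, c <= v mu p).
  { intro p. destruct (Rle_lt_dec p P) as [Hp|Hp]; [apply above_c, Hp|].
    eapply Rle_trans; [apply (above_c mu P); lra|].
    apply (nondecreasing_of_derive (v mu) (v1 mu)); [lra| |].
    - intros r _. apply D.
    - intros r Hr. apply Rle_trans with (v1 mu P).
      + rewrite HvP. apply Rdiv_le_0_compat; [pose proof (above_c mu P ltac:(lra)); lra | lra].
      + apply (nondecreasing_of_derive (v1 mu) (fun p => F mu p (v mu p))); [lra| |].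
        * intros q _. apply D.
        * intros q _. apply F_nonneg. }
  (* Dividing by mu turns v'' = mu^2 al / v into the equation without parameter; the Robin
     conditions are homogeneous and survive. *)
  exists (fun p => / mu * v mu p), (fun p => / mu * v1 mu p).
  assert (Hi : 0 < / mu) by (apply Rinv_0_lt_compat; lra).
  split; [|split; [|split]].
  - intro p. specialize (Hc p). apply Rmult_lt_0_compat; lra.
  - intro p. destruct (D p) as [D1 D2]. specialize (Hc p). split.
    + apply (is_derive_scal (v mu)). exact D1.
    + replace (al p / (/ mu * v mu p)) with (/ mu * F mu p (v mu p)).
      * apply (is_derive_scal (v1 mu)). exact D2.
      * unfold F. rewrite Rmax_left by exact Hc. field. split; lra.
  - rewrite V0, V1. field. lra.
  - rewrite HvP. field. lra.
Qed.

End Shooting.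

(** On the point of slope p the position is -w', the height [phi] is w - p w', and the ray is m =
    -w' / phi = - g(p). So [Th] is the inverse of - g, and 1 - m p = w / phi; the equation for w
    becomes g' = a / phi^2. *)
Lemma polar_profile_exists (a : R -> R) (P Q tau : R) :
  (forall r, 0 < a r) -> (forall r, continuous a r) ->
  - tau < P < tau -> - tau < Q < tau -> Q < P ->
  exists th0 lo hi Th ph, polar_profile a P Q tau th0 lo hi Th ph.
Proof.
  intros Ha Hc HP HQ HQP.
  (* Freezing [a] outside a bounded interval gives the uniform bounds of the shooting problem; only
     slopes inside it are used afterwards. *)
  set (al := fun p => a (Rmax (Q - 1) (Rmin (P + 1) p))).
  destruct (continuous_pos_bounded_below a (Q - 1) (P + 1) Hc Ha) as (am & Ham & Hlow).
  destruct (continuous_bounded a (Q - 1) (P + 1) Hc) as (A & _ & Hup).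
  assert (Hcl : forall p, Q - 1 <= Rmax (Q - 1) (Rmin (P + 1) p) <= P + 1).
  { intro p. split; [apply Rmax_l|]. apply Rmax_lub; [lra | apply Rmin_l]. }
  assert (Hal : forall p, continuous al p).
  { intro p. apply (continuous_comp (fun p => Rmax (Q - 1) (Rmin (P + 1) p)) a); [|apply Hc].
    apply continuous_of_nonexpansive. intro x.
    unfold Rmax, Rmin. repeat destruct (Rle_dec _ _); unfold Rabs; repeat destruct (Rcase_abs _); lra. }
  destruct (robin_problem_solvable al P Q tau A am Hal) as (w & w1 & Hw & Dw & RQ & RP); auto.
  { intro p. unfold al. split; [apply Hlow, Hcl|].
    eapply Rle_trans; [apply Rle_abs | apply Hup, Hcl]. }
  assert (Hala : forall p, Q - 1 < p < P + 1 -> al p = a p).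
  { intros p Hp. unfold al. rewrite Rmin_right by lra. rewrite Rmax_right by lra. reflexivity. }
  assert (Halp : forall p, 0 < al p) by (intro p; apply Ha).
  clearbody al.
  set (phi := fun p => w p - p * w1 p).
  assert (Dphi : forall p, is_derive phi p (- (p * (al p / w p)))).
  { intro p. destruct (Dw p) as [D1 D2].
    replace (- (p * (al p / w p))) with (w1 p - (1 * w1 p + p * (al p / w p))) by ring.
    apply (is_derive_minus w (fun p => p * w1 p)); [exact D1|].
    apply (is_derive_mult (fun p : R => p) w1); [auto_derive; [trivial | ring] | exact D2 |
      intros; apply Rmult_comm]. }
  assert (Hphi : forall p, Q <= p <= P -> 0 < phi p).
  { intros p Hp.
    assert (H1 : w Q + (tau - Q) * w1 Q <= w p + (tau - p) * w1 p).
    { apply (nondecreasing_of_derive (fun p => w p + (tau - p) * w1 p)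
        (fun p => w1 p + (- 1 * w1 p + (tau - p) * (al p / w p)))); [lra| |].
      - intros r Hr. destruct (Dw r) as [D1 D2].
        apply (is_derive_plus w (fun p => (tau - p) * w1 p)); [exact D1|].
        apply (is_derive_mult (fun p : R => tau - p) w1); [auto_derive; [trivial | ring] | exact D2 |
          intros; apply Rmult_comm].
      - intros r Hr. assert (0 <= (tau - r) * (al r / w r)); [|lra].
        apply Rmult_le_pos; [lra|]. apply Rlt_le, Rdiv_lt_0_compat; [apply Halp | apply Hw]. }
    assert (H2 : - (w p - (tau + p) * w1 p) <= - (w P - (tau + P) * w1 P)).
    { apply (nondecreasing_of_derive (fun p => - (w p - (tau + p) * w1 p))
        (fun p => - (w1 p - (1 * w1 p + (tau + p) * (al p / w p))))); [lra| |].
      - intros r Hr. destruct (Dw r) as [D1 D2].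
        apply (is_derive_opp (fun p => w p - (tau + p) * w1 p)).
        apply (is_derive_minus w (fun p => (tau + p) * w1 p)); [exact D1|].
        apply (is_derive_mult (fun p : R => tau + p) w1); [auto_derive; [trivial | ring] | exact D2 |
          intros; apply Rmult_comm].
      - intros r Hr. assert (0 <= (tau + r) * (al r / w r)); [|lra].
        apply Rmult_le_pos; [lra|]. apply Rlt_le, Rdiv_lt_0_compat; [apply Halp | apply Hw]. }
    assert (E1 : w Q + (tau - Q) * w1 Q = 0) by (rewrite RQ; field; lra).
    assert (E2 : w P - (tau + P) * w1 P = 0) by (rewrite RP; field; lra).
    rewrite E1 in H1. rewrite E2 in H2. unfold phi. pose proof (Hw p).
    (* [H1] and [H2] say phi + tau w' >= 0 and phi - tau w' >= 0: the profile lies in the cone. If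
       phi <= 0 then w' = 0 and phi = w > 0, a contradiction. *)
    apply Rnot_le_lt. intro Hn.
    nra. }
  assert (Cphi : forall p, continuity_pt phi p) by (intro p; eapply is_derive_continuity; apply Dphi).
  (* The profile is prolonged slightly beyond the contact slopes, still inside (- tau, tau), so that
     the edge rays are interior points of (lo, hi). *)
  assert (Hext : exists eta, 0 < eta /\ eta <= 1 /\ Q - eta > - tau /\ P + eta < tau /\
     forall p, Q - eta < p < P + eta -> 0 < phi p).
  { pose proof (Hphi Q ltac:(lra)) as FQ. pose proof (Hphi P ltac:(lra)) as FP.
    destruct (Cphi Q (phi Q) FQ) as [d1 [Hd1 K1]]. destruct (Cphi P (phi P) FP) as [d2 [Hd2 K2]].
    simpl in K1, K2. unfold R_dist in K1, K2.
    set (eta := Rmin (Rmin d1 d2) (Rmin 1 (Rmin ((Q + tau) / 2) ((tau - P) / 2)))).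
    assert (E1 : eta <= d1) by (unfold eta; eapply Rle_trans; [apply Rmin_l | apply Rmin_l]).
    assert (E2 : eta <= d2) by (unfold eta; eapply Rle_trans; [apply Rmin_l | apply Rmin_r]).
    assert (E3 : eta <= 1) by (unfold eta; eapply Rle_trans; [apply Rmin_r | apply Rmin_l]).
    assert (E4 : eta <= (Q + tau) / 2).
    { unfold eta. eapply Rle_trans; [apply Rmin_r|]. eapply Rle_trans; [apply Rmin_r | apply Rmin_l]. }
    assert (E5 : eta <= (tau - P) / 2).
    { unfold eta. eapply Rle_trans; [apply Rmin_r|]. eapply Rle_trans; [apply Rmin_r | apply Rmin_r]. }
    exists eta. split; [unfold eta; repeat apply Rmin_pos; lra|].
    split; [exact E3|]. split; [lra|]. split; [lra|]. intros p Hp.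
    destruct (Rlt_le_dec p Q) as [HpQ|HpQ].
    - assert (K : Rabs (phi p - phi Q) < phi Q).
      { apply K1. split; [split; [exact I | lra]|]. apply Rabs_lt_between. lra. }
      apply Rabs_lt_between in K. lra.
    - destruct (Rle_lt_dec p P) as [HpP|HpP]; [apply Hphi; lra|].
      assert (K : Rabs (phi p - phi P) < phi P).
      { apply K2. split; [split; [exact I | lra]|]. apply Rabs_lt_between. lra. }
      apply Rabs_lt_between in K. lra. }
  destruct Hext as (eta & Heta & Heta1 & HetaQ & HetaP & Hpos).
  set (g := fun p => w1 p / phi p).
  assert (Dg : forall p, Q - eta < p < P + eta ->
    is_derive g p (a p / phi p ^ 2) /\ 0 < a p / phi p ^ 2).
  { intros p Hp. specialize (Hpos p Hp). pose proof (Hw p) as Wp. rewrite <- Hala by lra.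
    split; [|apply Rdiv_lt_0_compat; [apply Halp | nra]].
    destruct (Dw p) as [D1 D2].
    replace (al p / phi p ^ 2)
      with (al p / w p * / phi p + w1 p * (- (- (p * (al p / w p))) / phi p ^ 2)).
    - apply (is_derive_mult w1 (fun p => / phi p)); [exact D2 | | intros; apply Rmult_comm].
      apply (is_derive_inv phi); [apply Dphi | lra].
    - assert (E : w1 p * p = w p - phi p) by (unfold phi; ring).
      replace (al p / w p * / phi p + w1 p * (- - (p * (al p / w p)) / phi p ^ 2))
        with (al p / w p * / phi p + (w1 p * p) * (al p / w p) / phi p ^ 2) by (field; lra).
      rewrite E. field. lra. }
  destruct (local_inverse g (fun p => a p / phi p ^ 2) (Q - eta) (P + eta) Dg) as [h Hh].
  assert (gQ : g Q = - / tau).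
  { unfold g, phi. rewrite RQ. pose proof (Hw Q). field. repeat split; try lra.
    replace (w Q * (tau - Q) + w Q * Q) with (w Q * tau) by ring. nra. }
  assert (gP : g P = / tau).
  { unfold g, phi. rewrite RP. pose proof (Hw P). field. repeat split; try lra.
    replace (w P * (tau + P) - w P * P) with (w P * tau) by ring. nra. }
  assert (Hginc : forall p q, Q - eta < p -> p < q -> q < P + eta -> g p < g q).
  { intros p q H1 H2 H3. apply (increasing_of_derive_pos g (fun p => a p / phi p ^ 2)); auto.
    - intros x Hx. apply Dg. lra.
    - intros x Hx. eapply is_derive_continuity. apply Dg. lra.
    - intros x Hx. apply Dg. lra. }
  set (th0 := Rmax (Rabs (Q - eta)) (Rabs (P + eta))).
  (* Half of [eta] keeps every slope reached strictly inside the interval where the inverse is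
     known. *)
  exists th0, (- g (P + eta / 2)), (- g (Q - eta / 2)), (fun m => h (- m)), (fun m => phi (h (- m))).
  split; [|split; [|split; [|split; [|split]]]].
  - unfold th0. split; [eapply Rle_trans; [apply Rabs_pos | apply Rmax_l]|].
    apply Rmax_lub_lt; apply Rabs_lt_between; lra.
  - specialize (Hginc P (P + eta / 2) ltac:(lra) ltac:(lra) ltac:(lra)). lra.
  - specialize (Hginc (Q - eta / 2) Q ltac:(lra) ltac:(lra) ltac:(lra)). lra.
  - intros m Hm.
    destruct (increasing_preimage g (fun p => a p / phi p ^ 2) (Q - eta) (P + eta)
      (Q - eta / 2) (P + eta / 2) (- m)) as (p & Hp & Ep); try lra.
    { intros x Hx. apply Dg, Hx. }
    destruct (Hh p ltac:(lra)) as [Hhp Dh]. rewrite Ep in Hhp, Dh.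
    rewrite Hhp. specialize (Hpos p ltac:(lra)). pose proof (Hw p) as Wp. pose proof (Ha p) as Ap.
    assert (Dn : is_derive (fun y : R => - y) m (- 1)) by (auto_derive; [trivial | ring]).
    assert (DTh : is_derive (fun m => h (- m)) m (- (phi p ^ 2 / a p))).
    { replace (- (phi p ^ 2 / a p)) with (- 1 * / (a p / phi p ^ 2)) by (field; lra).
      apply (is_derive_comp h (fun y => - y)); [exact Dh | exact Dn]. }
    assert (Hone : 1 - m * p = w p / phi p).
    { replace m with (- g p) by lra. unfold g.
      apply Rmult_eq_reg_r with (phi p); [|lra].
      replace ((1 - - (w1 p / phi p) * p) * phi p) with (phi p + w1 p * p) by (field; lra).
      replace (w p / phi p * phi p) with (w p) by (field; lra). unfold phi. ring. }
    split; [exact DTh|]. split; [|split; [exact Hpos|split]].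
    + rewrite Hone.
      replace (phi p * p / (w p / phi p)) with (- (phi p ^ 2 / a p) * (- (p * (al p / w p)))).
      * apply (is_derive_comp phi (fun m => h (- m))); [|exact DTh]. rewrite Hhp. apply Dphi.
      * rewrite Hala by lra. field. lra.
    + unfold th0. pose proof (Rmax_l (Rabs (Q - eta)) (Rabs (P + eta))).
      pose proof (Rmax_r (Rabs (Q - eta)) (Rabs (P + eta))).
      pose proof (Rle_abs (P + eta)). pose proof (Rabs_maj2 (Q - eta)).
      apply Rabs_le_between. lra.
    + rewrite Hone. apply Rdiv_lt_0_compat; lra.
  - rewrite Ropp_involutive, <- gP. apply Hh. lra.
  - rewrite <- gQ. apply Hh. lra.
Qed.

(** * The self-similar solution *)

Lemma is_derive_D_in (f df : R -> R) (D : R -> Prop) (x : R) :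
  is_derive f x (df x) -> D_in f df D x.
Proof.
  intro H. apply (D_in_imp f df no_cond); [intros; exact I|].
  apply derivable_pt_lim_D_in, is_derive_Reals, H.
Qed.

Section Self_similar_solution.

Variables (a : R -> R) (P Q beta th0 lo hi T b : R) (Th ph : R -> R) (k1 k2 : R -> R -> R).
Hypothesis Htau : 0 < tan beta.
Hypothesis Hprof : polar_profile a P Q (tan beta) th0 lo hi Th ph.
Hypothesis Ha : forall r, 0 < a r.
Hypothesis Hc : forall r, continuous a r.
Hypothesis HT : 0 < T.
Hypothesis Hb : 1 < b.
Hypothesis Hk : forall t u, 0 <= t < T -> 0 <= u -> k1 t u = - P /\ k2 t u = Q.

Let tau := tan beta.
Let s (t : R) : R := sqrt (2 * (T - t)).

Let s_pos (t : R) : t < T -> 0 < s t.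
Proof. intro H. apply sqrt_lt_R0. lra. Qed.

Let s_derive (t : R) : t < T -> is_derive s t (- (1 / s t)).
Proof.
  intro H. pose proof (s_pos t H). replace (- (1 / s t)) with (- (2 / (2 * s t))) by (field; lra).
  apply (is_derive_sqrt_gap T 2 t); lra.
Qed.

Let inv_tau : 0 < / tau.
Proof. apply Rinv_0_lt_compat. exact Htau. Qed.

Let prof : forall m, lo < m < hi ->
     is_derive Th m (- (ph m ^ 2 / a (Th m))) /\
     is_derive ph m (ph m * Th m / (1 - m * Th m)) /\
     0 < ph m /\ Rabs (Th m) <= th0 /\ 0 < 1 - m * Th m.
Proof. apply Hprof. Qed.

Let lo_hi : lo < - / tau /\ / tau < hi.
Proof. split; apply Hprof. Qed.

(** The rescaled position x / s of the profile on the ray m; its inverse [mu] recovers the ray from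
    the position. *)
Let Zf (m : R) : R := m * ph m.

Let Zf_derive (m : R) : lo < m < hi ->
  is_derive Zf m (ph m / (1 - m * Th m)) /\ 0 < ph m / (1 - m * Th m).
Proof.
  intro Hm. destruct (prof m Hm) as (D1 & D2 & D3 & D4 & D5).
  split; [|apply Rdiv_lt_0_compat; lra].
  replace (ph m / (1 - m * Th m)) with (1 * ph m + m * (ph m * Th m / (1 - m * Th m))) by (field; lra).
  apply (is_derive_mult (fun m : R => m) ph); [auto_derive; [trivial | ring] | exact D2 |
    intros; apply Rmult_comm].
Qed.

Let inverse_exists : exists mu, forall m, lo < m < hi ->
  mu (Zf m) = m /\ is_derive mu (Zf m) (/ (ph m / (1 - m * Th m))).
Proof. apply (local_inverse Zf (fun m => ph m / (1 - m * Th m))). exact Zf_derive. Qed.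

Let mu := proj1_sig (constructive_indefinite_description _ inverse_exists).

Let mu_spec (m : R) : lo < m < hi ->
  mu (Zf m) = m /\ is_derive mu (Zf m) (/ (ph m / (1 - m * Th m))).
Proof. apply (proj2_sig (constructive_indefinite_description _ inverse_exists)). Qed.

Let Xi1 (t : R) : R := s t * (ph (- / tau) / tau).
Let Xi2 (t : R) : R := s t * (ph (/ tau) / tau).
Let U (x t : R) : R := s t * ph (mu (x / s t)).
Let Ux (x t : R) : R := Th (mu (x / s t)).
(** Height minus position times slope: the intercept of the tangent, which is also the speed of
    descent up to the factor [/ s]. *)
Let W (m : R) : R := ph m * (1 - m * Th m).
Let Uxx (x t : R) : R := - (W (mu (x / s t)) / a (Th (mu (x / s t)))) / s t.
Let Ut (x t : R) : R := - W (mu (x / s t)) / s t.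

Let slice_param (x t : R) : t < T -> slice Xi1 Xi2 t x ->
  exists m, - / tau <= m <= / tau /\ x / s t = Zf m.
Proof.
  intros Ht [S1 S2]. pose proof (s_pos t Ht).
  assert (E1 : - (ph (- / tau) / tau) <= x / s t).
  { apply -> Rle_div_r; [|lra]. unfold Xi1 in S1. lra. }
  assert (E2 : x / s t <= ph (/ tau) / tau).
  { apply <- Rle_div_l; [|lra]. unfold Xi2 in S2. lra. }
  assert (Z1 : Zf (- / tau) = - (ph (- / tau) / tau)) by (unfold Zf, Rdiv; ring).
  assert (Z2 : Zf (/ tau) = ph (/ tau) / tau) by (unfold Zf, Rdiv; ring).
  destruct (Req_dec (x / s t) (Zf (- / tau))) as [E|N1]; [exists (- / tau); split; [lra | exact E]|].
  destruct (Req_dec (x / s t) (Zf (/ tau))) as [E|N2]; [exists (/ tau); split; [lra | exact E]|].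
  destruct (increasing_preimage Zf (fun m => ph m / (1 - m * Th m)) lo hi (- / tau) (/ tau) (x / s t))
    as (m & Hm & Em); try lra.
  - intros m Hm. apply Zf_derive, Hm.
  - exists m. split; [lra | auto].
Qed.

Let continuous_scaled (g : R -> R) (x t : R) : t < T -> continuous g (x / s t) ->
  continuous (fun z : R * R => g (fst z / s (snd z))) (x, t).
Proof.
  intros Ht Hg. apply (continuous_comp (fun z : R * R => fst z / s (snd z)) g); [|exact Hg].
  unfold Rdiv. apply (continuous_mult (fun z : R * R => fst z) (fun z => / s (snd z))).
  - apply continuous_fst.
  - apply (continuous_comp snd (fun t => / s t)); [apply continuous_snd|].
    apply (ex_derive_continuous (fun t => / s t)). eexists.
    apply (is_derive_inv s); [apply s_derive, Ht|]. pose proof (s_pos t Ht). simpl. lra.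
Qed.

Let continuous_inv_s (x t : R) : t < T -> continuous (fun z : R * R => / s (snd z)) (x, t).
Proof.
  intro Ht. apply (continuous_comp snd (fun t => / s t)); [apply continuous_snd|].
  apply (ex_derive_continuous (fun t => / s t)). eexists.
  apply (is_derive_inv s); [apply s_derive, Ht|]. pose proof (s_pos t Ht). simpl. lra.
Qed.

Let continuous_s (x t : R) : t < T -> continuous (fun z : R * R => s (snd z)) (x, t).
Proof.
  intro Ht. apply (continuous_comp snd s); [apply continuous_snd|].
  apply (ex_derive_continuous s). eexists. apply s_derive, Ht.
Qed.

Let facts (x t : R) : time_interval T t -> slice Xi1 Xi2 t x ->
  continuous mu (x / s t) /\
  continuous ph (mu (x / s t)) /\ continuous Th (mu (x / s t)) /\
  - / tau <= mu (x / s t) <= / tau /\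
  0 < ph (mu (x / s t)) /\ 0 < W (mu (x / s t)) /\
  is_derive (fun y => U y t) x (Ux x t) /\
  is_derive (fun y => Ux y t) x (Uxx x t) /\
  is_derive (fun r => U x r) t (Ut x t).
Proof.
  intros [Ht0 Ht] Sx. destruct (slice_param x t Ht Sx) as (m & Hm & Em).
  pose proof (s_pos t Ht) as Hs.
  destruct (mu_spec m ltac:(lra)) as [M1 M2].
  destruct (prof m ltac:(lra)) as (D1 & D2 & D3 & D4 & D5).
  pose proof (Ha (Th m)) as Hap.
  unfold U, Ux, Uxx, Ut. rewrite Em, M1.
  assert (Dphi : is_derive (fun z => ph (mu z)) (x / s t) (Th m)).
  { rewrite Em. replace (Th m) with (/ (ph m / (1 - m * Th m)) * (ph m * Th m / (1 - m * Th m))) at 1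
      by (field; lra).
    apply (is_derive_comp ph mu); [rewrite M1; exact D2 | exact M2]. }
  assert (DTh : is_derive (fun z => Th (mu z)) (x / s t) (- (W m / a (Th m)))).
  { rewrite Em. replace (- (W m / a (Th m)))
      with (/ (ph m / (1 - m * Th m)) * (- (ph m ^ 2 / a (Th m)))) by (unfold W; field; lra).
    apply (is_derive_comp Th mu); [rewrite M1; exact D1 | exact M2]. }
  assert (Dsc : is_derive (fun y => y / s t) x (/ s t)).
  { apply (is_derive_ext (fun y => / s t * y)); [intro y; apply Rmult_comm|].
    apply is_derive_linear. }
  split; [|split; [|split; [|split; [|split; [|split; [|split; [|split]]]]]]].
  - apply (ex_derive_continuous mu). eexists. apply M2.
  - apply (ex_derive_continuous ph). eexists. apply D2.
  - apply (ex_derive_continuous Th). eexists. apply D1.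
  - exact Hm.
  - exact D3.
  - unfold W. apply Rmult_lt_0_compat; lra.
  - replace (Th m) with (s t * (/ s t * Th m)) by (field; lra).
    apply (is_derive_scal (fun y => ph (mu (y / s t)))).
    apply (is_derive_comp (fun z => ph (mu z)) (fun y => y / s t)); [exact Dphi | exact Dsc].
  - replace (- (W m / a (Th m)) / s t) with (/ s t * - (W m / a (Th m))) by (field; lra).
    apply (is_derive_comp (fun z => Th (mu z)) (fun y => y / s t)); [exact DTh | exact Dsc].
  - replace (- W m / s t)
      with (- (1 / s t) * ph (mu (x / s t)) + s t * ((x * (- (- (1 / s t)) / s t ^ 2)) * Th m)).
    + apply (is_derive_mult s (fun r => ph (mu (x / s r)))); [apply s_derive, Ht | |
        intros; apply Rmult_comm].
      apply (is_derive_comp (fun z => ph (mu z)) (fun r => x / s r)); [exact Dphi|].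
      apply (is_derive_scal (fun r => / s r)). apply (is_derive_inv s); [apply s_derive, Ht | lra].
    + rewrite Em, M1. assert (Ex : x = Zf m * s t) by (rewrite <- Em; field; lra).
      rewrite Ex. unfold Zf, W. field. lra.
Qed.

Let U_continuous : continuous_on_domain T Xi1 Xi2 U.
Proof.
  apply continuous_on_forall. intros [x t] [Tt Sx]. simpl in Tt, Sx.
  destruct (facts x t Tt Sx) as (F1 & F2 & F3 & _). destruct Tt as [_ Ht].
  apply (continuous_mult (fun z : R * R => s (snd z)) (fun z => ph (mu (fst z / s (snd z))))).
  - apply continuous_s, Ht.
  - apply (continuous_scaled (fun z => ph (mu z))); [exact Ht|].
    apply (continuous_comp mu ph); assumption.
Qed.

Let Ux_continuous : continuous_on_domain T Xi1 Xi2 Ux.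
Proof.
  apply continuous_on_forall. intros [x t] [Tt Sx]. simpl in Tt, Sx.
  destruct (facts x t Tt Sx) as (F1 & F2 & F3 & _). destruct Tt as [_ Ht].
  apply (continuous_scaled (fun z => Th (mu z))); [exact Ht|].
  apply (continuous_comp mu Th); assumption.
Qed.

Let W_continuous (x t : R) : time_interval T t -> slice Xi1 Xi2 t x ->
  continuous (fun z => W (mu z)) (x / s t).
Proof.
  intros Tt Sx. destruct (facts x t Tt Sx) as (F1 & F2 & F3 & _).
  apply (continuous_comp mu W); [exact F1|]. unfold W.
  apply (continuous_mult ph (fun m => 1 - m * Th m)); [exact F2|].
  apply (continuous_minus (fun _ => 1) (fun m => m * Th m)); [apply continuous_const|].
  apply (continuous_mult (fun m : R => m) Th); [apply continuous_id | exact F3].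
Qed.

Let Uxx_continuous : continuous_on_domain T Xi1 Xi2 Uxx.
Proof.
  apply continuous_on_forall. intros [x t] [Tt Sx]. simpl in Tt, Sx.
  destruct (facts x t Tt Sx) as (F1 & F2 & F3 & _). pose proof (W_continuous x t Tt Sx) as CW.
  destruct Tt as [_ Ht].
  apply (continuous_mult (fun z : R * R => - (W (mu (fst z / s (snd z))) / a (Th (mu (fst z / s (snd z))))))
    (fun z => / s (snd z))); [|apply continuous_inv_s, Ht].
  apply (continuous_scaled (fun z => - (W (mu z) / a (Th (mu z))))); [exact Ht|].
  apply (continuous_opp (fun z => W (mu z) / a (Th (mu z)))).
  apply (continuous_mult (fun z => W (mu z)) (fun z => / a (Th (mu z)))); [exact CW|].
  apply (continuous_comp mu (fun m => / a (Th m))); [exact F1|].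
  apply (continuous_comp Th (fun p => / a p)); [exact F3|].
  apply (continuous_comp a Rinv); [apply Hc|]. apply continuous_Rinv. apply Rgt_not_eq, Ha.
Qed.

Let Ut_continuous : continuous_on_domain T Xi1 Xi2 Ut.
Proof.
  apply continuous_on_forall. intros [x t] [Tt Sx]. simpl in Tt, Sx.
  pose proof (W_continuous x t Tt Sx) as CW. destruct Tt as [_ Ht].
  apply (continuous_mult (fun z : R * R => - W (mu (fst z / s (snd z))))
    (fun z => / s (snd z))); [|apply continuous_inv_s, Ht].
  apply (continuous_scaled (fun z => - W (mu z))); [exact Ht|].
  apply (continuous_opp (fun z => W (mu z))). exact CW.
Qed.

Let Xi_C1 (c : R) : C1_time T (fun t => s t * c) (fun t => - (c / s t)).
Proof.
  split.
  - intros t [_ Ht]. apply is_derive_D_in. pose proof (s_pos t Ht).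
    apply (is_derive_ext (fun t => c * s t)); [intro; apply Rmult_comm|].
    replace (- (c / s t)) with (c * - (1 / s t)) by (field; lra).
    apply (is_derive_scal s). apply s_derive, Ht.
  - apply continuous_on_forall. intros t [_ Ht].
    apply (continuous_opp (fun t => c / s t)).
    apply (continuous_scal_r c (fun t => / s t)).
    apply (ex_derive_continuous (fun t => / s t)). eexists.
    apply (is_derive_inv s); [apply s_derive, Ht|]. pose proof (s_pos t Ht). simpl. lra.
Qed.

Let s_rescaled (t : R) : t < T -> s (rescaled_time T b t) = / b * s t.
Proof. intro Ht. apply sqrt_gap_rescaled; lra. Qed.

Let s_limit (c : R) : filterlim (fun t => s t * c) (at_left T) (locally 0).
Proof.
  assert (Hcont : continuous (fun t => s t * c) T).
  { apply (continuous_scal_l s c). apply (continuous_comp (fun t => 2 * (T - t)) sqrt).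
    - apply (ex_derive_continuous (fun t => 2 * (T - t))). auto_derive. trivial.
    - apply continuous_sqrt. }
  unfold continuous in Hcont.
  replace (s T * c) with 0 in Hcont.
  - intros V HV. specialize (Hcont V HV). unfold filtermap in *. unfold at_left, within.
    eapply filter_imp; [|exact Hcont]. auto.
  - unfold s. replace (2 * (T - T)) with 0 by ring. rewrite sqrt_0. ring.
Qed.

Let profile_at (sg : R) : sg = 1 \/ sg = -1 -> forall t, t < T ->
  mu (s t * (sg * (ph (sg * / tau) / tau)) / s t) = sg * / tau.
Proof.
  intros Hsg t Ht. pose proof (s_pos t Ht) as Hs.
  replace (s t * (sg * (ph (sg * / tau) / tau)) / s t) with (Zf (sg * / tau)).
  - apply mu_spec. destruct Hsg as [-> | ->]; lra.
  - unfold Zf. field. split; [exact (Rgt_not_eq _ _ Htau) | lra].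
Qed.

Lemma self_similar_solution : exists (U Ut : R -> R -> R) (Xi1 Xi2 dXi1 dXi2 : R -> R),
  discrete_shrinking_self_similar beta a k1 k2 T b U Xi1 Xi2 /\
  t_derivative T Xi1 Xi2 U Ut /\ C1_time T Xi1 dXi1 /\ C1_time T Xi2 dXi2 /\
  forall t, 0 <= t < T -> dXi1 t < 0 /\ dXi2 t < 0 /\
    forall x, - Xi1 t <= x <= Xi2 t -> Ut x t < 0.
Proof.
  destruct (prof (/ tau) ltac:(lra)) as (_ & _ & Pr & _).
  destruct (prof (- / tau) ltac:(lra)) as (_ & _ & Pl & _).
  assert (Htau' : 0 < tau) by exact Htau.
  assert (Cr : 0 < ph (/ tau) / tau) by (apply Rdiv_lt_0_compat; lra).
  assert (Cl : 0 < ph (- / tau) / tau) by (apply Rdiv_lt_0_compat; lra).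
  assert (Ht_der : t_derivative T Xi1 Xi2 U Ut).
  { split; [|exact Ut_continuous]. intros x t Tt [I1 I2].
    apply is_derive_D_in. apply facts; [exact Tt | split; lra]. }
  assert (Hxi : forall t, time_interval T t -> 0 < Xi1 t /\ 0 < Xi2 t).
  { intros t [_ Ht]. pose proof (s_pos t Ht). split; apply Rmult_lt_0_compat; lra. }
  exists U, Ut, Xi1, Xi2, (fun t => - ((ph (- / tau) / tau) / s t)), (fun t => - ((ph (/ tau) / tau) / s t)).
  split; [split; [|split; [|split; [|split; [|split]]]]|split; [exact Ht_der|split; [|split]]].
  - split; [exact Hxi|]. split; [|split; [|split; [exact U_continuous|]]].
    + intros x t Tt Sx. destruct (facts x t Tt Sx) as (_ & _ & _ & _ & F & _).
      apply Rmult_lt_0_compat; [apply s_pos, Tt | exact F].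
    + do 2 eexists. split; apply Xi_C1.
    + exists Ux, Uxx, Ut. split; [|split; [|split; [exact Ht_der|split; [|split]]]].
      * split; [|exact Ux_continuous]. intros x t Tt Sx. apply is_derive_D_in. apply facts; assumption.
      * split; [|exact Uxx_continuous]. intros x t Tt Sx. apply is_derive_D_in. apply facts; assumption.
      * intros x t Ht Ix. unfold Ut, Ux, Uxx. pose proof (s_pos t ltac:(lra)).
        pose proof (Ha (Th (mu (x / s t)))). field. lra.
      * intros t Ht.
        pose proof (s_pos t ltac:(lra)) as Hs.
        assert (Em : mu (- Xi1 t / s t) = - / tau).
        { pose proof (profile_at (-1) (or_intror eq_refl) t ltac:(lra)) as E.
          replace (-1 * / tau) with (- / tau) in E by ring.
          replace (s t * (-1 * (ph (- / tau) / tau))) with (- Xi1 t) in E by (unfold Xi1; ring).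
          exact E. }
        assert (Hup : 0 < U (- Xi1 t) t).
        { unfold U. rewrite Em. apply Rmult_lt_0_compat; lra. }
        split.
        -- destruct (Hk t (U (- Xi1 t) t) ltac:(lra) ltac:(lra)) as [-> _]. unfold Ux. rewrite Em.
           destruct Hprof as (_ & _ & _ & _ & E & _). fold tau in E. rewrite E. ring.
        -- unfold U. rewrite Em. fold tau. unfold Xi1. field. lra.
      * intros t Ht.
        pose proof (s_pos t ltac:(lra)) as Hs.
        assert (Em : mu (Xi2 t / s t) = / tau).
        { pose proof (profile_at 1 (or_introl eq_refl) t ltac:(lra)) as E.
          rewrite !Rmult_1_l in E. exact E. }
        assert (Hup : 0 < U (Xi2 t) t).
        { unfold U. rewrite Em. apply Rmult_lt_0_compat; lra. }
        split.
        -- destruct (Hk t (U (Xi2 t) t) ltac:(lra) ltac:(lra)) as [_ ->]. unfold Ux. rewrite Em.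
           destruct Hprof as (_ & _ & _ & _ & _ & E). exact E.
        -- unfold U. rewrite Em. fold tau. unfold Xi2. field. lra.
  - destruct (continuity_ab_maj ph (- / tau) (/ tau)) as [m0 [Hm0 Im0]]; [lra| |].
    { intros m Hm. destruct (prof m ltac:(lra)) as (_ & D & _). apply (is_derive_continuity _ _ _ D). }
    destruct (prof m0 ltac:(lra)) as (_ & _ & Pm & _).
    apply filterlim_locally. intros eps.
    pose proof (proj1 (filterlim_locally _ _) (s_limit (ph m0)) eps) as Hlim.
    assert (Hloc : at_left T (fun t => 0 <= t < T)).
    { exists (mkposreal T HT). intros t Hball Hlt. apply Rabs_lt_between in Hball.
      unfold minus, plus, opp in Hball. simpl in Hball. lra. }
    unfold at_left, within in *.
    generalize (filter_and _ _ Hlim Hloc). apply filter_imp. intros t [H1 H2] Hlt.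
    specialize (H1 Hlt). specialize (H2 Hlt). pose proof (s_pos t Hlt) as Hs.
    assert (Tt : time_interval T t) by (split; lra).
    destruct (Hxi t Tt) as [X1 X2].
    assert (Hsup : 0 <= sup_norm U Xi1 Xi2 t <= s t * ph m0).
    { unfold sup_norm.
      assert (Hb1 : forall x, slice Xi1 Xi2 t x -> 0 <= Rabs (U x t) <= s t * ph m0).
      { intros x Sx. split; [apply Rabs_pos|].
        destruct (facts x t Tt Sx) as (_ & _ & _ & Hm & F & _).
        unfold U. rewrite Rabs_pos_eq by (apply Rmult_le_pos; lra).
        apply Rmult_le_compat_l; [lra|]. apply Hm0, Hm. }
      destruct (Lub_Rbar_correct (fun y => exists x, slice Xi1 Xi2 t x /\ y = Rabs (U x t))) as [L1 L2].
      specialize (L2 (Finite (s t * ph m0))).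
      assert (L2' : Rbar_le (Lub_Rbar (fun y => exists x, slice Xi1 Xi2 t x /\ y = Rabs (U x t)))
                      (Finite (s t * ph m0))).
      { apply L2. intros y (x & Sx & ->). apply Hb1, Sx. }
      assert (L1' : Rbar_le (Finite (Rabs (U 0 t)))
        (Lub_Rbar (fun y => exists x, slice Xi1 Xi2 t x /\ y = Rabs (U x t)))).
      { apply L1. exists 0. split; [split; lra | reflexivity]. }
      (* [real] would send an infinite supremum to 0; the bounds from both sides exclude that
         case. *)
      destruct (Lub_Rbar _) as [l| |]; simpl in *; [|contradiction|contradiction].
      pose proof (Rabs_pos (U 0 t)). lra. }
    change (Rabs (s t * ph m0 - 0) < eps) in H1. change (Rabs (sup_norm U Xi1 Xi2 t - 0) < eps).
    rewrite Rminus_0_r in *. rewrite Rabs_pos_eq in * by lra. lra.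
  - apply s_limit.
  - apply s_limit.
  - intros x t [Ht0 Ht] _. unfold U. rewrite s_rescaled by exact Ht. pose proof (s_pos t Ht).
    replace (/ b * x / (/ b * s t)) with (x / s t) by (field; lra). field. lra.
  - intros t [Ht0 Ht]. unfold Xi1, Xi2. rewrite s_rescaled by exact Ht. split; field; lra.
  - apply Xi_C1.
  - apply Xi_C1.
  - intros t Ht. pose proof (s_pos t ltac:(lra)) as Hs. split; [|split].
    + assert (0 < ph (- / tau) / tau / s t) by (apply Rdiv_lt_0_compat; lra). lra.
    + assert (0 < ph (/ tau) / tau / s t) by (apply Rdiv_lt_0_compat; lra). lra.
    + intros x Sx. destruct (facts x t ltac:(split; lra) Sx) as (_ & _ & _ & _ & _ & F & _).
      unfold Ut. assert (0 < W (mu (x / s t)) / s t) by (apply Rdiv_lt_0_compat; lra).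
      unfold Rdiv in *. lra.
Qed.

End Self_similar_solution.

(** * Constancy of the contact slopes *)

Lemma D_in_is_derive (f df : R -> R) (D : R -> Prop) (x d : R) :
  0 < d -> (forall y, Rabs (y - x) < d -> D y) -> D_in f df D x -> is_derive f x (df x).
Proof.
  intros Hd HD H. apply is_derive_Reals. intros eps Heps.
  destruct (H eps Heps) as [e [He K]]. simpl in K. unfold R_dist in K.
  assert (Hm : 0 < Rmin d e) by (apply Rmin_pos; lra).
  exists (mkposreal _ Hm). intros h Hh Hhd. simpl in Hhd.
  pose proof (Rmin_l d e). pose proof (Rmin_r d e).
  specialize (K (x + h)). replace (x + h - x) with h in K by ring. apply K.
  split; [|lra]. split; [|lra]. apply HD. replace (x + h - x) with h by ring. lra.
Qed.

Lemma D_in_continuous (f df : R -> R) (D : R -> Prop) (x : R) :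
  D_in f df D x -> forall eps, 0 < eps ->
  exists d, 0 < d /\ forall y, D y -> Rabs (y - x) < d -> Rabs (f y - f x) < eps.
Proof.
  intros H eps Heps. apply cont_deriv in H. destruct (H eps Heps) as [d [Hd K]].
  simpl in K. unfold R_dist in K. exists d. split; [exact Hd|]. intros y Dy Hy.
  destruct (Req_dec x y) as [->|Hne].
  - rewrite Rminus_diag, Rabs_R0. exact Heps.
  - apply K. split; [split; assumption | exact Hy].
Qed.

Lemma domain_continuous_of_continuous_on (T : R) (xi1 xi2 : R -> R) (f : R -> R -> R) :
  continuous_on_domain T xi1 xi2 f -> domain_continuous T xi1 xi2 f.
Proof.
  intros Hf xn tn x t Hn Hl Lx Lt. apply is_lim_seq_spec. intro eps.
  specialize (Hf (x, t) Hl).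
  pose proof (proj1 (filterlim_locally _ _) Hf eps) as [d Hd].
  apply is_lim_seq_spec in Lx, Lt. destruct (Lx d) as [N1 H1]. destruct (Lt d) as [N2 H2].
  exists (N1 + N2)%nat. intros n Hnn.
  apply (Hd (xn n, tn n)); [|apply Hn]. split.
  - apply H1. lia.
  - apply H2. lia.
Qed.

(** At 0 the derivative is one-sided, while the mean value argument wants two-sided continuity; the
    even extension [g] provides it. *)
Lemma one_sided_mean_value (f df : R -> R) (M v : R) :
  0 <= v -> (forall w, 0 <= w -> D_in f df (fun w => 0 <= w) w) ->
  (forall w, 0 <= w <= v -> Rabs (df w) < M) -> Rabs (f v - f 0) <= M * v.
Proof.
  intros Hv Hd HM. destruct Hv as [Hv | <-].
  2: { rewrite Rminus_diag, Rabs_R0. lra. }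
  set (g := fun w => f (Rabs w)).
  assert (Dg : forall w, 0 < w -> is_derive g w (df w)).
  { intros w Hw. apply (is_derive_ext_loc f).
    - apply (locally_between 0 (w + 1)); [lra|]. intros y Hy. unfold g. rewrite Rabs_pos_eq; lra.
    - apply (D_in_is_derive f df (fun w => 0 <= w) w w Hw); [|apply Hd; lra].
      intros y Hy. apply Rabs_lt_between in Hy. lra. }
  assert (Cg : forall w, 0 <= w <= v -> continuity_pt g w).
  { intros w [[Hw | <-] _]; [apply (is_derive_continuity _ _ _ (Dg w Hw))|].
    intros eps Heps. destruct (D_in_continuous f df _ 0 (Hd 0 (Rle_refl 0)) eps Heps) as (d & Hd0 & K).
    exists d. split; [exact Hd0|]. simpl. unfold R_dist. intros x [_ Hx]. unfold g.
    rewrite (Rabs_R0). apply K; [apply Rabs_pos|]. rewrite Rminus_0_r in *. rewrite Rabs_Rabsolu. exact Hx. }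
  assert (HH : forall sg, sg = 1 \/ sg = -1 -> M * 0 + sg * g 0 < M * v + sg * g v).
  { intros sg Hsg.
    apply (increasing_of_derive_pos (fun w => M * w + sg * g w) (fun w => M + sg * df w)); [exact Hv| | |].
    - intros w Hw. apply (is_derive_plus (fun w => M * w) (fun w => sg * g w)).
      + apply is_derive_linear.
      + apply (is_derive_scal g). apply Dg. lra.
    - intros w Hw. apply continuity_pt_plus.
      + apply (is_derive_continuity _ _ _ (is_derive_linear M w)).
      + apply continuity_pt_mult; [apply continuity_pt_const; intros ? ?; reflexivity | apply Cg, Hw].
    - intros w Hw. specialize (HM w ltac:(lra)). apply Rabs_lt_between in HM.
      destruct Hsg as [-> | ->]; lra. }
  pose proof (HH 1 (or_introl eq_refl)) as A1. pose proof (HH (-1) (or_intror eq_refl)) as A2.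
  unfold g in A1, A2. rewrite Rabs_R0, (Rabs_pos_eq v) in A1, A2 by lra.
  apply Rabs_le_between. lra.
Qed.

(* The relation propagates every value of [k] to the point [(T, 0)], where [k] is continuous. *)
Lemma scale_invariant_constant (T b : R) (k kt ku : R -> R -> R) :
  0 < T -> 1 < b -> C1_quadrant k kt ku ->
  (forall t u, 0 <= t < T -> 0 <= u -> k t u = k (rescaled_time T b t) (/ b * u)) ->
  forall t u, 0 <= t < T -> 0 <= u -> k t u = k T 0.
Proof.
  intros HT Hb (Hd & _ & Cku) Hsc t u Ht Hu.
  pose proof (inv_sq_bounds b Hb) as Hq.
  assert (Hr : 0 < / b < 1).
  { split; [apply Rinv_0_lt_compat; lra|]. rewrite <- Rinv_1. apply Rinv_lt_contravar; lra. }
  set (q := / b ^ 2) in *.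
  assert (Hpw : forall (x : R) n, 0 < x < 1 -> 0 < x ^ n <= 1).
  { intros x n Hx. split; [apply pow_lt; lra|]. rewrite <- (pow1 n). apply pow_incr. lra. }
  assert (Hit : forall n, k t u = k (T - (T - t) * q ^ n) (u * (/ b) ^ n)).
  { induction n as [|n IH].
    - simpl. f_equal; ring.
    - rewrite IH. pose proof (Hpw q n Hq). pose proof (Hpw (/ b) n Hr).
      rewrite Hsc; [|split; nra|apply Rmult_le_pos; lra].
      f_equal; [|simpl; ring]. unfold rescaled_time. fold q. simpl. ring. }
  apply Rminus_diag_uniq. apply Rabs_eq_0. apply Rle_antisym; [|apply Rabs_pos].
  apply le_epsilon. intros eps Heps. rewrite Rplus_0_l.
  assert (Q0 : quadrant (T, 0)) by (split; simpl; lra).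
  (* Continuity at (T, 0) in both variables together is assembled from two facts: the u-derivative
     is bounded by [M] near that point, so k(., v) is within M v of k(., 0), and k(., 0) is
     continuous at [T]. *)
  pose proof (proj1 (filterlim_locally _ _) (Cku (T, 0) Q0) (mkposreal 1 Rlt_0_1)) as [d1 H1].
  set (M := Rabs (ku T 0) + 1). assert (HM : 0 < M) by (unfold M; pose proof (Rabs_pos (ku T 0)); lra).
  destruct (Hd T 0 ltac:(lra) ltac:(lra)) as [Dt _].
  destruct (D_in_continuous _ _ _ _ Dt (eps / 2) ltac:(lra)) as (d2 & Hd2 & K2).
  assert (Hsmall : forall x Y e, 0 < x < 1 -> 0 <= Y -> 0 < e -> exists N, forall n, (N <= n)%nat -> Y * x ^ n < e).
  { intros x Y e Hx HY He. destruct (pow_lt_1_zero x) with (y := e / (Y + 1)) as [N HN].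
    { rewrite Rabs_pos_eq; lra. } { apply Rdiv_lt_0_compat; lra. }
    exists N. intros n Hn. specialize (HN n Hn). pose proof (Hpw x n Hx) as Hp.
    rewrite Rabs_pos_eq in HN by lra.
    assert ((Y + 1) * x ^ n < (Y + 1) * (e / (Y + 1))) by (apply Rmult_lt_compat_l; lra).
    replace ((Y + 1) * (e / (Y + 1))) with e in H by (field; lra). lra. }
  pose proof (cond_pos d1) as Hd1.
  destruct (Hsmall q (T - t) (Rmin d1 d2) Hq ltac:(lra) ltac:(apply Rmin_pos; lra)) as [N1 HN1].
  destruct (Hsmall (/ b) u (Rmin d1 (eps / (2 * M))) Hr Hu
    ltac:(apply Rmin_pos; [lra | apply Rdiv_lt_0_compat; lra])) as [N2 HN2].
  set (n := (N1 + N2)%nat). specialize (HN1 n ltac:(unfold n; lia)). specialize (HN2 n ltac:(unfold n; lia)).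
  rewrite (Hit n). pose proof (Hpw q n Hq). pose proof (Hpw (/ b) n Hr).
  assert (T1 : 0 <= (T - t) * q ^ n <= T - t) by (split; nra).
  assert (U1 : 0 <= u * (/ b) ^ n) by (apply Rmult_le_pos; lra).
  set (dt := (T - t) * q ^ n) in *. set (v := u * (/ b) ^ n) in *.
  pose proof (Rmin_l d1 d2). pose proof (Rmin_r d1 d2).
  pose proof (Rmin_l d1 (eps / (2 * M))). pose proof (Rmin_r d1 (eps / (2 * M))).
  assert (B1 : Rabs (k (T - dt) v - k (T - dt) 0) <= M * v).
  { apply (one_sided_mean_value (k (T - dt)) (ku (T - dt)) M v U1).
    - intros w Hw. apply (Hd (T - dt) w); lra.
    - intros w Hw.
      assert (Hball : Rabs (ku (T - dt) w - ku T 0) < 1).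
      { apply (H1 (T - dt, w)); [|split; simpl; lra]. split.
        - change (Rabs ((T - dt) - T) < d1). apply Rabs_lt_between. lra.
        - change (Rabs (w - 0) < d1). apply Rabs_lt_between. lra. }
      unfold M. replace (ku (T - dt) w) with (ku T 0 + (ku (T - dt) w - ku T 0)) by ring.
      eapply Rle_lt_trans; [apply Rabs_triang | lra]. }
  assert (B2 : Rabs (k (T - dt) 0 - k T 0) < eps / 2).
  { apply K2; [lra|]. apply Rabs_lt_between. lra. }
  assert (M * v <= eps / 2).
  { replace (eps / 2) with (M * (eps / (2 * M))) by (field; lra). apply Rmult_le_compat_l; lra. }
  replace (k (T - dt) v - k T 0) with ((k (T - dt) v - k (T - dt) 0) + (k (T - dt) 0 - k T 0)) by ring.
  eapply Rle_trans; [apply Rabs_triang | lra].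
Qed.

(** * Reduction to regular solutions, uniqueness and conclusion *)

Lemma regular_solution_of_self_similar (beta : R) (a : R -> R) (k1 k2 : R -> R -> R) (P Q T b : R)
    (U : R -> R -> R) (Xi1 Xi2 : R -> R) :
  0 < T -> 1 < b ->
  (forall t u, 0 <= t < T -> 0 <= u -> k1 t u = - P /\ k2 t u = Q) ->
  discrete_shrinking_self_similar beta a k1 k2 T b U Xi1 Xi2 ->
  exists Ux Uxx, regular_solution a P Q (tan beta) T b Xi1 Xi2 U Ux Uxx.
Proof.
  intros HT Hb Hk ((Hpos & HU & (dxi1 & dxi2 & [D1 _] & [D2 _]) & CU & Ux & Uxx & Ut &
    [Hx CUx] & [Hxx _] & [Ht _] & Hpde & Hl & Hr) & _ & _ & _ & Hsc & Hxi).
  assert (Hdom : shrinking_domain T b Xi1 Xi2).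
  { split; [exact HT|]. split; [exact Hb|]. split; [exact Hpos|]. split; [exact Hxi|].
    split; intros t eps Tt He.
    - apply (D_in_continuous _ _ _ _ (D1 t Tt) eps He).
    - apply (D_in_continuous _ _ _ _ (D2 t Tt) eps He). }
  exists Ux, Uxx. split; [exact Hdom|].
  split; [apply domain_continuous_of_continuous_on, CU|].
  split; [apply domain_continuous_of_continuous_on, CUx|].
  split; [exact HU|]. split; [|split; [|split; [|exact Hsc]]].
  - intros x t Tt [I1 I2]. assert (Sx : slice Xi1 Xi2 t x) by (split; lra).
    assert (Hm : 0 < Rmin (x + Xi1 t) (Xi2 t - x)) by (apply Rmin_pos; lra).
    pose proof (Rmin_l (x + Xi1 t) (Xi2 t - x)). pose proof (Rmin_r (x + Xi1 t) (Xi2 t - x)).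
    assert (HD : forall y, Rabs (y - x) < Rmin (x + Xi1 t) (Xi2 t - x) -> slice Xi1 Xi2 t y).
    { intros y Hy. apply Rabs_lt_between in Hy. split; lra. }
    split.
    + apply (D_in_is_derive (fun y => U y t) (fun y => Ux y t) _ x _ Hm HD). apply Hx; assumption.
    + apply (D_in_is_derive (fun y => Ux y t) (fun y => Uxx y t) _ x _ Hm HD). apply Hxx; assumption.
  - intros x t H1 Ix. assert (Tt : time_interval T t) by (split; lra).
    rewrite <- (Hpde x t H1 Ix).
    destruct (interior_slice_open T b Xi1 Xi2 Hdom x t Tt Ix) as (d & Hd & K).
    assert (Hm : 0 < Rmin d (Rmin t (T - t))) by (repeat apply Rmin_pos; lra).
    apply (D_in_is_derive (fun s => U x s) (fun s => Ut x s)
      (fun s => time_interval T s /\ slice Xi1 Xi2 s x) t _ Hm); [|apply Ht; assumption].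
    intros s Hs. pose proof (Rmin_l d (Rmin t (T - t))). pose proof (Rmin_r d (Rmin t (T - t))).
    pose proof (Rmin_l t (T - t)). pose proof (Rmin_r t (T - t)).
    assert (Ts : time_interval T s) by (apply Rabs_lt_between in Hs; split; lra).
    split; [exact Ts|]. destruct (K s Ts ltac:(lra)). split; lra.
  - intros t H1. assert (Tt : time_interval T t) by (split; lra).
    destruct (Hpos t Tt) as [X1 X2]. destruct (Hl t H1) as [L1 L2]. destruct (Hr t H1) as [R1 R2].
    pose proof (HU (- Xi1 t) t Tt ltac:(split; lra)). pose proof (HU (Xi2 t) t Tt ltac:(split; lra)).
    destruct (Hk t (U (- Xi1 t) t) ltac:(lra) ltac:(lra)) as [E1 _].
    destruct (Hk t (U (Xi2 t) t) ltac:(lra) ltac:(lra)) as [_ E2].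
    rewrite E1 in L1. rewrite E2 in R1. repeat split; lra.
Qed.

Lemma D_in_congruence (f g df : R -> R) (D E : R -> Prop) (x : R) :
  (forall y, E y -> D y) -> (forall y, E y -> g y = f y) -> E x ->
  D_in f df D x -> D_in g df E x.
Proof.
  intros HED Hfg Ex H eps Heps. destruct (H eps Heps) as [d [Hd K]].
  exists d. split; [exact Hd|]. intros y [[Ey Hne] Hy].
  rewrite (Hfg y Ey), (Hfg x Ex). apply K. split; [split; [apply HED, Ey | exact Hne] | exact Hy].
Qed.

(** The classification fixes the free boundaries and gives x = s m ph(m) on the ray m. Since m ph(m)
    is strictly increasing, a given x lies on the same ray for both solutions, and the heights
    agree. *)
Lemma self_similar_unique (beta : R) (a : R -> R) (k1 k2 : R -> R -> R) (P Q th0 lo hi T b : R)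
    (Th ph : R -> R) (U V : R -> R -> R) (Xi1 Xi2 Eta1 Eta2 : R -> R) :
  0 < T -> 1 < b ->
  (forall r, 0 < a r) -> (forall r, ex_derive a r) -> (forall r, continuous (Derive a) r) ->
  polar_profile a P Q (tan beta) th0 lo hi Th ph ->
  (forall t u, 0 <= t < T -> 0 <= u -> k1 t u = - P /\ k2 t u = Q) ->
  discrete_shrinking_self_similar beta a k1 k2 T b U Xi1 Xi2 ->
  discrete_shrinking_self_similar beta a k1 k2 T b V Eta1 Eta2 ->
  forall t, 0 <= t < T ->
    Xi1 t = Eta1 t /\ Xi2 t = Eta2 t /\ forall x, - Xi1 t <= x <= Xi2 t -> U x t = V x t.
Proof.
  intros HT Hb Ha Hda Hca Hprof Hk HU HV t Ht.
  destruct (regular_solution_of_self_similar beta a k1 k2 P Q T b U Xi1 Xi2 HT Hb Hk HU)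
    as (Ux & Uxx & RU).
  destruct (regular_solution_of_self_similar beta a k1 k2 P Q T b V Eta1 Eta2 HT Hb Hk HV)
    as (Vx & Vxx & RV).
  destruct (classification a P Q (tan beta) th0 lo hi T b Th ph Xi1 Xi2 U Ux Uxx
    Hprof Ha Hda Hca RU t Ht) as (A1 & A2 & A3).
  destruct (classification a P Q (tan beta) th0 lo hi T b Th ph Eta1 Eta2 V Vx Vxx
    Hprof Ha Hda Hca RV t Ht) as (B1 & B2 & B3).
  assert (E1 : Xi1 t = Eta1 t) by congruence. assert (E2 : Xi2 t = Eta2 t) by congruence.
  split; [exact E1|]. split; [exact E2|]. intros x Sx.
  assert (Sx' : slice Eta1 Eta2 t x) by (unfold slice; lra).
  destruct (A3 x Sx) as [M1 U1]. destruct (B3 x Sx') as [M2 U2].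
  destruct RU as (_ & _ & _ & PU & _). destruct RV as (_ & _ & _ & PV & _).
  specialize (PU x t Ht Sx). specialize (PV x t Ht Sx').
  assert (Hs : 0 < sqrt (2 * (T - t))) by (apply sqrt_lt_R0; lra).
  pose proof Hprof as (H0 & H1 & H2 & H3 & _).
  set (m := x / U x t) in *. set (n := x / V x t) in *.
  assert (X1 : x = sqrt (2 * (T - t)) * (m * ph m)).
  { replace (sqrt (2 * (T - t)) * (m * ph m)) with (m * (sqrt (2 * (T - t)) * ph m)) by ring.
    rewrite <- U1. unfold m. field. lra. }
  assert (X2 : x = sqrt (2 * (T - t)) * (n * ph n)).
  { replace (sqrt (2 * (T - t)) * (n * ph n)) with (n * (sqrt (2 * (T - t)) * ph n)) by ring.
    rewrite <- U2. unfold n. field. lra. }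
  assert (Hmn : m * ph m = n * ph n).
  { apply Rmult_eq_reg_l with (sqrt (2 * (T - t))); lra. }
  assert (Hinc : forall p q, - / tan beta <= p -> p < q -> q <= / tan beta -> p * ph p < q * ph q).
  { assert (D : forall r, lo < r < hi -> is_derive (fun r => r * ph r) r (ph r / (1 - r * Th r))).
    { intros r Hr. destruct (H3 r Hr) as (_ & D2 & D3 & _ & D5).
      replace (ph r / (1 - r * Th r)) with (1 * ph r + r * (ph r * Th r / (1 - r * Th r))) by (field; lra).
      apply (is_derive_mult (fun r : R => r) ph); [auto_derive; [trivial | ring] | exact D2 |
        intros; apply Rmult_comm]. }
    intros p q Hp Hpq Hq.
    apply (increasing_of_derive_pos (fun r => r * ph r) (fun r => ph r / (1 - r * Th r))); [exact Hpq| | |].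
    - intros r Hr. apply D. lra.
    - intros r Hr. eapply is_derive_continuity. apply D. lra.
    - intros r Hr. destruct (H3 r ltac:(lra)) as (_ & _ & D3 & _ & D5). apply Rdiv_lt_0_compat; lra. }
  assert (E : m = n).
  { destruct (Rtotal_order m n) as [Hlt|[Heq|Hgt]]; [|exact Heq|].
    - specialize (Hinc m n ltac:(lra) Hlt ltac:(lra)). lra.
    - specialize (Hinc n m ltac:(lra) Hgt ltac:(lra)). lra. }
  rewrite U1, U2, E. reflexivity.
Qed.

Theorem theorem1p4 (beta : R) (a : R -> R) (k1 k2 : R -> R -> R) (T b : R)
    (hbeta : 0 < beta < PI / 2)
    (ha : C2_line a) (ha_pos : forall p : R, 0 < a p)
    (hk1 : C2_quadrant k1) (hk2 : C2_quadrant k2)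
    (hT : 0 < T) (hb : 1 < b)
    (hk_scal : forall t u : R, 0 <= t < T -> 0 <= u ->
       k1 t u = k1 (rescaled_time T b t) (/ b * u) /\
       k2 t u = k2 (rescaled_time T b t) (/ b * u))
    (hk_bound : exists sigma : R, 0 < sigma < tan beta /\
       forall t u : R, 0 <= t -> 0 <= u ->
         Rabs (k1 t u) <= tan beta - sigma /\ Rabs (k2 t u) <= tan beta - sigma)
    (m1 m2 : R)
    (hm1 : is_lub (quadrant_range k1) m1) (hm2 : is_lub (quadrant_range k2) m2)
    (hm : m1 + m2 < 0) :
  (exists (U : R -> R -> R) (Xi1 Xi2 : R -> R),
     discrete_shrinking_self_similar beta a k1 k2 T b U Xi1 Xi2) /\
  ((forall t s u : R, 0 <= t -> 0 <= s -> 0 <= u ->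
      k1 t u = k1 s u /\ k2 t u = k2 s u) ->
   (forall (U V : R -> R -> R) (Xi1 Xi2 Eta1 Eta2 : R -> R),
      discrete_shrinking_self_similar beta a k1 k2 T b U Xi1 Xi2 ->
      discrete_shrinking_self_similar beta a k1 k2 T b V Eta1 Eta2 ->
      forall t : R, 0 <= t < T ->
        Xi1 t = Eta1 t /\ Xi2 t = Eta2 t /\
        forall x : R, - Xi1 t <= x <= Xi2 t -> U x t = V x t) /\
   (forall (U : R -> R -> R) (Xi1 Xi2 : R -> R),
      discrete_shrinking_self_similar beta a k1 k2 T b U Xi1 Xi2 ->
      exists (Ut : R -> R -> R) (dXi1 dXi2 : R -> R),
        t_derivative T Xi1 Xi2 U Ut /\
        C1_time T Xi1 dXi1 /\ C1_time T Xi2 dXi2 /\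
        forall t : R, 0 <= t < T ->
          dXi1 t < 0 /\ dXi2 t < 0 /\
          forall x : R, - Xi1 t <= x <= Xi2 t -> Ut x t < 0)).
Proof.
  destruct hk_bound as (sigma & Hsig & Hbd).
  assert (Htau : 0 < tan beta) by lra.
  destruct hk1 as (k1t & k1u & _ & _ & _ & _ & C1 & _).
  destruct hk2 as (k2t & k2u & _ & _ & _ & _ & C2 & _).
  set (P := - k1 T 0). set (Q := k2 T 0).
  assert (Hk : forall t u, 0 <= t < T -> 0 <= u -> k1 t u = - P /\ k2 t u = Q).
  { intros t u Ht Hu. unfold P, Q. rewrite Ropp_involutive. split.
    - apply (scale_invariant_constant T b k1 k1t k1u hT hb C1); auto. intros; apply hk_scal; auto.
    - apply (scale_invariant_constant T b k2 k2t k2u hT hb C2); auto. intros; apply hk_scal; auto. }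
  destruct (Hbd T 0 ltac:(lra) ltac:(lra)) as [B1 B2]. apply Rabs_le_between in B1, B2.
  (* The suprema dominate the values at (T, 0), so k1 + k2 < 0 there; this is the sign for which the
     slope of the profile decreases from left to right. *)
  assert (HQP : Q < P).
  { destruct hm1 as [U1 _]. destruct hm2 as [U2 _].
    assert (k1 T 0 <= m1) by (apply U1; exists T, 0; repeat split; lra).
    assert (k2 T 0 <= m2) by (apply U2; exists T, 0; repeat split; lra).
    unfold P, Q. lra. }
  assert (Hda : forall r, ex_derive a r) by (intro r; apply (ha 1%nat r); lia).
  assert (Hca : forall r, continuous (Derive a) r) by (intro r; apply (ha 1%nat r); lia).
  assert (Hc : forall r, continuous a r) by (intro r; apply (ex_derive_continuous a), Hda).
  destruct (polar_profile_exists a P Q (tan beta) ha_pos Hc) as (th0 & lo & hi & Th & ph & Hprof);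
    [unfold P; lra | unfold Q; lra | exact HQP|].
  destruct (self_similar_solution a P Q beta th0 lo hi T b Th ph k1 k2 Htau Hprof ha_pos Hc hT hb Hk)
    as (U0 & Ut & Xi1 & Xi2 & dXi1 & dXi2 & S0 & Ht & HX1 & HX2 & Hneg).
  split; [exists U0, Xi1, Xi2; exact S0|]. intros _. split.
  - intros U V Y1 Y2 Z1 Z2 HU HV.
    apply (self_similar_unique beta a k1 k2 P Q th0 lo hi T b Th ph U V Y1 Y2 Z1 Z2); assumption.
  (* By uniqueness [U] agrees with the explicit solution on its domain. Derivatives are taken
     relative to that domain, so those of the explicit solution, whose signs are known, serve for
     [U]. *)
  - intros U Y1 Y2 HU.
    assert (E := self_similar_unique beta a k1 k2 P Q th0 lo hi T b Th ph U U0 Y1 Y2 Xi1 Xi2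
      hT hb ha_pos Hda Hca Hprof Hk HU S0).
    assert (EX1 : forall t, time_interval T t -> Y1 t = Xi1 t) by (intros t Tt; apply E, Tt).
    assert (EX2 : forall t, time_interval T t -> Y2 t = Xi2 t) by (intros t Tt; apply E, Tt).
    assert (EU : forall t x, time_interval T t -> slice Y1 Y2 t x -> U x t = U0 x t).
    { intros t x Tt. apply E, Tt. }
    assert (ES : forall t x, time_interval T t -> slice Y1 Y2 t x -> slice Xi1 Xi2 t x).
    { intros t x Tt Sx. unfold slice in *. rewrite <- (EX1 t Tt), <- (EX2 t Tt). exact Sx. }
    exists Ut, dXi1, dXi2. split; [|split; [|split]].
    + destruct Ht as [HtD HtC]. split.
      * intros x t Tt [I1 I2]. assert (Sx : slice Y1 Y2 t x) by (split; lra).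
        apply (D_in_congruence (fun s => U0 x s) (fun s => U x s) (fun s => Ut x s)
          (fun s => time_interval T s /\ slice Xi1 Xi2 s x)).
        -- intros s [Ts Ss]. split; [exact Ts | apply ES; assumption].
        -- intros s [Ts Ss]. apply EU; assumption.
        -- split; assumption.
        -- apply HtD; [exact Tt|]. unfold interior_slice. rewrite <- (EX1 t Tt), <- (EX2 t Tt). lra.
      * intros z [Tz Sz]. intros W HW. specialize (HtC z (conj Tz (ES _ _ Tz Sz)) W HW).
        unfold filtermap, within in *. revert HtC. apply filter_imp.
        intros y Hy [Ty Sy]. apply Hy. split; [exact Ty | apply ES; assumption].
    + destruct HX1 as [D1 Cd1]. split; [|exact Cd1]. intros t Tt.
      apply (D_in_congruence Xi1 Y1 dXi1 (time_interval T) (time_interval T)); auto.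
    + destruct HX2 as [D2 Cd2]. split; [|exact Cd2]. intros t Tt.
      apply (D_in_congruence Xi2 Y2 dXi2 (time_interval T) (time_interval T)); auto.
    + intros t Htt. destruct (Hneg t Htt) as (N1 & N2 & N3). split; [exact N1|]. split; [exact N2|].
      intros x Sx. apply N3. apply (ES t x Htt Sx).
Qed.
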